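(* Let $n\ge1$, $\mathfrak g=\mathfrak{osp}(2|2n)$, let $q$ be generic, and let $\mathcal A\subset U_q(\mathfrak g)^\circ$ be the algebra of functions on $\mathrm{OSP}_q(2|2n)$, i.e. the subalgebra (a sub-Hopf-superalgebra) generated by the matrix elements $t_{ab}$ of the vector representation $t$ of $U_q(\mathfrak g)$. Let $\mathcal P:U_q(\mathfrak g)^\circ\to U_q(\mathfrak g_0)^\circ$ be restriction to $U_q(\mathfrak g_0)=U_q(\mathfrak{sp}(2n)\oplus\mathfrak{gl}(1))$, let $\int_0$ be the left integral on $\mathcal A_e=\mathcal P(\mathcal A)$ with $\int_01_{\mathcal A_e}=1$, and let $\Gamma=\mathbb E\,\mathbb F$ with $$\mathbb E=\psi_1\psi_2\cdots\psi_n\psi_{-n}\psi_{-n+1}\cdots\psi_{-1},\qquad\mathbb F=\phi_{-1}\phi_{-2}\cdots\phi_{-n}\phi_n\phi_{n-1}\cdots\phi_1.$$ Then the linear form $\int=\nu(\Gamma)\cdot(\int_0\circ\mathcal P|_{\mathcal A}):\mathcal A\to\mathbb C$ is a left integral on $\mathcal A$.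
   Context: Everything is over $\mathbb C$ and $\mathbb Z_2$-graded, with the super sign rule; $[x]$ is the degree of a homogeneous element; $q\in\mathbb C^\times$ is generic (in particular not a root of unity) and a square root of $q$ is fixed. Let $\delta_0,\dots,\delta_n$ be a basis with bilinear form $(\delta_i,\delta_j)=-(-1)^{\delta_{0,i}}\delta_{i,j}$; simple roots $\alpha_i=\delta_i-\delta_{i+1}$ ($0\le i<n$), $\alpha_n=2\delta_n$; $a_{ij}=2(\alpha_i,\alpha_j)/(\alpha_i,\alpha_i)$ for $i>0$, $a_{0j}=(\alpha_0,\alpha_j)$; $q_0=q$, $q_i=q^{(\alpha_i,\alpha_i)/2}$ for $i>0$. $U_q(\mathfrak g)$ is generated by $k_i^{\pm1},e_i,f_i$, $0\le i\le n$, with $e_0,f_0$ odd and the rest even, and relations: $k_ik_j=k_jk_i$, $k_ik_i^{-1}=k_i^{-1}k_i=1$; $k_ie_jk_i^{-1}=q_i^{a_{ij}/2}e_j$, $k_if_jk_i^{-1}=q_i^{-a_{ij}/2}f_j$; $[e_i,f_j]=\delta_{ij}(k_i^2-k_i^{-2})/(q_i-q_i^{-1})$ (graded bracket); $e_0^2=f_0^2=0$; and for $i\ne0$, $j\ne i$, $\sum_{\mu=0}^{1-a_{ij}}(-1)^\mu\binom{1-a_{ij}}{\mu}_{q_i}x_i^{1-a_{ij}-\mu}x_jx_i^\mu=0$ for $x=e$ and $x=f$ (symmetric $q$-binomials). Hopf structure (standard): $\Delta(k_i)=k_i\otimes k_i$, $\Delta(e_i)=e_i\otimes k_i+k_i^{-1}\otimes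 e_i$, $\Delta(f_i)=f_i\otimes k_i+k_i^{-1}\otimes f_i$, $\varepsilon(k_i)=1$, $\varepsilon(e_i)=\varepsilon(f_i)=0$. $U_q(\mathfrak g_0)$ is the Hopf subalgebra generated by $e_i,f_i$ ($1\le i\le n$) and all $k_i^{\pm1}$ ($0\le i\le n$). Odd elements: $\psi_1=e_0$; $\psi_{i+1}=\psi_ie_i-qe_i\psi_i$ ($1\le i<n$); $\psi_{-n}=\psi_ne_n-q^2e_n\psi_n$; $\psi_{-i}=\psi_{-i-1}e_i-qe_i\psi_{-i-1}$ ($1\le i<n$); $\phi_1=f_0$; $\phi_{i+1}=f_i\phi_i-q^{-1}\phi_if_i$ ($1\le i<n$); $\phi_{-n}=f_n\phi_n-q^{-2}\phi_nf_n$; $\phi_{-i}=f_i\phi_{-i-1}-q^{-1}\phi_{-i-1}f_i$ ($1\le i<n$). Vector representation, on a space with basis indexed by $0,\dots,n,\bar0,\dots,\bar n$ and with matrix units $e_{a,b}$: $t(e_0)=e_{0,1}+e_{\bar1,\bar0}$, $t(f_0)=e_{1,0}-e_{\bar0,\bar1}$; $t(e_i)=e_{i,i+1}-e_{\overline{i+1},\bar i}$, $t(f_i)=e_{i+1,i}-e_{\bar i,\overline{i+1}}$ ($1\le i<n$); $t(e_n)=e_{n,\bar n}$, $t(f_n)=e_{\bar n,n}$; $t(k_i)=q_i^{H_i/2}$ with $H_0=\delta_0^*+\delta_1^*$, $H_i=\delta_i^*-\delta_{i+1}^*$ ($0<i<n$), $H_n=\delta_n^*$, $\delta_i^*=e_{i,i}-e_{\bar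 i,\bar i}$; $\langle t_{ab},x\rangle=t(x)_{ab}$. The finite dual $\mathcal U^\circ\subset\mathcal U^*$ of a Hopf superalgebra $\mathcal U$ consists of the matrix elements of finite-dimensional graded representations, with Hopf superalgebra structure obtained by transposition: $\langle ab,x\rangle=\langle a\otimes b,\Delta(x)\rangle$, $\langle\Delta(a),x\otimes y\rangle=\langle a,xy\rangle$, where $\langle a\otimes b,x\otimes y\rangle=(-1)^{[b][x]}\langle a,x\rangle\langle b,y\rangle$. $\mathcal A_e$ has a basis of matrix elements of irreducible representations of $U_q(\mathfrak g_0)$, and $\int_0$ annihilates those of the non-trivial ones. $\nu:U_q(\mathfrak g)\to\mathcal A^\circ\subset\mathcal A^*$ is $\langle\nu(x),a\rangle=(-1)^{[x][a]}\langle a,x\rangle$, and $\langle f\cdot g,a\rangle=\langle f\otimes g,\Delta(a)\rangle$ is the product in $\mathcal A^*$. A left integral on a Hopf superalgebra $\mathcal B$ is a linear form $\int$ on $\mathcal B$ with $(\mathrm{id}\otimes\int)\Delta(b)=1_{\mathcal B}\int(b)$ for all $b$. *)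

(* Defs.v *)
From HB Require Import structures.
From mathcomp Require Import all_boot all_algebra.
From mathcomp Require Import boolp classical_sets functions.

Set Implicit Arguments.
Unset Strict Implicit.
Unset Printing Implicit Defensive.

Import GRing.Theory.
Local Open Scope ring_scope.
Local Open Scope quotient_scope.

(* A Z_2-grading V = V_0 (+) V_1, given by the two projections
   hpart false : V -> V_0 and hpart true : V -> V_1; v is homogeneous of
   degree p when hpart p v = v. *)
HB.mixin Record isSuper (K : fieldType) V of GRing.Lmodule K V := {
  hpart : bool -> V -> V;
  hpart_linear : forall p, linear (hpart p);
  hpartI : forall p r v, hpart p (hpart r v) = if p == r then hpart p v else 0;
  hpart_sum : forall v, hpart false v + hpart true v = v }.

#[short(type="superModType")]
HB.structure Definition SuperMod (K : fieldType) :=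
  { V of GRing.Lmodule K V & isSuper K V }.

HB.mixin Record isSuperAlg (K : fieldType) A
    of GRing.Algebra K A & SuperMod K A := {
  hpart1 : hpart false (1 : A) = 1;
  hpartM : forall p (a b : A),
    hpart p (a * b) = \sum_(r : bool) hpart r a * hpart (p (+) r) b }.

#[short(type="superAlgType")]
HB.structure Definition SuperAlg (K : fieldType) :=
  { A of GRing.Algebra K A & SuperMod K A & isSuperAlg K A }.

HB.instance Definition _ (K : fieldType) (V : superModType K) p :=
  GRing.isLinear.Build K V V *:%R (@hpart K V p) (hpart_linear p).

Notation bilin b := (bilinear_for *:%R *:%R b).

(* V (x) W: finite formal sums of pairs, two sums being identified when every
   bilinear map takes the same value on them. *)
Section Tensor.
Variables (K : fieldType) (V W : lmodType K).


Definition tev (Z : lmodType K) (b : V -> W -> Z) (s : seq (V * W)) : Z :=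
  \sum_(u <- s) b u.1 u.2.

Definition teq (s t : seq (V * W)) : bool :=
  `[< forall (Z : lmodType K) (b : V -> W -> Z), bilin b -> tev b s = tev b t >].

Lemma teq_refl : reflexive teq.
Proof. by move=> s; apply/asboolP. Qed.
Lemma teq_sym : symmetric teq.
Proof.
by move=> s t; apply/asboolP/asboolP => h Z b hb; rewrite h.
Qed.
Lemma teq_trans : transitive teq.
Proof.
move=> t s u /asboolP h1 /asboolP h2; apply/asboolP => Z b hb.
by rewrite h1 ?h2.
Qed.

Canonical teq_equiv := EquivRel teq teq_refl teq_sym teq_trans.

Definition tens := {eq_quot teq_equiv}.
HB.instance Definition _ := Choice.on tens.
HB.instance Definition _ := EqQuotient.on tens.

Definition pure (v : V) (w : W) : tens := \pi_tens [:: (v, w)].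

(* The linear map induced by b; it does not depend on the representative as
   soon as b is bilinear (tlift_pi). *)
Definition tlift (Z : lmodType K) (b : V -> W -> Z) (T : tens) : Z :=
  tev b (repr T).

Lemma tlift_pi (Z : lmodType K) (b : V -> W -> Z) s : bilin b ->
  tlift b (\pi_tens s) = tev b s.
Proof.
move=> hb; rewrite /tlift.
have /eqmodP/asboolP : repr (\pi_tens s) = s %[mod tens] by rewrite reprK.
exact.
Qed.

Lemma tlift_pure (Z : lmodType K) (b : V -> W -> Z) v w : bilin b ->
  tlift b (pure v w) = b v w.
Proof. by move=> hb; rewrite tlift_pi // /tev big_seq1. Qed.

Lemma tensP (T S : tens) :
  (forall (Z : lmodType K) (b : V -> W -> Z), bilin b -> tlift b T = tlift b S) ->
  T = S.
Proof.
move=> h; rewrite -[T]reprK -[S]reprK; apply/eqmodP/asboolP => Z b hb.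
exact: h.
Qed.

Definition tadd (T S : tens) : tens := \pi_tens (repr T ++ repr S).
Definition tscale (c : K) (T : tens) : tens :=
  \pi_tens [seq (c *: u.1, u.2) | u <- repr T].
Definition tzero : tens := \pi_tens [::].
Definition topp (T : tens) : tens := tscale (-1) T.

Section Eval.
Variables (Z : lmodType K) (b : V -> W -> Z) (hb : bilin b).
Lemma bilinZl c v w : b (c *: v) w = c *: b v w.
Proof.
have h := hb.1 w; have h0 : b 0 w = 0.
  by have := h (-1) 0 0; rewrite /= scaler0 addr0 scaleN1r addNr.
by have := h c v 0; rewrite /= addr0 h0 addr0.
Qed.
Lemma tlift0 : tlift b tzero = 0.
Proof. by rewrite tlift_pi // /tev big_nil. Qed.
Lemma tliftD T S : tlift b (tadd T S) = tlift b T + tlift b S.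
Proof. by rewrite tlift_pi // /tev big_cat. Qed.
Lemma tliftZ c T : tlift b (tscale c T) = c *: tlift b T.
Proof.
rewrite tlift_pi // /tev big_map scaler_sumr; apply: eq_bigr => u _ /=.
exact: bilinZl.
Qed.
End Eval.

Lemma taddA : associative tadd.
Proof. by move=> T S U; apply: tensP => Z b hb; rewrite !tliftD // addrA. Qed.
Lemma taddC : commutative tadd.
Proof. by move=> T S; apply: tensP => Z b hb; rewrite !tliftD // addrC. Qed.
Lemma tadd0 : left_id tzero tadd.
Proof. by move=> T; apply: tensP => Z b hb; rewrite tliftD // tlift0 // add0r. Qed.
Lemma taddN : left_inverse tzero topp tadd.
Proof.
move=> T; apply: tensP => Z b hb.
by rewrite tliftD // tliftZ // tlift0 // scaleN1r addNr.
Qed.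
HB.instance Definition _ := GRing.isZmodule.Build tens taddA taddC tadd0 taddN.

Lemma tscaleA a c T : tscale a (tscale c T) = tscale (a * c) T.
Proof. by apply: tensP => Z b hb; rewrite !tliftZ // scalerA. Qed.
Lemma tscale1 : left_id 1 tscale.
Proof. by move=> T; apply: tensP => Z b hb; rewrite tliftZ // scale1r. Qed.
Lemma tscaleDr : right_distributive tscale +%R.
Proof.
move=> c T S; apply: tensP => Z b hb.
by rewrite tliftZ // !tliftD // !tliftZ // scalerDr.
Qed.
Lemma tscaleDl T : {morph tscale^~ T : a c / a + c}.
Proof.
move=> a c; apply: tensP => Z b hb.
by rewrite tliftZ // tliftD // !tliftZ // scalerDl.
Qed.
HB.instance Definition _ :=
  GRing.Zmodule_isLmodule.Build K tens tscaleA tscale1 tscaleDr tscaleDl.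

Lemma tlift_linear (Z : lmodType K) (b : V -> W -> Z) : bilin b -> linear (tlift b).
Proof. by move=> hb c T S; rewrite tliftD // tliftZ. Qed.

Lemma bilin_pure : bilin pure.
Proof.
split=> [w | v] c u1 u2; apply: tensP => Z b hb;
  rewrite tliftD // tliftZ // !tlift_pure //; [exact: hb.1 | exact: hb.2].
Qed.

Lemma tens_sum (T : tens) : T = \sum_(u <- repr T) pure u.1 u.2.
Proof.
apply: tensP => Z b hb; rewrite /tlift /tev.
transitivity (\sum_(u <- repr T) tlift b (pure u.1 u.2)).
  by apply: eq_bigr => u _; rewrite tlift_pure.
elim: (repr T) => [|u s IH]; first by rewrite !big_nil; symmetry; exact: tlift0.
by rewrite !big_cons IH; symmetry; exact: tliftD.
Qed.

Lemma tens_ext (Z : lmodType K) (f g : tens -> Z) : linear f -> linear g ->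
  (forall v w, f (pure v w) = g (pure v w)) -> f =1 g.
Proof.
move=> hf hg h T; rewrite [T]tens_sum.
have lin0 (k : tens -> Z) : linear k -> k 0 = 0.
  by move=> hk; have := hk (-1) 0 0; rewrite scaler0 addr0 scaleN1r addNr.
have linD (k : tens -> Z) : linear k -> forall x y, k (x + y) = k x + k y.
  by move=> hk x y; have := hk 1 x y; rewrite !scale1r.
elim: (repr T) => [|u s IH]; first by rewrite !big_nil !lin0.
by rewrite !big_cons !linD // h IH.
Qed.

End Tensor.

Section PureTheory.
Variables (K : fieldType) (V W : lmodType K).
Implicit Types (v : V) (w : W).

Lemma lin0 (X Y : lmodType K) (f : X -> Y) : linear f -> f 0 = 0.
Proof. by move=> h; have := h (-1) 0 0; rewrite scaler0 addr0 scaleN1r addNr. Qed.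

Lemma pureDl v1 v2 w : pure (v1 + v2) w = pure v1 w + pure v2 w.
Proof. by have := (bilin_pure V W).1 w 1 v1 v2; rewrite /= !scale1r. Qed.
Lemma pureDr v w1 w2 : pure v (w1 + w2) = pure v w1 + pure v w2.
Proof. by have := (bilin_pure V W).2 v 1 w1 w2; rewrite /= !scale1r. Qed.
Lemma pure0l w : pure (0 : V) w = 0.
Proof. exact: lin0 ((bilin_pure V W).1 w). Qed.
Lemma pure0r v : pure v (0 : W) = 0.
Proof. exact: lin0 ((bilin_pure V W).2 v). Qed.
Lemma pureZl c v w : pure (c *: v) w = c *: pure v w.
Proof. by have := (bilin_pure V W).1 w c v 0; rewrite /= pure0l !addr0. Qed.
Lemma pureZr c v w : pure v (c *: w) = c *: pure v w.
Proof. by have := (bilin_pure V W).2 v c w 0; rewrite /= pure0r !addr0. Qed.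
End PureTheory.

Section TensorSuper.
Variables (K : fieldType) (V W : superModType K).

Definition tpart_pure p (v : V) (w : W) : tens V W :=
  \sum_(r : bool) pure (hpart r v) (hpart (p (+) r) w).
Definition tpart p : tens V W -> tens V W := tlift (tpart_pure p).

Lemma bilin_tpart p : bilin (tpart_pure p).
Proof.
split=> [w c v1 v2 | v c w1 w2]; rewrite /= /tpart_pure scaler_sumr -big_split;
  apply: eq_bigr => r _ /=; rewrite hpart_linear.
  by rewrite pureDl pureZl.
by rewrite pureDr pureZr.
Qed.

Lemma tpart_linear p : linear (tpart p).
Proof. exact: tlift_linear (bilin_tpart p). Qed.
HB.instance Definition _ p :=
  GRing.isLinear.Build K (tens V W) (tens V W) *:%R (tpart p) (tpart_linear p).

Lemma tpart_pureE p v w : tpart p (pure v w) = tpart_pure p v w.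
Proof. exact: tlift_pure (bilin_tpart p). Qed.

Lemma tpartI p r (T : tens V W) :
  tpart p (tpart r T) = if p == r then tpart p T else 0.
Proof.
rewrite (_ : (if _ then _ else _) = (p == r)%:R *: tpart p T); last first.
  by case: eqP => _; rewrite ?scale1r ?scale0r.
apply: (@tens_ext _ _ _ _ (fun T => tpart p (tpart r T)) (fun T => (p == r)%:R *: tpart p T)).
- by move=> c x y; rewrite !linearP.
- by move=> c x y; rewrite linearP scalerDr !scalerA mulrC.
move=> v w; rewrite !tpart_pureE linear_sum /=.
rewrite /tpart_pure !big_bool /= !tpart_pureE /tpart_pure !big_bool /= !hpartI.
by case: p; case: r; rewrite /= ?scale0r ?scale1r ?pure0l ?pure0r ?addr0 ?add0r.
Qed.

Lemma tpart_sum (T : tens V W) : tpart false T + tpart true T = T.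
Proof.
apply: (@tens_ext _ _ _ _ (fun T => tpart false T + tpart true T) id) => //.
- by move=> c x y; rewrite !linearP scalerDr addrACA.
move=> v w; rewrite !tpart_pureE /tpart_pure !big_bool /=.
by rewrite addrACA -!pureDr [hpart true w + _]addrC !hpart_sum -pureDl addrC hpart_sum.
Qed.

HB.instance Definition _ :=
  isSuper.Build K (tens V W) tpart_linear tpartI tpart_sum.

(* f (x) g and id (x) g on v (x) w with the sign rule: the component of degree
   p of the form g is g \o hpart p, and it moves past hpart r v with the sign
   (-1)^(p r). *)
Definition tform (f : V -> K) (g : W -> K) : tens V W -> K :=
  tlift (fun v w => \sum_(p : bool) \sum_(r : bool)
    (-1) ^+ (p && r) * (f (hpart r v) * g (hpart p w)) : K^o).

Definition tslice (g : W -> K) : tens V W -> V :=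
  tlift (fun v w => \sum_(p : bool) \sum_(r : bool)
    ((-1) ^+ (p && r) * g (hpart p w)) *: hpart r v).

End TensorSuper.

Lemma hpart_one (K : fieldType) (A : superAlgType K) p :
  hpart p (1 : A) = if p then 0 else 1.
Proof. by rewrite -{1}hpart1 hpartI; case: p; rewrite //= hpart1. Qed.

Section TensorAlg.
Variables (K : fieldType) (A B : superAlgType K).

(* (a (x) b)(a' (x) b') = (-1)^([b][a']) aa' (x) bb' *)
Definition tmul_pure (a : A) (b : B) (a' : A) (b' : B) : tens A B :=
  \sum_(p : bool) \sum_(r : bool)
    (-1) ^+ (p && r) *: pure (a * hpart r a') (hpart p b * b').
Definition tmul (T S : tens A B) : tens A B :=
  tlift (fun a b => tlift (tmul_pure a b) S) T.

Lemma bilin_tmul2 a b : bilin (tmul_pure a b).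
Proof.
split=> [b' c x y | a' c x y]; rewrite /= /tmul_pure scaler_sumr -big_split;
  apply: eq_bigr => p _ /=; rewrite scaler_sumr -big_split;
  apply: eq_bigr => r _ /=.
  by rewrite linearP mulrDr -scalerAr pureDl pureZl scalerDr !scalerA mulrC.
by rewrite mulrDr -scalerAr pureDr pureZr scalerDr !scalerA mulrC.
Qed.

Lemma bilin_tmul1 S : bilin (fun a b => tlift (tmul_pure a b) S).
Proof.
have gen (a1 : A) (b1 : B) a2 b2 a3 b3 c :
    (forall a' b', tmul_pure a1 b1 a' b' = c *: tmul_pure a2 b2 a' b' + tmul_pure a3 b3 a' b') ->
    tlift (tmul_pure a1 b1) S = c *: tlift (tmul_pure a2 b2) S + tlift (tmul_pure a3 b3) S.
  move=> h; apply: (@tens_ext _ _ _ _ (tlift (tmul_pure a1 b1))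
      (fun S => c *: tlift (tmul_pure a2 b2) S + tlift (tmul_pure a3 b3) S)).
  - exact: tlift_linear (bilin_tmul2 _ _).
  - move=> d x y; rewrite !(tlift_linear (bilin_tmul2 _ _)) !scalerDr !scalerA.
    by rewrite addrACA [c * d]mulrC.
  move=> v w; rewrite !(tlift_pure _ _ (bilin_tmul2 _ _)); exact: h.
split=> [b c x y | a c x y]; apply: gen => a' b';
  rewrite /= /tmul_pure scaler_sumr -big_split;
  apply: eq_bigr => p _ /=; rewrite scaler_sumr -big_split;
  apply: eq_bigr => r _ /=.
  by rewrite mulrDl -scalerAl pureDl pureZl scalerDr !scalerA mulrC.
by rewrite linearP mulrDl -scalerAl pureDr pureZr scalerDr !scalerA mulrC.
Qed.

Lemma tmul_linl S : linear (tmul^~ S).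
Proof. exact: tlift_linear (bilin_tmul1 S). Qed.

Lemma tmul_linr T : linear (tmul T).
Proof.
move=> c S1 S2; rewrite /tmul {1}/tlift /tev.
under eq_bigr => u _ do rewrite (tlift_linear (bilin_tmul2 _ _)).
by rewrite big_split /= -scaler_sumr.
Qed.

Lemma tmul_pureE a b a' b' : tmul (pure a b) (pure a' b') = tmul_pure a b a' b'.
Proof. by rewrite /tmul (tlift_pure _ _ (bilin_tmul1 _)) (tlift_pure _ _ (bilin_tmul2 _ _)). Qed.

Lemma tmulDl : left_distributive tmul +%R.
Proof. by move=> T S U; have := tmul_linl U 1 T S; rewrite !scale1r. Qed.
Lemma tmulDr : right_distributive tmul +%R.
Proof. by move=> T S U; have := tmul_linr T 1 S U; rewrite !scale1r. Qed.
Lemma tmul0l T : tmul 0 T = 0.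
Proof. by apply: (addrI (tmul 0 T)); rewrite -tmulDl !addr0. Qed.
Lemma tmul0r T : tmul T 0 = 0.
Proof. by apply: (addrI (tmul T 0)); rewrite -tmulDr !addr0. Qed.
Lemma tmulZl c T S : tmul (c *: T) S = c *: tmul T S.
Proof. by have := tmul_linl S c T 0; rewrite /= tmul0l !addr0. Qed.
Lemma tmulZr c T S : tmul T (c *: S) = c *: tmul T S.
Proof. by have := tmul_linr T c S 0; rewrite /= tmul0r !addr0. Qed.

Lemma tmul1l : left_id (pure 1 1) tmul.
Proof.
apply: (@tens_ext _ _ _ _ (tmul (pure 1 1)) id) => //; first exact: tmul_linr.
move=> v w; rewrite tmul_pureE /tmul_pure !big_bool /= !hpart_one.
by rewrite !mul1r !mul0r !pure0r !scaler0 !add0r !scale1r -pureDl [X in pure X _]addrC hpart_sum.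
Qed.
Lemma tmul1r : right_id (pure 1 1) tmul.
Proof.
apply: (@tens_ext _ _ _ _ (tmul^~ (pure 1 1)) id) => //; first exact: tmul_linl.
move=> v w; rewrite tmul_pureE /tmul_pure !big_bool /= !hpart_one.
by rewrite !mulr1 !mulr0 !pure0l !scaler0 !add0r !scale1r -pureDr [X in pure _ X]addrC hpart_sum.
Qed.

Lemma tens_pure_ind (P : tens A B -> Prop) :
  P 0 -> (forall T S, P T -> P S -> P (T + S)) -> (forall a b, P (pure a b)) ->
  forall T, P T.
Proof. by move=> h0 hD hp T; rewrite [T]tens_sum; apply: big_ind => // u _; exact: hp. Qed.

Lemma tens_hom_ind (P : tens A B -> Prop) :
  P 0 -> (forall T S, P T -> P S -> P (T + S)) ->
  (forall p r a b, hpart p a = a -> hpart r b = b -> P (pure a b)) ->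
  forall T, P T.
Proof.
move=> h0 hD hp; apply: tens_pure_ind => // a b.
have h p r : P (pure (hpart p a) (hpart r b)).
  by apply: (hp p r); rewrite hpartI eqxx.
rewrite -[a]hpart_sum -[b]hpart_sum pureDl !pureDr.
by apply: (hD); apply: hD; exact: h.
Qed.

Lemma tmul_hom p r a b a' b' : hpart p b = b -> hpart r a' = a' ->
  tmul (pure a b) (pure a' b') = (-1) ^+ (p && r) *: pure (a * a') (b * b').
Proof.
move=> hb ha; rewrite tmul_pureE /tmul_pure -hb -ha.
rewrite (bigD1 p) //= [X in _ + X]big1 ?addr0; last first.
  move=> q hq; rewrite big1 // => s _.
  by rewrite !hpartI (negPf hq) mul0r pure0r scaler0.
rewrite (bigD1 r) //= [X in _ + X]big1 ?addr0; last first.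
  by move=> q hq; rewrite !hpartI (negPf hq) mulr0 pure0l scaler0.
by rewrite !hpartI !eqxx.
Qed.

Lemma hpart_hom (C : superModType K) p r (c : C) : hpart r c = c ->
  hpart p c = if p == r then c else 0.
Proof. by move=> hc; rewrite -{1}hc hpartI; case: eqP => // ->. Qed.

Lemma hpartM_hom (C : superAlgType K) p r (c d : C) : hpart p c = c -> hpart r d = d ->
  hpart (p (+) r) (c * d) = c * d.
Proof.
move=> hc hd; rewrite hpartM (bigD1 p) //= [X in _ + X]big1 ?addr0; last first.
  by move=> q hq; rewrite (hpart_hom _ hc) (negPf hq) mul0r.
by rewrite addbAC addbb /= hc hd.
Qed.

Lemma tmulA : associative tmul.
Proof.
move=> T S U.
elim/tens_hom_ind: T => [|T T' IH IH'|p1 p2 a b ha hb]; first by rewrite !tmul0l.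
  by rewrite !tmulDl IH IH'.
elim/tens_hom_ind: S => [|S S' IH IH'|q1 q2 a' b' ha' hb'].
- by rewrite tmul0r !tmul0l tmul0r.
- by rewrite tmulDl !tmulDr IH IH' tmulDl.
elim/tens_hom_ind: U => [|U U' IH IH'|r1 r2 a'' b'' ha'' hb''].
- by rewrite !tmul0r.
- by rewrite !tmulDr IH IH'.
rewrite (tmul_hom _ _ hb' ha'') (tmul_hom _ _ hb ha') tmulZl tmulZr.
rewrite (tmul_hom _ _ hb (hpartM_hom ha' ha'')) (tmul_hom _ _ (hpartM_hom hb hb') ha'').
rewrite !scalerA !mulrA -!signr_addb; congr ((-1) ^+ _ *: _).
by case: (p2); case: (q1); case: (q2); case: (r1).
Qed.

HB.instance Definition _ := GRing.Zmodule_isPzRing.Build (tens A B)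
  tmulA tmul1l tmul1r tmulDl tmulDr.

Lemma tpart1 : hpart false (1 : tens A B) = 1.
Proof.
by rewrite [LHS]tpart_pureE /tpart_pure big_bool /= !hpart_one pure0l add0r.
Qed.

Lemma tpart_hom p r (a : A) (b : B) : hpart p a = a -> hpart r b = b ->
  hpart (p (+) r) (pure a b) = pure a b.
Proof.
move=> ha hb; rewrite [LHS]tpart_pureE /tpart_pure.
rewrite (bigD1 p) //= [X in _ + X]big1 ?addr0; last first.
  by move=> q hq; rewrite (hpart_hom _ ha) (negPf hq) pure0l.
by rewrite ha addbAC addbb /= hb.
Qed.

Lemma tpartM p (T S : tens A B) :
  hpart p (T * S) = \sum_(r : bool) hpart r T * hpart (p (+) r) S.
Proof.
elim/tens_hom_ind: T => [|T T' IH IH'|p1 p2 a b ha hb].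
- by rewrite mul0r linear0 big1 // => r _; rewrite linear0 mul0r.
- by rewrite mulrDl linearD /= IH IH' -big_split; apply: eq_bigr => r _ /=;
    rewrite linearD mulrDl.
elim/tens_hom_ind: S => [|S S' IH IH'|q1 q2 a' b' ha' hb'].
- by rewrite mulr0 linear0 big1 // => r _; rewrite linear0 mulr0.
- by rewrite mulrDr linearD /= IH IH' -big_split; apply: eq_bigr => r _ /=;
    rewrite linearD mulrDr.
have hT := tpart_hom ha hb; have hS := tpart_hom ha' hb'.
rewrite (bigD1 (p1 (+) p2)) //= [X in _ + X]big1 ?addr0; last first.
  by move=> q hq; rewrite (hpart_hom _ hT) (negPf hq) mul0r.
have hM : pure a b * pure a' b' = (-1) ^+ (p2 && q1) *: pure (a * a') (b * b').
  exact: tmul_hom.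
rewrite hT hM linearZ /=.
have hTS := tpart_hom (hpartM_hom ha ha') (hpartM_hom hb hb').
rewrite (hpart_hom _ hTS) (hpart_hom _ hS).
have -> : (p == p1 (+) q1 (+) (p2 (+) q2)) = (p (+) (p1 (+) p2) == q1 (+) q2).
  by case: (p); case: (p1); case: (p2); case: (q1); case: (q2).
case: eqP => _; last by rewrite mulr0 scaler0.
by rewrite hM.
Qed.

End TensorAlg.


Section ScalarSuper.
Variable K : fieldType.

Definition kpart (p : bool) (x : K^o) : K^o := if p then 0 else x.
Lemma kpart_linear p : linear (kpart p).
Proof. by case: p => c x y //=; rewrite scaler0 addr0. Qed.
Lemma kpartI p r x : kpart p (kpart r x) = if p == r then kpart p x else 0.
Proof. by case: p; case: r. Qed.
Lemma kpart_sum x : kpart false x + kpart true x = x.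
Proof. exact: addr0. Qed.
HB.instance Definition _ := isSuper.Build K K^o kpart_linear kpartI kpart_sum.
Lemma kpartM p (x y : K^o) :
  hpart p (x * y) = \sum_(r : bool) hpart r x * hpart (p (+) r) y.
Proof.
by rewrite big_bool /=; case: p; rewrite /hpart /= /kpart ?mul0r ?mulr0 ?addr0 ?add0r.
Qed.
HB.instance Definition _ := isSuperAlg.Build K K^o (erefl 1) kpartM.
End ScalarSuper.

(* The i-th basis vector has degree d i. *)
Definition smatrix (K : fieldType) (m : nat) (d : 'I_m.+1 -> bool) : Type :=
  'M[K]_m.+1.
HB.instance Definition _ K m d :=
  GRing.Algebra.copy (@smatrix K m d) 'M[K]_m.+1.

Section MatrixSuper.
Variables (K : fieldType) (m : nat) (d : 'I_m.+1 -> bool).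
Local Notation smx := (@smatrix K m d).

Definition mpart (p : bool) (M : smx) : smx :=
  \matrix_(i, j) (if d i (+) d j == p then M i j else 0).
Lemma mpart_linear p : linear (mpart p).
Proof.
move=> c M N; apply/matrixP => i j; rewrite !mxE.
by case: ifP; rewrite ?mulr0 ?addr0.
Qed.
Lemma mpartI p r M : mpart p (mpart r M) = if p == r then mpart p M else 0.
Proof.
case: eqP => [->|h]; apply/matrixP => i j; rewrite !mxE; first by case: (_ == r).
by case: eqP => // ->; case: eqP => // e; case: h.
Qed.
Lemma mpart_sum M : mpart false M + mpart true M = M.
Proof.
apply/matrixP => i j; rewrite !mxE.
by case: (_ (+) _); rewrite ?addr0 ?add0r.
Qed.
HB.instance Definition _ := isSuper.Build K smx mpart_linear mpartI mpart_sum.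
Lemma mpart1 : hpart false (1 : smx) = 1.
Proof.
by apply/matrixP => i j; rewrite !mxE; case: (i =P j) => [->|_]; rewrite ?addbb // mulr0n if_same.
Qed.
Lemma mpartM p (M N : smx) :
  hpart p (M * N) = \sum_(r : bool) hpart r M * hpart (p (+) r) N.
Proof.
apply/matrixP => i j; rewrite summxE big_bool !mxE -big_split.
transitivity (\sum_k (if d i (+) d j == p then M i k * N k j else 0)).
  by case: ifP => // _; rewrite big1.
apply: eq_bigr => k _ /=; rewrite !mxE.
by case: (d i); case: (d j); case: (d k); case: (p); rewrite /= ?mul0r ?mulr0 ?addr0 ?add0r.
Qed.
HB.instance Definition _ := isSuperAlg.Build K smx mpart1 mpartM.
End MatrixSuper.

Section CartanData.
Variable n : nat.

(* (delta_i, delta_j) = -(-1)^[i = 0] [i = j] *)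
Definition dform (i j : 'I_n.+1) : int :=
  if i == j then - (-1) ^+ (i == 0 :> nat)%N else 0.

Definition bform (u v : 'rV[int]_n.+1) : int :=
  \sum_i \sum_j u 0 i * v 0 j * dform i j.

Definition delta (i : nat) : 'rV[int]_n.+1 := delta_mx 0 (inord i).

Definition alpha (i : 'I_n.+1) : 'rV[int]_n.+1 :=
  if (i < n)%N then delta i - delta i.+1 else delta n *+ 2.

(* For i > 0 the quotient is exact. *)
Definition cartan (i j : 'I_n.+1) : int :=
  if i == ord0 then bform (alpha i) (alpha j)
  else (2 * bform (alpha i) (alpha j) %/ bform (alpha i) (alpha i))%Z.

End CartanData.

Section QNumbers.
Variables (K : fieldType) (x : K).
Definition qnum (m : nat) : K := (x ^+ m - x ^- m) / (x - x^-1).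
Definition qfact (m : nat) : K := \prod_(1 <= i < m.+1) qnum i.
Definition qbinom (m k : nat) : K := qfact m / (qfact k * qfact (m - k)).
End QNumbers.

Section Relations.
Variables (K : fieldType) (n : nat) (qh : K).

(* qh is the chosen square root of q, and qhi i the resulting square root
   of q_i; thus q_i^(a_ij / 2) = qhi i ^ a_ij. *)
Definition qhi (i : 'I_n.+1) : K :=
  if i == ord0 then qh else qh ^ (bform (alpha i) (alpha i) %/ 2)%Z.
Definition qi (i : 'I_n.+1) : K := qhi i ^+ 2.

(* Used for i <> 0 and j <> i only, where 1 - a_ij > 0. *)
Definition serre (B : algType K) (x : 'I_n.+1 -> B) (i j : 'I_n.+1) : B :=
  let m := `|1 - cartan i j|%N in
  \sum_(mu < m.+1)
    ((-1) ^+ mu * qbinom (qi i) m mu) *: (x i ^+ (m - mu) * x j * x i ^+ mu).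

(* k' i stands for k_i^-1. *)
Record osp_rel (B : algType K) (k k' e f : 'I_n.+1 -> B) : Prop := OspRel {
  rel_kk : forall i j, k i * k j = k j * k i;
  rel_kk' : forall i, k i * k' i = 1;
  rel_k'k : forall i, k' i * k i = 1;
  rel_ke : forall i j, k i * e j * k' i = qhi i ^ cartan i j *: e j;
  rel_kf : forall i j, k i * f j * k' i = qhi i ^ (- cartan i j) *: f j;
  rel_ef : forall i j,
    e i * f j - (-1) ^+ ((i == ord0) && (j == ord0)) *: (f j * e i)
    = if i == j then (qi i - (qi i)^-1)^-1 *: (k i ^+ 2 - k' i ^+ 2) else 0;
  rel_e0 : e ord0 ^+ 2 = 0;
  rel_f0 : f ord0 ^+ 2 = 0;
  rel_se : forall i j, i != ord0 -> j != i -> serre e i j = 0;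
  rel_sf : forall i j, i != ord0 -> j != i -> serre f i j = 0 }.

End Relations.

Section Uq.
Variables (K : fieldType) (n : nat) (qh : K).

Inductive gen :=
  | Gk of 'I_n.+1 | Gk' of 'I_n.+1 | Ge of 'I_n.+1 | Gf of 'I_n.+1.

Definition gpar (g : gen) : bool :=
  match g with Ge i | Gf i => i == ord0 | _ => false end.

(* Elements of a superalgebra B, of the prescribed degrees, that satisfy the
   defining relations. *)
Definition model (B : superAlgType K) (x : gen -> B) : Prop :=
  (forall g, hpart (gpar g) (x g) = x g) /\
  osp_rel qh (x \o Gk) (x \o Gk') (x \o Ge) (x \o Gf).

Inductive term :=
  | TGen of gen | TOne | TAdd of term & term | TMul of term & term
  | TScale of K & term.
HB.instance Definition _ := gen_eqMixin term.
HB.instance Definition _ := gen_choiceMixin term.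

Fixpoint eval (B : algType K) (x : gen -> B) (t : term) : B :=
  match t with
  | TGen g => x g
  | TOne => 1
  | TAdd t1 t2 => eval x t1 + eval x t2
  | TMul t1 t2 => eval x t1 * eval x t2
  | TScale c t1 => c *: eval x t1
  end.

Fixpoint termpart (p : bool) (t : term) : term :=
  match t with
  | TGen g => if gpar g == p then t else TScale 0 TOne
  | TOne => if p then TScale 0 TOne else TOne
  | TAdd t1 t2 => TAdd (termpart p t1) (termpart p t2)
  | TMul t1 t2 => TAdd (TMul (termpart true t1) (termpart (~~ p) t2))
                       (TMul (termpart false t1) (termpart p t2))
  | TScale c t1 => TScale c (termpart p t1)
  end.

Lemma eval_part (B : superAlgType K) (x : gen -> B) p t : model x ->
  eval x (termpart p t) = hpart p (eval x t).
Proof.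
case=> hx _; elim: t p => [g||t1 h1 t2 h2|t1 h1 t2 h2|c t1 h1] p /=.
- rewrite -[in RHS]hx hpartI eq_sym; case: eqP => [->|_] /=; first by rewrite hx.
  by rewrite scale0r.
- by rewrite hpart_one; case: p; rewrite //= scale0r.
- by rewrite h1 h2 linearD.
- by rewrite hpartM big_bool /= !h1 !h2 addbT addbF.
- by rewrite h1 linearZ.
Qed.

(* The congruence generated by the relations: s and t are identified when they
   have the same value in every superalgebra where the relations hold. *)
Definition ueq (s t : term) : bool :=
  `[< forall (B : superAlgType K) (x : gen -> B), model x -> eval x s = eval x t >].
Lemma ueq_refl : reflexive ueq.
Proof. by move=> s; apply/asboolP. Qed.
Lemma ueq_sym : symmetric ueq.
Proof. by move=> s t; apply/asboolP/asboolP => h B x hx; rewrite h. Qed.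
Lemma ueq_trans : transitive ueq.
Proof.
move=> t s u /asboolP h1 /asboolP h2; apply/asboolP => B x hx.
by rewrite h1 ?h2.
Qed.
Canonical ueq_equiv := EquivRel ueq ueq_refl ueq_sym ueq_trans.

Definition Uq := {eq_quot ueq_equiv}.
HB.instance Definition _ := Choice.on Uq.
HB.instance Definition _ := EqQuotient.on Uq.

(* The morphism U -> B sending each generator g to x g; it does not depend on
   the representative as soon as x is a model (Ulift_pi). *)
Definition Ulift (B : algType K) (x : gen -> B) (u : Uq) : B := eval x (repr u).

Lemma Ulift_pi (B : superAlgType K) (x : gen -> B) t : model x ->
  Ulift x (\pi_Uq t) = eval x t.
Proof.
move=> hx; rewrite /Ulift.
have /eqmodP/asboolP : repr (\pi_Uq t) = t %[mod Uq] by rewrite reprK.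
exact.
Qed.

Lemma UqP (u v : Uq) :
  (forall (B : superAlgType K) (x : gen -> B), model x -> Ulift x u = Ulift x v) ->
  u = v.
Proof.
move=> h; rewrite -[u]reprK -[v]reprK; apply/eqmodP/asboolP => B x hx.
exact: h.
Qed.

Definition uadd (u v : Uq) : Uq := \pi_Uq (TAdd (repr u) (repr v)).
Definition umul (u v : Uq) : Uq := \pi_Uq (TMul (repr u) (repr v)).
Definition uscale (c : K) (u : Uq) : Uq := \pi_Uq (TScale c (repr u)).
Definition uone : Uq := \pi_Uq TOne.
Definition uzero : Uq := \pi_Uq (TScale 0 TOne).
Definition uopp (u : Uq) : Uq := uscale (-1) u.
Definition upart p (u : Uq) : Uq := \pi_Uq (termpart p (repr u)).

Section Eval.
Variables (B : superAlgType K) (x : gen -> B) (hx : model x).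
Lemma UliftD u v : Ulift x (uadd u v) = Ulift x u + Ulift x v.
Proof. exact: Ulift_pi. Qed.
Lemma UliftM u v : Ulift x (umul u v) = Ulift x u * Ulift x v.
Proof. exact: Ulift_pi. Qed.
Lemma UliftZ c u : Ulift x (uscale c u) = c *: Ulift x u.
Proof. exact: Ulift_pi. Qed.
Lemma UliftN u : Ulift x (uopp u) = - Ulift x u.
Proof. by rewrite UliftZ scaleN1r. Qed.
Lemma Ulift1 : Ulift x uone = 1.
Proof. exact: Ulift_pi. Qed.
Lemma Ulift0 : Ulift x uzero = 0.
Proof. by rewrite Ulift_pi //= scale0r. Qed.
Lemma Ulift_part p u : Ulift x (upart p u) = hpart p (Ulift x u).
Proof. by rewrite Ulift_pi // eval_part. Qed.
Definition UliftE := (UliftD, UliftM, UliftZ, UliftN, Ulift1, Ulift0, Ulift_part).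
End Eval.

Local Ltac ulift :=
  let B := fresh "B" in let x := fresh "x" in let hx := fresh "hx" in
  apply: UqP; intros B x hx; rewrite !(UliftE hx).

Lemma uaddA : associative uadd. Proof. by move=> ? ? ?; ulift; rewrite addrA. Qed.
Lemma uaddC : commutative uadd. Proof. by move=> ? ?; ulift; rewrite addrC. Qed.
Lemma uadd0 : left_id uzero uadd. Proof. by move=> ?; ulift; rewrite add0r. Qed.
Lemma uaddN : left_inverse uzero uopp uadd.
Proof. by move=> ?; ulift; rewrite addNr. Qed.
HB.instance Definition _ := GRing.isZmodule.Build Uq uaddA uaddC uadd0 uaddN.

Local Lemma uaddE (u v : Uq) : u + v = uadd u v. Proof. by []. Qed.

Lemma umulA : associative umul. Proof. by move=> ? ? ?; ulift; rewrite mulrA. Qed.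
Lemma umul1l : left_id uone umul. Proof. by move=> ?; ulift; rewrite mul1r. Qed.
Lemma umul1r : right_id uone umul. Proof. by move=> ?; ulift; rewrite mulr1. Qed.
Lemma umulDl : left_distributive umul +%R.
Proof. by move=> ? ? ?; rewrite !uaddE; ulift; rewrite mulrDl. Qed.
Lemma umulDr : right_distributive umul +%R.
Proof. by move=> ? ? ?; rewrite !uaddE; ulift; rewrite mulrDr. Qed.

Definition eps_gen (g : gen) : K^o :=
  match g with Gk _ | Gk' _ => 1 | _ => 0 end.

Lemma model_eps : model eps_gen.
Proof.
split=> [[i|i|i|i]|] //=; rewrite /hpart /= /kpart; try by case: (_ == _).
split=> //= *; rewrite ?(mulr1, mulr0, mul0r, scaler0, subrr, expr0n, expr1n) //.
- by case: ifP.
- by rewrite /serre big1 // => mu _ /=; rewrite mulr0 mul0r scaler0.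
- by rewrite /serre big1 // => mu _ /=; rewrite mulr0 mul0r scaler0.
Qed.

Lemma uone_neq0 : uone != 0.
Proof.
apply/eqP => h; have := Ulift1 model_eps; rewrite h (Ulift0 model_eps).
by move/eqP; rewrite eq_sym oner_eq0.
Qed.
HB.instance Definition _ := GRing.Zmodule_isNzRing.Build Uq
  umulA umul1l umul1r umulDl umulDr uone_neq0.

Lemma uscaleA a c u : uscale a (uscale c u) = uscale (a * c) u.
Proof. by ulift; rewrite scalerA. Qed.
Lemma uscale1 : left_id 1 uscale. Proof. by move=> u; ulift; rewrite scale1r. Qed.
Lemma uscaleDr : right_distributive uscale +%R.
Proof. by move=> c u v; rewrite !uaddE; ulift; rewrite scalerDr. Qed.
Lemma uscaleDl u : {morph uscale^~ u : a c / a + c}.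
Proof. by move=> a c; rewrite !uaddE; ulift; rewrite scalerDl. Qed.
HB.instance Definition _ := GRing.Zmodule_isLmodule.Build K Uq
  uscaleA uscale1 uscaleDr uscaleDl.

Lemma uscalerAl (c : K) (u v : Uq) : c *: (u * v) = (c *: u) * v.
Proof.
rewrite -[LHS]/(uscale c (umul u v)) -[RHS]/(umul (uscale c u) v).
by ulift; rewrite scalerAl.
Qed.
HB.instance Definition _ := GRing.Lmodule_isLalgebra.Build K Uq uscalerAl.
Lemma uscalerAr (c : K) (u v : Uq) : c *: (u * v) = u * (c *: v).
Proof.
rewrite -[LHS]/(uscale c (umul u v)) -[RHS]/(umul u (uscale c v)).
by ulift; rewrite scalerAr.
Qed.
HB.instance Definition _ := GRing.Lalgebra_isAlgebra.Build K Uq uscalerAr.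

Lemma upart_linear p : linear (upart p).
Proof.
move=> c u v; rewrite -[c *: u + v]/(uadd (uscale c u) v).
rewrite -[RHS]/(uadd (uscale c (upart p u)) (upart p v)).
by ulift; rewrite linearP.
Qed.
Lemma upartI p r u : upart p (upart r u) = if p == r then upart p u else 0.
Proof.
case: eqP => [->|/eqP h]; last rewrite -[0]/uzero.
  by ulift; rewrite hpartI eqxx.
by ulift; rewrite hpartI (negPf h).
Qed.
Lemma upart_sum u : upart false u + upart true u = u.
Proof. by rewrite uaddE; ulift; rewrite hpart_sum. Qed.
HB.instance Definition _ := isSuper.Build K Uq upart_linear upartI upart_sum.

Lemma upart1 : hpart false (1 : Uq) = 1.
Proof.
rewrite -[LHS]/(upart false uone) -[RHS]/uone.
by ulift; rewrite hpart1.
Qed.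
Lemma upartM p (u v : Uq) :
  hpart p (u * v) = \sum_(r : bool) hpart r u * hpart (p (+) r) v.
Proof.
rewrite big_bool -[LHS]/(upart p (umul u v)).
rewrite -[RHS]/(uadd (umul (upart true u) (upart (p (+) true) v))
                     (umul (upart false u) (upart (p (+) false) v))).
by ulift; rewrite hpartM big_bool.
Qed.
HB.instance Definition _ := isSuperAlg.Build K Uq upart1 upartM.

Definition ugen (g : gen) : Uq := \pi_Uq (TGen g).
Definition uk i := ugen (Gk i).
Definition uk' i := ugen (Gk' i).
Definition ue i := ugen (Ge i).
Definition uf i := ugen (Gf i).

Definition counit : Uq -> K := Ulift eps_gen.

End Uq.


Section UqTensor.
Variables (K : fieldType) (n : nat) (qh : K).
Local Notation U := (Uq n qh).
Local Notation UU := (tens U U).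

Lemma uu_one_neq0 : (1 : UU) != 0.
Proof.
pose b (u v : U) : K^o := counit u * counit v.
have hb : bilin b.
  split=> [v | u] c x y; rewrite /b /counit /=;
    rewrite (UliftD (model_eps n qh)) (UliftZ (model_eps n qh)).
    by rewrite mulrDl; congr (_ + _); symmetry; exact: mulrA.
  by rewrite mulrDr; congr (_ + _); exact: mulrCA.
apply/eqP => /(congr1 (tlift b)).
rewrite (lin0 (tlift_linear hb)) [tlift b 1](tlift_pure _ _ hb) /b /counit.
by rewrite (Ulift1 (model_eps n qh)) mulr1 => /eqP; rewrite oner_eq0.
Qed.
HB.instance Definition _ := GRing.PzSemiRing_isNonZero.Build UU uu_one_neq0.

Lemma uu_scalerAl (c : K) (u v : UU) : c *: (u * v) = (c *: u) * v.
Proof. by symmetry; exact: tmulZl. Qed.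
Lemma uu_scalerAr (c : K) (u v : UU) : c *: (u * v) = u * (c *: v).
Proof. by symmetry; exact: tmulZr. Qed.
HB.instance Definition _ := GRing.Lmodule_isLalgebra.Build K UU uu_scalerAl.
HB.instance Definition _ := GRing.Lalgebra_isAlgebra.Build K UU uu_scalerAr.
HB.instance Definition _ := isSuperAlg.Build K UU (tpart1 U U) (@tpartM K U U).

(* The product on the right-hand side of Delta is the one of the super tensor
   product U (x) U. *)
Definition Delta_gen (g : gen n) : UU :=
  match g with
  | Gk i => pure (uk qh i) (uk qh i)
  | Gk' i => pure (uk' qh i) (uk' qh i)
  | Ge i => pure (ue qh i) (uk qh i) + pure (uk' qh i) (ue qh i)
  | Gf i => pure (uf qh i) (uk qh i) + pure (uk' qh i) (uf qh i)
  end.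

Definition Delta : U -> UU := Ulift Delta_gen.

(* The basis 0, ..., n, \bar 0, ..., \bar n, of size n.+1 + n.+1; 0 and \bar 0
   are even and the other basis vectors odd. *)
Definition nn := (n + n.+1)%N.
Definition vidx (i : nat) : 'I_nn.+1 := lshift n.+1 (inord i : 'I_n.+1).
Definition vbar (i : nat) : 'I_nn.+1 := rshift n.+1 (inord i : 'I_n.+1).
Definition vpar (c : 'I_nn.+1) : bool :=
  match fintype.split (c : 'I_(n.+1 + n.+1)) with inl a | inr a => a != ord0 end.
Definition unit_mx (a b : 'I_nn.+1) : smatrix K vpar := delta_mx a b.

(* H_i acts by Hval i a on the basis vector a and by - Hval i a on \bar a. *)
Definition Hval (i a : nat) : int :=
  if i == 0%N then (a == 0)%N%:R + (a == 1)%N%:R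
  else if (i < n)%N then (a == i)%:R - (a == i.+1)%:R
  else (a == n)%:R.

(* t(k_i) for sg = 1, its inverse for sg = -1 *)
Definition vec_k (sg : int) (i : 'I_n.+1) : smatrix K vpar :=
  \sum_(a < n.+1) (qhi qh i ^ (sg * Hval i a) *: unit_mx (vidx a) (vidx a)
                 + qhi qh i ^ (- sg * Hval i a) *: unit_mx (vbar a) (vbar a)).

Definition vec_gen (g : gen n) : smatrix K vpar :=
  match g with
  | Gk i => vec_k 1 i
  | Gk' i => vec_k (-1) i
  | Ge i =>
      if i == ord0 then unit_mx (vidx 0) (vidx 1) + unit_mx (vbar 1) (vbar 0)
      else if (i < n)%N then
        unit_mx (vidx i) (vidx i.+1) - unit_mx (vbar i.+1) (vbar i)
      else unit_mx (vidx n) (vbar n)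
  | Gf i =>
      if i == ord0 then unit_mx (vidx 1) (vidx 0) - unit_mx (vbar 0) (vbar 1)
      else if (i < n)%N then
        unit_mx (vidx i.+1) (vidx i) - unit_mx (vbar i) (vbar i.+1)
      else unit_mx (vbar n) (vidx n)
  end.

Definition vec_rep : U -> smatrix K vpar := Ulift vec_gen.

End UqTensor.

Section GradedSub.
Variables (K : fieldType) (V : superModType K).

Record gsub := GSub {
  gmem :> V -> Prop;
  gsub0 : gmem 0;
  gsub_lin : forall (c : K) u v, gmem u -> gmem v -> gmem (c *: u + v);
  gsub_part : forall p u, gmem u -> gmem (hpart p u) }.

(* The smallest graded subspace that contains G and one and is stable under
   mul, i.e. the subsuperalgebra generated by G. *)
Inductive gen_mem (mul : V -> V -> V) (one : V) (G : V -> Prop) : V -> Prop :=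
  | gen_incl u : G u -> gen_mem mul one G u
  | gen_one : gen_mem mul one G one
  | gen_zero : gen_mem mul one G 0
  | gen_lin (c : K) u v :
      gen_mem mul one G u -> gen_mem mul one G v -> gen_mem mul one G (c *: u + v)
  | gen_mul u v :
      gen_mem mul one G u -> gen_mem mul one G v -> gen_mem mul one G (mul u v)
  | gen_part p u : gen_mem mul one G u -> gen_mem mul one G (hpart p u).

Definition gen_sub mul one G : gsub :=
  GSub (gen_zero mul one G) (@gen_lin mul one G) (@gen_part mul one G).

Variable S : gsub.
Definition gsort : Type := {v : V | `[< S v >]}.
HB.instance Definition _ := SubChoice.on gsort.

Lemma gsort_closed : submod_closed (fun v : V => `[< S v >]).
Proof.
split=> [|c u v /asboolP hu /asboolP hv]; apply/asboolP; first exact: gsub0.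
exact: gsub_lin.
Qed.
HB.instance Definition _ := GRing.SubChoice_isSubLmodule.Build
  K V (fun v : V => `[< S v >]) gsort gsort_closed.

Definition gin (v : V) (h : S v) : gsort := exist _ v (asboolT h).

Lemma gmemP (v : gsort) : S (val v).
Proof. exact/asboolP/(valP v). Qed.

Definition gpart p (v : gsort) : gsort := gin (gsub_part p (gmemP v)).
Lemma gpart_linear p : linear (gpart p).
Proof. by move=> c u v; apply: val_inj; rewrite /= !linearP. Qed.
Lemma gpartI p r v : gpart p (gpart r v) = if p == r then gpart p v else 0.
Proof. by apply: val_inj; rewrite /= hpartI; case: ifP => // _; rewrite linear0. Qed.
Lemma gpart_sum v : gpart false v + gpart true v = v.
Proof. by apply: val_inj; rewrite linearD /= hpart_sum. Qed.
HB.instance Definition _ := isSuper.Build K gsort gpart_linear gpartI gpart_sum.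

End GradedSub.
Coercion gsort : gsub >-> Sortclass.

Section Dual.
Variables (K : fieldType) (X : superModType K).

Definition dual : Type := {a : X -> K^o | `[< linear a >]}.
HB.instance Definition _ := SubChoice.on dual.
Definition dval (a : dual) : X -> K := val a.

Lemma dual_closed : submod_closed (fun a : X -> K^o => `[< linear a >]).
Proof.
split=> [|c a b /asboolP ha /asboolP hb]; apply/asboolP => d x y.
  by rewrite /= scaler0 addr0.
rewrite [LHS]/(c *: a (d *: x + y) + b (d *: x + y)) ha hb.
rewrite [RHS]/(d *: (c *: a x + b x) + (c *: a y + b y)).
by rewrite !scalerDr !scalerA [d * c]mulrC; exact: addrACA.
Qed.
HB.instance Definition _ := GRing.SubChoice_isSubLmodule.Build
  K (X -> K^o) (fun a : X -> K^o => `[< linear a >]) dual dual_closed.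

(* a itself when a is linear (mkdualE), as it is in each use below: for the
   matrix elements and the product of the dual of U, because vec_gen and
   Delta_gen are models. *)
Definition mkdual (a : X -> K) : dual := insubd (0 : dual) (a : X -> K^o).

Lemma mkdualE (a : X -> K) : linear (a : X -> K^o) -> dval (mkdual a) = a.
Proof. by move=> ha; rewrite /dval /mkdual val_insubd asboolT. Qed.

Lemma dual_linear (a : dual) : linear (val a).
Proof. exact/asboolP/(valP a). Qed.

(* The component of degree p of a form vanishes on X_(1 - p). *)
Definition dpart (p : bool) (a : dual) : dual := mkdual (dval a \o hpart p).
Lemma dpartE p a x : val (dpart p a) x = val a (hpart p x).
Proof.
by rewrite -[LHS]/(dval (dpart p a) x) mkdualE // => c u v; rewrite /= linearP; exact: dual_linear.
Qed.

Lemma dpart_linear p : linear (dpart p).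
Proof.
move=> c a b; apply/val_inj/funext => x.
rewrite [RHS]/(c *: val (dpart p a) x + val (dpart p b) x).
by rewrite !dpartE.
Qed.
Lemma dpartI p r a : dpart p (dpart r a) = if p == r then dpart p a else 0.
Proof.
apply/val_inj/funext => x; rewrite !dpartE hpartI eq_sym.
by case: eqP => [->|_]; rewrite ?dpartE // (lin0 (dual_linear a)).
Qed.
Lemma dpart_sum a : dpart false a + dpart true a = a.
Proof.
apply/val_inj/funext => x; rewrite [LHS]/(val (dpart false a) x + val (dpart true a) x).
rewrite !dpartE -[in RHS](hpart_sum x).
by have := dual_linear a 1 (hpart false x) (hpart true x); rewrite !scale1r.
Qed.
HB.instance Definition _ := isSuper.Build K dual dpart_linear dpartI dpart_sum.
End Dual.
Coercion dval : dual >-> Funclass.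

Section Coalgebra.
Variable K : fieldType.

(* <f . g, c> = <f (x) g, D c> *)
Definition conv (C : superModType K) (D : C -> tens C C) (f g : C -> K) : C -> K :=
  fun c => tform f g (D c).

(* (id (x) I)(D c) = I(c) one *)
Definition left_integral (C : superModType K) (D : C -> tens C C) (one : C)
    (I : C -> K) : Prop :=
  scalar I /\ forall c, tslice I (D c) = I c *: one.

Variables (X : superAlgType K) (B : gsub (dual X)).

(* The pairing of B (x) B with X (x) X, extending
   <a (x) b, x (x) y> = (-1)^([b][x]) <a, x> <b, y>. *)
Definition dpair (T : tens B B) (z : tens X X) : K :=
  tlift (fun a b : B => tform (val a : dual X) (val b : dual X) z : K^o) T.

(* The coproduct transposed from the product of X: the element T of B (x) B,
   unique because the pairing separates the points of B (x) B, such that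
   <T, x (x) y> = <a, xy>. *)
Definition coprod (a : B) : tens B B :=
  xget 0 [set T | forall x y, dpair T (pure x y) = (val a : dual X) (x * y)].

(* <nu(x), a> = (-1)^([x][a]) <a, x> *)
Definition nu (x : X) (a : B) : K :=
  \sum_(p : bool) \sum_(r : bool)
    (-1) ^+ (p && r) * (val (hpart r a) : dual X) (hpart p x).

End Coalgebra.

Section Functions.
Variables (K : fieldType) (n : nat) (qh : K).
Local Notation U := (Uq n qh).

Inductive gen0 : U -> Prop :=
  | gen0_k i : gen0 (uk qh i)
  | gen0_k' i : gen0 (uk' qh i)
  | gen0_e i : i != ord0 -> gen0 (ue qh i)
  | gen0_f i : i != ord0 -> gen0 (uf qh i).

Definition U0sub : gsub U := gen_sub *%R 1 gen0.
Definition Uq0 : Type := U0sub.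
HB.instance Definition _ := SuperMod.on Uq0.
HB.instance Definition _ := SubChoice.on Uq0.

Definition u0mul (x y : Uq0) : Uq0 := @gin K U U0sub _ (gen_mul (gmemP x) (gmemP y)).
Definition u0one : Uq0 := @gin K U U0sub _ (gen_one _ _ _).

Lemma u0mulA : associative u0mul.
Proof. by move=> x y z; apply: val_inj; rewrite /= mulrA. Qed.
Lemma u0mul1l : left_id u0one u0mul.
Proof. by move=> x; apply: val_inj; rewrite /= mul1r. Qed.
Lemma u0mul1r : right_id u0one u0mul.
Proof. by move=> x; apply: val_inj; rewrite /= mulr1. Qed.
Lemma u0mulDl : left_distributive u0mul +%R.
Proof. by move=> x y z; apply: val_inj; rewrite /= mulrDl. Qed.
Lemma u0mulDr : right_distributive u0mul +%R.
Proof. by move=> x y z; apply: val_inj; rewrite /= mulrDr. Qed.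
Lemma u0one_neq0 : u0one != 0.
Proof. by rewrite -(inj_eq val_inj) /= oner_neq0. Qed.
HB.instance Definition _ := GRing.Zmodule_isNzRing.Build Uq0
  u0mulA u0mul1l u0mul1r u0mulDl u0mulDr u0one_neq0.
Lemma u0scalerAl (c : K) (x y : Uq0) : c *: (x * y) = (c *: x) * y.
Proof. by apply: val_inj; rewrite /= scalerAl. Qed.
HB.instance Definition _ := GRing.Lmodule_isLalgebra.Build K Uq0 u0scalerAl.
Lemma u0scalerAr (c : K) (x y : Uq0) : c *: (x * y) = x * (c *: y).
Proof. by apply: val_inj; rewrite /= scalerAr. Qed.
HB.instance Definition _ := GRing.Lalgebra_isAlgebra.Build K Uq0 u0scalerAr.
Lemma u0part1 : hpart false (1 : Uq0) = 1.
Proof. by apply: val_inj; rewrite /= hpart1. Qed.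
Lemma u0partM p (x y : Uq0) :
  hpart p (x * y) = \sum_(r : bool) hpart r x * hpart (p (+) r) y.
Proof. by apply: val_inj; rewrite big_bool /= hpartM big_bool. Qed.
HB.instance Definition _ := isSuperAlg.Build K Uq0 u0part1 u0partM.

(* the product and the unit of the dual of U *)
Definition dmul (a b : dual U) : dual U := mkdual (conv (@Delta K n qh) a b).
Lemma counit_linear : linear (@counit K n qh : U -> K^o).
Proof.
move=> c u v; rewrite /counit (UliftD (model_eps n qh) (uscale c u) v).
by rewrite (UliftZ (model_eps n qh)).
Qed.
Definition deps : dual U := exist _ (@counit K n qh : U -> K^o) (asboolT counit_linear).
Definition tcoef (i j : 'I_(nn n).+1) : dual U := mkdual (fun u => vec_rep u i j).

(* The t_ab are homogeneous, and they are matrix elements of a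
   finite-dimensional graded representation, so that the subalgebra they
   generate in the dual of U is graded and lies in the finite dual. *)
Definition Asub : gsub (dual U) :=
  gen_sub dmul deps (fun a => exists i j, a = tcoef i j).

Definition restr (a : dual U) : dual Uq0 := mkdual (fun x : Uq0 => a (val x)).

Lemma restrE (a : dual U) x : val (restr a) x = a (val x).
Proof.
rewrite -[LHS]/(dval (restr a) x) mkdualE // => c u v.
exact: (dual_linear a c (val u) (val v)).
Qed.
Lemma restr_linear : linear restr.
Proof.
move=> c a b; apply/val_inj/funext => x.
rewrite [RHS]/(c *: val (restr a) x + val (restr b) x).
by rewrite !restrE.
Qed.

(* A_e is the image of A under restriction to U_q(g_0). *)
Definition Aemem (b : dual Uq0) : Prop := exists2 a, Asub a & b = restr a.
Lemma Ae0 : Aemem 0.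
Proof. by exists 0; [exact: gsub0 | rewrite (lin0 restr_linear)]. Qed.
Lemma Aelin (c : K) a b : Aemem a -> Aemem b -> Aemem (c *: a + b).
Proof.
move=> [a' ha ->] [b' hb ->]; exists (c *: a' + b'); first exact: gsub_lin.
by rewrite restr_linear.
Qed.
Lemma Aepart p a : Aemem a -> Aemem (hpart p a).
Proof.
move=> [a' ha ->]; exists (hpart p a'); first exact: gsub_part.
by apply/val_inj/funext => x; rewrite restrE [LHS]dpartE [RHS]dpartE restrE.
Qed.
Definition Aesub : gsub (dual Uq0) := GSub Ae0 Aelin Aepart.

Definition A_one : Asub := @gin K (dual U) Asub _ (gen_one _ _ _).
Definition resA (a : Asub) : Aesub :=
  @gin K (dual Uq0) Aesub _ 
    (ex_intro2 Asub (fun a' => restr (val a) = restr a') (val a) (gmemP a) erefl).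

Local Notation q := (qh ^+ 2).
Local Notation e i := (ue qh (inord i)).
Local Notation f i := (uf qh (inord i)).

(* psi_pos i and psi_neg i are psi_i and psi_(-i) for 1 <= i <= n, and
   psi_neg_rec j is psi_(-(n - j)); similarly for phi. *)
Fixpoint psi_pos (i : nat) : U :=
  match i with
  | i'.+1 =>
    if i' == 0%N then e 0 else psi_pos i' * e i' - q *: (e i' * psi_pos i')
  | 0 => 0
  end.

Fixpoint psi_neg_rec (j : nat) : U :=
  match j with
  | 0 => psi_pos n * e n - q ^+ 2 *: (e n * psi_pos n)
  | j'.+1 => let i := (n - j)%N in
     psi_neg_rec j' * e i - q *: (e i * psi_neg_rec j')
  end.
Definition psi_neg (i : nat) : U := psi_neg_rec (n - i).

Fixpoint phi_pos (i : nat) : U :=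
  match i with
  | i'.+1 =>
    if i' == 0%N then f 0 else f i' * phi_pos i' - q^-1 *: (phi_pos i' * f i')
  | 0 => 0
  end.

Fixpoint phi_neg_rec (j : nat) : U :=
  match j with
  | 0 => f n * phi_pos n - q ^- 2 *: (phi_pos n * f n)
  | j'.+1 => let i := (n - j)%N in
     f i * phi_neg_rec j' - q^-1 *: (phi_neg_rec j' * f i)
  end.
Definition phi_neg (i : nat) : U := phi_neg_rec (n - i).

Definition EE : U :=
  (\prod_(i <- iota 1 n) psi_pos i) * (\prod_(i <- rev (iota 1 n)) psi_neg i).
Definition FF : U :=
  (\prod_(i <- iota 1 n) phi_neg i) * (\prod_(i <- rev (iota 1 n)) phi_pos i).
Definition Gamma : U := EE * FF.

End Functions.

(* Main.v *)
Require Import Defs.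
From mathcomp Require Import all_boot all_algebra.
From mathcomp Require Import boolp classical_sets.
From mathcomp Require Import reals.
From mathcomp Require Import complex.
From mathcomp Require Import zify ring.
Set Implicit Arguments.
Unset Strict Implicit.
Unset Printing Implicit Defensive.
Import GRing.Theory.
Local Open Scope ring_scope.
Local Open Scope quotient_scope.

(** Linear forms on the algebra A of functions form a left U-module: x acts
    by precomposition with the right translation a |-> a(x _), the operator
    [ltrans x]. A form is a left integral exactly when U acts on it through the
    counit. The form v = int0 o P is fixed by U_q(g_0), and the claim is that
    Gamma v is fixed by all of U. The annihilator of v is a left ideal that
    contains y - eps(y) for y in U_q(g_0) ([annihilates]), so it is enough that
    x Gamma - eps(x) Gamma lies in every such left ideal, for x a generator
    ([left_integral_of_even_invariant]).

    U_q(g_0) acts on U by the adjoint action, given by the skew derivations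
    [ad_f i] and the operators [ad_e i]. Under it the psi's, and likewise the
    phi's, form a copy of the vector representation of U_q(sp(2n)): a string
    of 2n vectors in which each simple root moves an index p to p + 1
    ([odd_root]). The point of the proof is that no computation with the Serre
    relations is needed to see this. They only say that [ad_f i] is locally
    nilpotent, and then rank one representation theory does the rest: a vector
    of weight m killed by [ad_e i] is killed by [ad_f i] to the power m + 1
    ([ad_f_iter_eq0], [odd_root_adjoint]). Applying the [ad_f i] repeatedly to
    f_0^2 = 0 produces all quadratic relations: odd root vectors square to
    zero and q-anticommute, except that opposite pairs satisfy a recursion along
    the string ([odd_root_sqr], [odd_root_comm], [odd_root_pair]).

    Consequently every e_i and f_i with i > 0 commutes with EE and with FF up
    to scalars, because each term that its commutator could produce contains a
    square of an odd root vector; the weights of EE and FF are opposite, so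
    Gamma commutes with the k_i; and e_0 EE = 0, f_0 FF = 0 ([f0_desc]).
    What remains is f_0 EE FF. Moving f_0 through EE replaces a factor psi_p by
    {f_0, psi_p}. For p > 1 this is a combination of products of the k_0 and
    the e_i, i > 0, whose terms all contain some e_i; such an element carries
    the rest of the product into the left ideal, since e_i moves to the right
    end. For p = 1 it is (k_0^2 - k_0^-2)/(q - q^-1), and the remaining product
    has weight zero for k_0 because alpha_0 is isotropic ([f0_tail],
    [f0_ideal]).

    The algebra A is only accessible through its values on U. That it is
    closed under product and has a coproduct rests on two facts: the vector
    representation and the coproduct of U respect the defining relations
    ([model_vec], [model_Delta]). *)

(** * Identities in noncommutative algebras *)

(** A polynomial identity between noncommuting elements is reduced to the
    vanishing of its coefficients, one scalar equation for each word, which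
    commutative tactics can then solve. *)
Section NcReflection.
Variables (K : fieldType) (B : algType K).

Inductive nc_expr :=
  | NcVar of nat | NcZero | NcOne | NcAdd of nc_expr & nc_expr
  | NcOpp of nc_expr | NcMul of nc_expr & nc_expr | NcScale of K & nc_expr.

Fixpoint nc_eval (v : seq B) (t : nc_expr) : B :=
  match t with
  | NcVar i => nth 0 v i
  | NcZero => 0
  | NcOne => 1
  | NcAdd a b => nc_eval v a + nc_eval v b
  | NcOpp a => - nc_eval v a
  | NcMul a b => nc_eval v a * nc_eval v b
  | NcScale c a => c *: nc_eval v a
  end.

Fixpoint nc_same (m m' : seq nat) : bool :=
  match m, m' with
  | [::], [::] => true
  | i :: m, j :: m' => if Nat.eqb i j then nc_same m m' else false
  | _, _ => false
  end.

Fixpoint nc_insert (c : K) (m : seq nat) (l : seq (K * seq nat)) :=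
  match l with
  | [::] => [:: (c, m)]
  | (d, m') :: l' =>
    if nc_same m m' then (c + d, m') :: l' else (d, m') :: nc_insert c m l'
  end.

(** Distributes c * t * m over the sums in t and passes each resulting word to
    the continuation k; the continuation for a product expands its left factor,
    so that no intermediate list is built. *)
Fixpoint nc_norm (t : nc_expr) (c : K) (m : seq nat) (l : seq (K * seq nat))
    (k : K -> seq nat -> seq (K * seq nat) -> seq (K * seq nat)) :=
  match t with
  | NcVar i => k c (i :: m) l
  | NcZero => l
  | NcOne => k c m l
  | NcAdd a b => nc_norm a c m (nc_norm b c m l k) k
  | NcOpp a => nc_norm a (- c) m l k
  | NcMul a b => nc_norm b c m l (fun c m l => nc_norm a c m l k)
  | NcScale d a => nc_norm a (d * c) m l k
  end.

Fixpoint nc_zeros (l : seq (K * seq nat)) : Prop :=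
  match l with
  | [::] => True
  | [:: (c, _)] => c = 0
  | (c, _) :: l' => c = 0 /\ nc_zeros l'
  end.

Definition nc_mono (v : seq B) (m : seq nat) : B :=
  foldr (fun i b => nth 0 v i * b) 1 m.
Definition nc_value (v : seq B) (l : seq (K * seq nat)) : B :=
  foldr (fun u b => u.1 *: nc_mono v u.2 + b) 0 l.

Lemma nc_sameP m m' : nc_same m m' -> m = m'.
Proof.
elim: m m' => [|i m IH] [|j m'] //=.
by case E: (Nat.eqb i j) => // /IH ->; congr (_ :: _); apply/PeanoNat.Nat.eqb_eq.
Qed.

Lemma nc_insertE v c m l :
  nc_value v (nc_insert c m l) = c *: nc_mono v m + nc_value v l.
Proof.
elim: l => [|[d m'] l IH] //=; case E: (nc_same m m') => /=.
  by rewrite (nc_sameP E) scalerDl addrA.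
by rewrite IH addrCA.
Qed.

Lemma nc_normE v t c m l k (g : B -> B) :
  (forall c m l, nc_value v (k c m l) = c *: g (nc_mono v m) + nc_value v l) ->
  (forall x y, g (x + y) = g x + g y) ->
  (forall (d : K) x, g (d *: x) = d *: g x) ->
  nc_value v (nc_norm t c m l k) = c *: g (nc_eval v t * nc_mono v m) + nc_value v l.
Proof.
elim: t c m l k g => [i|||a IHa b IHb|a IHa|a IHa b IHb|d a IHa] c m l k g hk gD gZ /=.
- by rewrite hk.
- by rewrite mul0r -(scale0r 0) gZ scale0r scaler0 add0r.
- by rewrite hk mul1r.
- by rewrite (IHa _ _ _ _ g) // (IHb _ _ _ _ g) // mulrDl gD scalerDr addrA.
- by rewrite (IHa _ _ _ _ g) // mulNr -[in RHS]scaleN1r gZ scalerA mulrN1.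
- rewrite (IHb _ _ _ _ (fun x => g (nc_eval v a * x))) ?mulrA //.
  + by move=> c' m' l'; rewrite (IHa _ _ _ _ g).
  + by move=> x y; rewrite mulrDr gD.
  + by move=> d x; rewrite -scalerAr gZ.
- by rewrite (IHa _ _ _ _ g) // -scalerAl gZ scalerA mulrC.
Qed.

Lemma nc_zerosE v l : nc_zeros l -> nc_value v l = 0.
Proof.
elim: l => [|[c m] [|u l] IH] // => [c0|[c0 /IH h]]; rewrite [LHS]/= c0 scale0r add0r //.
Qed.

Lemma nc_correct v s t :
  nc_zeros (nc_norm (NcAdd s (NcOpp t)) 1 [::] [::] nc_insert) ->
  nc_eval v s = nc_eval v t.
Proof.
move=> /(nc_zerosE v); rewrite (@nc_normE _ _ _ _ _ _ id) //; last exact: nc_insertE.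
by rewrite /= scale1r mulr1 addr0 => /eqP; rewrite subr_eq0 => /eqP.
Qed.
End NcReflection.

Ltac nc_index x v :=
  lazymatch v with
  | x :: _ => constr:(O)
  | _ :: ?v' => let i := nc_index x v' in constr:(S i)
  end.
Ltac nc_add x v :=
  lazymatch v with
  | context [x :: _] => v
  | _ => constr:(x :: v)
  end.
Ltac nc_atoms t v :=
  lazymatch t with
  | (0)%R => v
  | (1)%R => v
  | (?a + ?b)%R => let v := nc_atoms a v in nc_atoms b v
  | (- ?a)%R => nc_atoms a v
  | (?a * ?b)%R => let v := nc_atoms a v in nc_atoms b v
  | (_ *: ?a)%R => nc_atoms a v
  | _ => nc_add t v
  end.
Ltac nc_reify K t v :=
  lazymatch t with
  | (0)%R => constr:(NcZero K)
  | (1)%R => constr:(NcOne K)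
  | (?a + ?b)%R => let a := nc_reify K a v in let b := nc_reify K b v in constr:(NcAdd a b)
  | (- ?a)%R => let a := nc_reify K a v in constr:(NcOpp a)
  | (?a * ?b)%R => let a := nc_reify K a v in let b := nc_reify K b v in constr:(NcMul a b)
  | (?c *: ?a)%R => let a := nc_reify K a v in constr:(@NcScale K c a)
  | _ => let i := nc_index t v in constr:(NcVar K i)
  end.
Ltac nc K :=
  rewrite ?expr2;
  lazymatch goal with
  | |- @eq ?T ?s ?t =>
    let v := nc_atoms s (@nil T) in
    let v := nc_atoms t v in
    let s' := nc_reify K s v in
    let t' := nc_reify K t v in
    refine (@nc_correct K _ v s' t' _);
    cbv [nc_zeros nc_norm nc_insert nc_same Nat.eqb]; repeat split
  end.

(** * The Cartan matrix *)

Section Cartan.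
Variable n : nat.

Lemma bformDl (u u' v : 'rV[int]_n.+1) : bform (u + u') v = bform u v + bform u' v.
Proof.
rewrite /bform -big_split; apply: eq_bigr => i _ /=; rewrite -big_split.
by apply: eq_bigr => j _ /=; rewrite mxE !mulrDl.
Qed.

Lemma bformZl c (u v : 'rV[int]_n.+1) : bform (c *: u) v = c * bform u v.
Proof.
rewrite /bform mulr_sumr; apply: eq_bigr => i _ /=; rewrite mulr_sumr.
by apply: eq_bigr => j _ /=; rewrite mxE !mulrA.
Qed.

Lemma dformC (i j : 'I_n.+1) : dform i j = dform j i.
Proof. by rewrite /dform eq_sym; case: eqP => // ->. Qed.

Lemma bformC (u v : 'rV[int]_n.+1) : bform u v = bform v u.
Proof.
rewrite /bform exchange_big; apply: eq_bigr => j _; apply: eq_bigr => i _.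
by rewrite dformC [u 0 i * _]mulrC.
Qed.

Lemma bform_delta a b : (a <= n)%N -> (b <= n)%N ->
  bform (delta n a) (delta n b) = if a == b then - (-1) ^+ (a == 0)%N else 0.
Proof.
move=> ha hb; rewrite /bform /delta.
rewrite (bigD1 (inord a)) //= [X in _ + X]big1 ?addr0; last first.
  by move=> i hi; rewrite big1 // => j _; rewrite mxE eqxx (negPf hi) !mul0r.
rewrite (bigD1 (inord b)) //= [X in _ + X]big1 ?addr0; last first.
  by move=> i hi; rewrite !mxE eqxx (negPf hi) mulr0 mul0r.
rewrite !mxE !eqxx !mul1r /dform -val_eqE /= !inordK //.
Qed.

Definition delta_form (a b : nat) : int :=
  if a == b then - (-1) ^+ (a == 0)%N else 0.

Lemma bform_alpha (i j : 'I_n.+1) : bform (alpha i) (alpha j) =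
  if (i < n)%N then
    if (j < n)%N then delta_form i j - delta_form i j.+1
                      - delta_form i.+1 j + delta_form i.+1 j.+1
    else 2 * (delta_form i n - delta_form i.+1 n)
  else if (j < n)%N then 2 * (delta_form n j - delta_form n j.+1)
  else 4 * delta_form n n.
Proof.
have E a b : (a <= n)%N -> (b <= n)%N ->
    bform (delta n a) (delta n b) = delta_form a b by exact: bform_delta.
have Z c u v : bform (u : 'rV[int]_n.+1) (c *: v) = c * bform u v.
  by rewrite bformC bformZl bformC.
have D u v w : bform (u : 'rV[int]_n.+1) (v + w) = bform u v + bform u w.
  by rewrite bformC bformDl !(bformC _ u).
have N u : - u = -1 *: (u : 'rV[int]_n.+1) by rewrite scaleN1r.
have M u : u *+ 2 = 2 *: (u : 'rV[int]_n.+1) by rewrite scaler_nat.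
have := ltn_ord i; have := ltn_ord j; rewrite !ltnS => hj hi.
rewrite /alpha; case: ifP => h1; case: ifP => h2; rewrite ?N ?M.
all: rewrite !(bformDl, bformZl, D, Z) !E //; ring.
Qed.

Lemma delta_formE a b : delta_form a b = ((a == b) && (a == 0))%N%:Z - ((a == b) && (a != 0))%N%:Z.
Proof. by rewrite /delta_form; case: eqP => // _; case: eqP. Qed.

Lemma bform_norm (i : 'I_n.+1) : (0 < i)%N ->
  bform (alpha i) (alpha i) = if (i < n)%N then -2 else -4.
Proof.
move=> i0; have hi := ltn_ord i; rewrite bform_alpha !delta_formE.
by repeat (case: ifP => ?); lia.
Qed.

Lemma cartanE (i j : 'I_n.+1) : (0 < n)%N -> cartan i j =
  (if i == ord0 then
     if j == ord0 then 0
     else if (j == 1 :> nat)%N then (if (1 < n)%N then 1 else 2) else 0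
   else if i == j then 2
   else if (j.+1 == i)%N then -1
   else if (i.+1 == j)%N then (if (j < n)%N then -1 else -2) else 0)%R.
Proof.
move=> n0; rewrite /cartan bform_alpha !delta_formE -!val_eqE /=.
have := ltn_ord i; have := ltn_ord j; rewrite !ltnS => hj hi.
case: eqP => [i0|/eqP i0].
  by rewrite i0 /=; repeat (case: ifP => ?); lia.
rewrite bform_norm; last by lia.
by repeat (case: ifP => ?); lia.
Qed.
End Cartan.

(** * The parameters q_i *)

Section QParameters.
Variables (K : fieldType) (n : nat) (qh : K).
Hypothesis n_gt0 : (0 < n)%N.
Hypothesis qh_neq0 : qh != 0.
Hypothesis q_generic : forall m : nat, (0 < m)%N -> (qh ^+ 2) ^+ m != 1.

Lemma qhiE (i : 'I_n.+1) : qhi qh i =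
  qh ^ (if i == ord0 then 1 else if (i < n)%N then -1 else -2).
Proof.
rewrite /qhi; case: eqP => [_|/eqP i0]; first by rewrite expr1z.
rewrite bform_norm; last by rewrite lt0n -val_eqE in i0 *.
by case: ifP.
Qed.

Lemma qhi_neq0 (i : 'I_n.+1) : qhi qh i != 0.
Proof. by rewrite qhiE expfz_neq0. Qed.

Lemma qi_neq0 (i : 'I_n.+1) : qi qh i != 0.
Proof. by rewrite /qi expf_neq0 // qhi_neq0. Qed.

Lemma qiXn_neq1 (i : 'I_n.+1) m : (0 < m)%N -> qi qh i ^+ m != 1.
Proof.
move=> m0; rewrite /qi qhiE; case: ifP => _; first by rewrite expr1z q_generic.
case: ifP => _.
  by rewrite exprN1 exprVn exprVn -[1]invr1 (inj_eq invr_inj) q_generic.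
have -> : qh ^ (-2 : int) = (qh ^+ 2)^-1 by [].
by rewrite !exprVn -[1]invr1 (inj_eq invr_inj) -exprM q_generic // muln_gt0.
Qed.

Lemma qi_neqV (i : 'I_n.+1) m : (0 < m)%N -> qi qh i ^+ m - qi qh i ^- m != 0.
Proof.
move=> m0; rewrite subr_eq0; apply/negP => /eqP h.
have /(qiXn_neq1 i)/negP[] : (0 < m + m)%N by rewrite addn_gt0 m0.
by rewrite exprD {2}h mulfV // expf_neq0 // qi_neq0.
Qed.

Lemma qhi_cartanC (i j : 'I_n.+1) :
  qhi qh i ^ cartan i j = qhi qh j ^ cartan j i.
Proof.
rewrite !qhiE !exprz_exp !cartanE //; congr (_ ^ _).
have := ltn_ord i; have := ltn_ord j; rewrite -!val_eqE /= !ltnS => hj hi.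
by repeat (case: ifP => ?); lia.
Qed.
End QParameters.

(** * Serre relations as iterated q-commutators *)

Section SerrePolynomial.
Variables (K : fieldType) (n : nat) (qh : K) (B : algType K).
Hypothesis n_gt0 : (0 < n)%N.
Hypothesis qh_neq0 : qh != 0.
Hypothesis q_generic : forall m : nat, (0 < m)%N -> (qh ^+ 2) ^+ m != 1.

Definition qcomm (c : K) (x z : B) : B := x * z - c *: (z * x).

Fixpoint qad (c : nat -> K) (x : B) (m : nat) (z : B) : B :=
  if m is m'.+1 then qcomm (c m') x (qad c x m' z) else z.

Lemma qadD c x m z z' : qad c x m (z + z') = qad c x m z + qad c x m z'.
Proof. by elim: m => //= m ->; rewrite /qcomm; nc K; ring. Qed.

Lemma qcommC c d x z : qcomm c x (qcomm d x z) = qcomm d x (qcomm c x z).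
Proof. by rewrite /qcomm; nc K; ring. Qed.

Lemma cartan_serre (i j : 'I_n.+1) : i != ord0 -> j != i ->
  [\/ cartan i j = 0, cartan i j = -1 | cartan i j = -2].
Proof.
move=> i0 ij; rewrite cartanE // (negPf i0) eq_sym (negPf ij).
by do 3?[case: ifP => _]; [constructor 2 | constructor 2 | constructor 3 | constructor 1].
Qed.

Lemma qnumE (i : 'I_n.+1) : let t := qi qh i in
  [/\ qnum t 0 = 0, qnum t 1 = 1, qnum t 2 = t + t^-1
    & qnum t 3 = t ^+ 2 + 1 + t ^- 2].
Proof.
set t := qi qh i => /=.
have t0 : t != 0 by exact: qi_neq0.
have t1 : t - t^-1 != 0 by have := qi_neqV qh_neq0 q_generic i (ltn0Sn 0); rewrite expr1.
split; rewrite /qnum ?expr0 ?expr1 ?invr1 ?subrr ?mul0r ?divff //.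
  by apply: (mulIf t1); rewrite mulfVK //; field.
by apply: (mulIf t1); rewrite mulfVK //; field.
Qed.

(** The symmetric q-binomial coefficients are those of the product of the
    commuting factors L - q_i^h R with h = -a, -a - 2, ..., a, where L and R
    are left and right multiplication by x_i and a = a_ij. As a_ij is 0, -1 or
    -2, there are at most three factors to expand. *)
Lemma serre_qad (x : 'I_n.+1 -> B) (i j : 'I_n.+1) : i != ord0 -> j != i ->
  serre qh x i j =
  qad (fun r => qi qh i ^ (- cartan i j - 2 * r%:Z)) (x i) `|1 - cartan i j|%N (x j).
Proof.
move=> i0 ij; rewrite /serre /=.
have [e0 e1 e2 e3] := qnumE i.
have t0 : qi qh i != 0 by exact: qi_neq0.
have n2 : qnum (qi qh i) 2 != 0.
  by rewrite mulf_neq0 ?invr_neq0 ?qi_neqV //; have := qi_neqV qh_neq0 q_generic i (ltn0Sn 0); rewrite expr1.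
have n3 : qnum (qi qh i) 3 != 0.
  by rewrite mulf_neq0 ?invr_neq0 ?qi_neqV //; have := qi_neqV qh_neq0 q_generic i (ltn0Sn 0); rewrite expr1.
have f0 : qfact (qi qh i) 0 = 1 by rewrite /qfact big_nil.
have fS m : qfact (qi qh i) m.+1 = qfact (qi qh i) m * qnum (qi qh i) m.+1.
  by rewrite /qfact big_nat_recr.
have e2n : qi qh i * qi qh i + 1 != 0.
  by rewrite -(mulVf t0) -mulrDl mulf_neq0 // -e2.
have e3n : (qi qh i * qi qh i + 1) * (qi qh i * qi qh i) + 1 != 0.
  have -> : (qi qh i * qi qh i + 1) * (qi qh i * qi qh i) + 1
      = qi qh i * qi qh i * qnum (qi qh i) 3 by rewrite e3; field.
  by rewrite mulf_neq0 ?n3 // mulf_neq0 ?t0.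
have [-> | -> | ->] := cartan_serre i0 ij.
- rewrite (_ : absz (1 - 0)%R = 1%N) // !big_ord_recl big_ord0 /= /qbinom /= !fS f0 e1.
  rewrite /qcomm /bump /= !mulr1 !divr1 !expr0 !expr1 mulr1 mul1r expr0z scale1r addr0.
  by rewrite mulN1r ?invr1 ?mulr1 scaleN1r scale1r.
- rewrite (_ : absz (1 - -1)%R = 2%N) // !big_ord_recl big_ord0 /= /qbinom /bump /= !fS f0 e1 e2.
  rewrite /qcomm /= ?subn0 ?subn1 ?subnn /= ?expr0 ?expr1.
  rewrite (_ : (- -1 - 2 * 0)%R = 1 :> int) // (_ : (- -1 - 2 * 1)%R = -1 :> int) // expr1z exprN1.
  by nc K; rewrite ?fS ?f0 ?e1 ?e2 /=; field; rewrite ?t0 ?e2n ?oner_eq0.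
- rewrite (_ : absz (1 - -2)%R = 3%N) // !big_ord_recl big_ord0 /= /qbinom /bump /= !fS f0 e1 e2 e3.
  rewrite /qcomm /= ?subn0 ?subn1 ?subnn /= ?expr0 ?expr1.
  rewrite (_ : (- -2 - 2 * 0)%R = 2 :> int) // (_ : (- -2 - 2 * 1)%R = 0 :> int) //
   (_ : (- -2 - 2 * 2)%R = -2 :> int) // expr0z.
  rewrite (_ : qi qh i ^ 2 = qi qh i ^+ 2) // (_ : qi qh i ^ (-2) = qi qh i ^- 2) //.
  rewrite !exprS !expr0 !mulr1.
  by nc K; rewrite ?fS ?f0 ?e1 ?e2 ?e3 /=; field; rewrite ?t0 ?e2n ?e3n.
Qed.

(** The exponents -a - 2r are symmetric about 0, and the factors commute. *)
Lemma qad_rev (i j : 'I_n.+1) x z : i != ord0 -> j != i ->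
  qad (fun r => qi qh i ^ (- cartan i j - 2 * r%:Z)) x `|1 - cartan i j|%N z =
  qad (fun r => qi qh i ^ (cartan i j + 2 * r%:Z)) x `|1 - cartan i j|%N z.
Proof.
move=> i0 ij; have [-> | -> | ->] := cartan_serre i0 ij => //=.
  by rewrite qcommC.
by rewrite qcommC [in RHS]qcommC [X in _ = qcomm _ _ X]qcommC.
Qed.

End SerrePolynomial.

(** * The adjoint action of the even part *)

Section Adjoint.
Variables (K : fieldType) (n : nat) (qh : K) (B : algType K).
Hypothesis n_gt0 : (0 < n)%N.
Hypothesis qh_neq0 : qh != 0.
Hypothesis q_generic : forall m : nat, (0 < m)%N -> (qh ^+ 2) ^+ m != 1.
Variables (k k' e f : 'I_n.+1 -> B).
Hypothesis H : osp_rel qh k k' e f.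
Local Notation t := (@qi K n qh).

Definition has_weight (i : 'I_n.+1) (h : int) (x : B) :=
  k i * x = qhi qh i ^ h *: (x * k i).

Lemma qhi_sqr i (h : int) : qhi qh i ^ h * qhi qh i ^ h = t i ^ h.
Proof. by rewrite /qi -expfzMl. Qed.

Lemma wtM i a b x y : has_weight i a x -> has_weight i b y -> has_weight i (a + b) (x * y).
Proof.
move=> hx hy; rewrite /has_weight mulrA hx -scalerAl -(mulrA x (k i)) hy -scalerAr scalerA mulrA.
by rewrite -expfzDr // qhi_neq0.
Qed.

Lemma wtB i a c x y : has_weight i a x -> has_weight i a y -> has_weight i a (x - c *: y).
Proof.
rewrite /has_weight => hx hy; rewrite mulrBr -scalerAr hx hy mulrBl -scalerAl scalerBr.
by rewrite !scalerA [c * _]mulrC.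
Qed.

Lemma wtZ i a c x : has_weight i a x -> has_weight i a (c *: x).
Proof. by rewrite /has_weight => hx; rewrite -scalerAr hx -scalerAl !scalerA mulrC. Qed.

Lemma wt_k' i h x : has_weight i h x -> k' i * x = qhi qh i ^ (- h) *: (x * k' i).
Proof.
move=> hx; have hx' : k i * x * k' i = qhi qh i ^ h *: x.
  by rewrite hx -scalerAl -mulrA (rel_kk' H) mulr1.
have <- : k' i * (k i * x * k' i) = x * k' i by rewrite !mulrA (rel_k'k H) mul1r.
rewrite hx' -scalerAr scalerA -expfzDr ?qhi_neq0 //.
by rewrite addNr expr0z scale1r.
Qed.

Lemma wt_K i h x : has_weight i h x -> k i ^+ 2 * x = t i ^ h *: (x * k i ^+ 2).
Proof.
move=> hx; rewrite !expr2 -(mulrA (k i)) hx -scalerAr (mulrA (k i)) hx -scalerAl scalerA.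
by rewrite qhi_sqr (mulrA x).
Qed.

Lemma wt_K' i h x : has_weight i h x -> k' i ^+ 2 * x = t i ^ (- h) *: (x * k' i ^+ 2).
Proof.
move=> /wt_k' hx; rewrite !expr2 -(mulrA (k' i)) hx -scalerAr (mulrA (k' i)) hx -scalerAl scalerA.
by rewrite qhi_sqr (mulrA x).
Qed.

Lemma KK' i : k i ^+ 2 * k' i ^+ 2 = 1.
Proof. by rewrite !expr2 mulrA -(mulrA (k i)) (rel_kk' H) mulr1 (rel_kk' H). Qed.

Lemma K'K i : k' i ^+ 2 * k i ^+ 2 = 1.
Proof. by rewrite !expr2 mulrA -(mulrA (k' i)) (rel_k'k H) mulr1 (rel_k'k H). Qed.

Lemma wt_e i j : has_weight i (cartan i j) (e j).
Proof.
by rewrite /has_weight scalerAl -(rel_ke H) -!mulrA (rel_k'k H) mulr1.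
Qed.

Lemma wt_f i j : has_weight i (- cartan i j) (f j).
Proof.
by rewrite /has_weight scalerAl -(rel_kf H) -!mulrA (rel_k'k H) mulr1.
Qed.

Lemma wt_k i j : has_weight i 0 (k j).
Proof. by rewrite /has_weight expr0z scale1r (rel_kk H). Qed.

Lemma wt_k'0 i j : has_weight i 0 (k' j).
Proof.
have := wt_k' (wt_k j i); rewrite oppr0 expr0z scale1r => h.
by rewrite /has_weight expr0z scale1r h.
Qed.

(** The adjoint action for the coproduct f |-> f (x) 1 + K (x) f: this choice
    makes [ad_f] a skew derivation whose values on odd root vectors are the
    q-commutators that define the next ones. *)
Definition ad_K i x := k i ^+ 2 * x * k' i ^+ 2.
Definition ad_f i x := f i * x - ad_K i x * f i.
Definition ad_e i x := (e i * x - x * e i) * k i ^+ 2.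

Lemma ad_KE i h x : has_weight i h x -> ad_K i x = t i ^ h *: x.
Proof. by move=> hx; rewrite /ad_K (wt_K hx) -scalerAl -mulrA KK' mulr1. Qed.

Lemma ad_fE i h x : has_weight i h x -> ad_f i x = f i * x - t i ^ h *: (x * f i).
Proof. by move=> hx; rewrite /ad_f (ad_KE hx) scalerAl. Qed.

Lemma ad_f0 i : ad_f i 0 = 0.
Proof. by rewrite /ad_f /ad_K !(mulr0, mul0r) subrr. Qed.

Lemma ad_fD i x y : ad_f i (x + y) = ad_f i x + ad_f i y.
Proof. by rewrite /ad_f /ad_K; nc K; ring. Qed.

Lemma ad_fZ i c x : ad_f i (c *: x) = c *: ad_f i x.
Proof. by rewrite /ad_f /ad_K; nc K; ring. Qed.

Lemma ad_e0 i : ad_e i 0 = 0.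
Proof. by rewrite /ad_e !(mulr0, mul0r) subrr mul0r. Qed.

Lemma ad_fM i h x y : has_weight i h x ->
  ad_f i (x * y) = ad_f i x * y + t i ^ h *: (x * ad_f i y).
Proof.
move=> hx; rewrite (ad_fE hx) /ad_f {1}/ad_K (mulrA (k i ^+ 2)) (wt_K hx) /ad_K.
by nc K; ring.
Qed.

Lemma wt_ad_f i j h x : has_weight j h x -> has_weight j (h - cartan j i) (ad_f i x).
Proof.
have wK : has_weight j 0 (k i ^+ 2) by rewrite expr2 -(addr0 0); apply: wtM; exact: wt_k.
have wK' : has_weight j 0 (k' i ^+ 2) by rewrite expr2 -(addr0 0); apply: wtM; exact: wt_k'0.
move=> hx; rewrite /ad_f -[_ * f i]scale1r; apply: wtB.
  by rewrite addrC; apply: wtM => //; exact: wt_f.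
apply: wtM; last exact: wt_f.
by rewrite -(addr0 h) -(add0r h); apply: wtM => //; apply: wtM.
Qed.

Lemma qi_cartanC i j : t i ^ cartan i j = t j ^ cartan j i.
Proof. by rewrite -!qhi_sqr qhi_cartanC. Qed.

Lemma ef_comm i j : i != j -> e i * f j = f j * e i.
Proof.
move=> ij; have := rel_ef H i j; rewrite (negPf ij).
case: eqP => [i0|_]; first case: eqP => [j0|_].
- by rewrite i0 j0 eqxx in ij.
- by rewrite expr0 scale1r => /eqP; rewrite subr_eq0 => /eqP.
- by rewrite expr0 scale1r => /eqP; rewrite subr_eq0 => /eqP.
Qed.

Lemma wt_ad_e i j h x : has_weight j h x -> has_weight j (h + cartan j i) (ad_e i x).
Proof.
have wK : has_weight j 0 (k i ^+ 2) by rewrite expr2 -(addr0 0); apply: wtM; exact: wt_k.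
move=> hx; rewrite /ad_e -(addr0 (h + _)); apply: wtM => //.
rewrite -[x * e i]scale1r; apply: wtB; last by apply: wtM => //; exact: wt_e.
by rewrite addrC; apply: wtM => //; exact: wt_e.
Qed.

Lemma ad_e_ad_f_comm i j h x : i != j -> has_weight j h x ->
  ad_e i (ad_f j x) = ad_f j (ad_e i x).
Proof.
move=> ij hx; have efC := ef_comm ij.
have kf : k i ^+ 2 * f j = t i ^ (- cartan i j) *: (f j * k i ^+ 2) := wt_K (wt_f i j).
rewrite (ad_fE hx) (ad_fE (wt_ad_e i hx)) /ad_e.
rewrite -(mulrA _ (k i ^+ 2)) kf -scalerAr scalerA expfzDr ?qi_neq0 // -mulrA.
rewrite -qi_cartanC -expfzDr ?qi_neq0 // subrr expr0z mulr1.
transitivity (f j * ((e i * x - x * e i) * k i ^+ 2)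
   - t j ^ h *: ((e i * x - x * e i) * (f j * k i ^+ 2))
   + ((e i * f j - f j * e i) * x - t j ^ h *: (x * (e i * f j - f j * e i))) * k i ^+ 2).
  by nc K; ring.
by rewrite efC subrr mulr0 mul0r scaler0 subrr mul0r addr0.
Qed.

(** [ad_e i], [ad_f i] and conjugation by k_i^2 form a representation of
    U_q(sl(2)). *)
Lemma ad_e_ad_f_id i h x : i != ord0 -> has_weight i h x ->
  ad_e i (ad_f i x)
  = ad_f i (ad_e i x) + ((t i - (t i)^-1)^-1 * (t i ^ h - t i ^ (- h))) *: x.
Proof.
move=> i0 hx; have := rel_ef H i i; rewrite eqxx (negPf i0) expr0 scale1r => efC.
have kf : k i ^+ 2 * f i = t i ^ (- cartan i i) *: (f i * k i ^+ 2) := wt_K (wt_f i i).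
have xk : k i ^+ 2 * x = t i ^ h *: (x * k i ^+ 2) := wt_K hx.
have xk' : k' i ^+ 2 * x = t i ^ (- h) *: (x * k' i ^+ 2) := wt_K' hx.
have [kk' k'k] := (KK' i, K'K i).
rewrite (ad_fE hx) (ad_fE (wt_ad_e i hx)) /ad_e.
rewrite -(mulrA _ (k i ^+ 2)) kf -scalerAr scalerA expfzDr ?qi_neq0 // -mulrA.
rewrite -expfzDr ?qi_neq0 // subrr expr0z mulr1.
transitivity (f i * ((e i * x - x * e i) * k i ^+ 2)
   - t i ^ h *: ((e i * x - x * e i) * (f i * k i ^+ 2))
   + ((e i * f i - f i * e i) * x - t i ^ h *: (x * (e i * f i - f i * e i))) * k i ^+ 2).
  by nc K; ring.
congr (_ + _); rewrite efC; set c := (_ - _)^-1.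
transitivity (c *: ((k i ^+ 2 * x - t i ^ h *: (x * k i ^+ 2)) * k i ^+ 2)
   + c *: (t i ^ h *: (x * (k' i ^+ 2 * k i ^+ 2)) - k' i ^+ 2 * x * k i ^+ 2)).
  by nc K; ring.
rewrite xk subrr mul0r scaler0 add0r xk' k'k mulr1 -scalerAl -mulrA k'k mulr1.
by rewrite -scalerBl scalerA.
Qed.

Lemma cartan_diag (i : 'I_n.+1) : i != ord0 -> cartan i i = 2.
Proof. by move=> i0; rewrite cartanE // (negPf i0) eqxx. Qed.

Lemma wt_iter i j h x N : has_weight j h x ->
  has_weight j (h - cartan j i *+ N) (iter N (ad_f i) x).
Proof.
move=> hx; elim: N => [|N IH] /=; first by rewrite mulr0n subr0.
by rewrite mulrS opprD [- _ - _]addrC addrA; exact: wt_ad_f.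
Qed.

Lemma iter_ad_f0 i N : iter N (ad_f i) 0 = 0.
Proof. by elim: N => //= N ->; exact: ad_f0. Qed.

(** The formula E F^(N+1) x = [N+1] [h-N] F^N x for a vector of weight h killed
    by E. *)
Lemma ad_e_iter i h x N : i != ord0 -> has_weight i h x -> ad_e i x = 0 ->
  ad_e i (iter N.+1 (ad_f i) x) =
  ((t i - (t i)^-1)^-1 ^+ 2 * (t i ^+ N.+1 - t i ^- N.+1)
     * (t i ^ (h - N%:Z) - t i ^ (N%:Z - h))) *: iter N (ad_f i) x.
Proof.
move=> i0 hx ex; have t0 : t i != 0 by exact: qi_neq0.
have t1 : t i - (t i)^-1 != 0.
  by have := qi_neqV qh_neq0 q_generic i (ltn0Sn 0); rewrite expr1.
elim: N => [|N IH].
  rewrite /= (ad_e_ad_f_id i0 hx) ex ad_f0 add0r; congr (_ *: _).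
  by rewrite !expr1 expr2 mulfVK // subr0 sub0r.
have hN := wt_iter i N.+1 hx; rewrite iterS (ad_e_ad_f_id i0 hN) IH ad_fZ -iterS.
rewrite -scalerDl; congr (_ *: _); rewrite cartan_diag //.
have -> : h - 2 *+ N.+1 = h - N%:Z - N%:Z - 2 by rewrite -mulr_natl; lia.
have -> : N.+1%:Z - h = - (h - N%:Z - 1) by lia.
have -> : h - N.+1%:Z = h - N%:Z - 1 by lia.
have -> : N%:Z - h = - (h - N%:Z) by lia.
rewrite -!invr_expz !expfzDr // -![t i ^ (- N%:Z)]invr_expz -!exprnP !exprS !expr0.
have := expf_neq0 N t0; have := expfz_neq0 h t0.
move: (t i ^ h) (t i ^+ N) (t i) t0 t1 => b a u u0 u1 b0 a0.
rewrite -[u ^ (-2)]/((u ^+ 2)^-1) -[u ^ (-1)]/(u^-1).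
have u2 : u * u - 1 != 0 by rewrite -(mulfV u0) -mulrBr mulf_neq0.
by field; rewrite ?u0 ?a0 ?b0 ?u2.
Qed.

(** Let N be minimal with F^(N+1) x = 0 and suppose N > m. Then
    0 = E F^(N+1) x is a multiple of F^N x by [N+1] [m-N], which is nonzero
    since q is not a root of unity; this contradicts the choice of N. *)
Lemma ad_f_iter_eq0 i m x : i != ord0 -> has_weight i m%:Z x -> ad_e i x = 0 ->
  (exists N, iter N (ad_f i) x = 0) -> iter m.+1 (ad_f i) x = 0.
Proof.
move=> i0 hx ex [N]; elim: N => [|N IH] hN.
  by rewrite -(iter_ad_f0 i m.+1); congr (iter _ _ _).
have [lt_mN | le_Nm] := ltnP m N; last first.
  by rewrite -(subnK (le_Nm : N.+1 <= m.+1)%N) iterD hN iter_ad_f0.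
apply: IH; have := ad_e_iter N i0 hx ex; rewrite hN ad_e0 => /esym/eqP.
have t1 : t i - (t i)^-1 != 0.
  by have := qi_neqV qh_neq0 q_generic i (ltn0Sn 0); rewrite expr1.
rewrite scaler_eq0 !mulf_eq0 (negPf (qi_neqV qh_neq0 q_generic i (ltn0Sn N))).
rewrite !invr_eq0 (negPf t1) /=.
have -> : N%:Z - m%:Z = (N - m)%:Z by lia.
have -> : m%:Z - N%:Z = - (N - m)%:Z by lia.
rewrite -exprnP -exprnN -oppr_eq0 opprB.
have -> : (t i ^+ (N - m) - t i ^- (N - m) == 0) = false.
  by apply/negbTE/qi_neqV => //; rewrite subn_gt0.
by move=> /eqP.
Qed.

(** A skew derivation is nilpotent on a product as soon as it is nilpotent on
    both factors: each application lowers one of the two nilpotency orders. *)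
Lemma iter_ad_fM_eq0 i h x y a b : has_weight i h x -> iter a (ad_f i) x = 0 -> iter b (ad_f i) y = 0 ->
  iter (a + b) (ad_f i) (x * y) = 0.
Proof.
move: {2 3}(a + b)%N (erefl (a + b)%N) => N.
elim: N a b h x y => [|N IH] a b h x y.
  by case: a => [|a] //; case: b => // _ _ x0 _; rewrite (_ : x = 0) ?mul0r.
case: a => [_ _ x0 _|a]; first by rewrite (_ : x = 0) ?mul0r ?iter_ad_f0.
case: b => [_ _ _ y0|b]; first by rewrite (_ : y = 0) ?mulr0 ?iter_ad_f0.
move=> eN hx hxa hyb; rewrite iterSr (ad_fM _ hx).
have iterD : forall u v, iter N (ad_f i) (u + v) = iter N (ad_f i) u + iter N (ad_f i) v.
  by elim: (N) => //= M IHM u v; rewrite IHM ad_fD.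
have iterZ : forall c u, iter N (ad_f i) (c *: u) = c *: iter N (ad_f i) u.
  by elim: (N) => //= M IHM c u; rewrite IHM ad_fZ.
rewrite iterD iterZ (IH a b.+1 _ _ _ _ (wt_ad_f i hx)) ?(IH a.+1 b _ _ _ _ hx) //.
all: by rewrite ?scaler0 ?addr0 -?iterSr //; lia.
Qed.

(** The Serre relation is ad(f_i)^(1 - a_ij) f_j = 0. *)
Lemma serre_ad_f i j : i != ord0 -> j != i -> exists N, iter N (ad_f i) (f j) = 0.
Proof.
move=> i0 ij; exists `|1 - cartan i j|%N.
have := rel_sf H i0 ij; rewrite serre_qad // => <-.
move: (absz _) => m; elim: m => //= m IH; rewrite (ad_fE (wt_iter i m (wt_f i j))) IH.
rewrite /qcomm cartan_diag //; congr (_ - _ ^ _ *: _); lia.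
Qed.

(** * The string of odd root vectors *)

(** The simple root that leads from position p to position p + 1 of the string:
    alpha_1, ..., alpha_(n-1), alpha_n, alpha_(n-1), ..., alpha_1. At the last
    position 2n - 1 it is the value 0, which no even simple root takes. *)
Definition node (p : nat) : 'I_n.+1 := inord (minn p.+1 (n.*2.-1 - p)).

(** Position p holds phi_(p+1) when p < n and phi_(-(2n-p)) otherwise. The
    scalar q_i is q^-1 for i < n and q^-2 for i = n. *)
Fixpoint odd_root_rec (p : nat) : B :=
  if p is p'.+1 then
    f (node p') * odd_root_rec p' - t (node p') *: (odd_root_rec p' * f (node p'))
  else f ord0.
Fact odd_root_key : unit. Proof. by []. Qed.
(** Locked, because unification would otherwise unfold [odd_root p.+1] into a
    q-commutator. *)
Definition odd_root := locked_with odd_root_key odd_root_rec.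

Lemma odd_root_0 : odd_root 0 = f ord0.
Proof. by rewrite /odd_root unlock. Qed.

Lemma odd_root_rec_step p :
  odd_root p.+1 = f (node p) * odd_root p - t (node p) *: (odd_root p * f (node p)).
Proof. by rewrite /odd_root unlock. Qed.

Lemma nodeE p : (node p : nat) = minn p.+1 (n.*2.-1 - p).
Proof. by rewrite /node inordK //; lia. Qed.

Lemma node_neq0 p : (p < n.*2.-1)%N -> node p != ord0.
Proof. by move=> hp; rewrite -val_eqE /= nodeE; lia. Qed.

Lemma node_last (i : 'I_n.+1) : i != ord0 -> (node n.*2.-1 == i) = false.
Proof. by rewrite -!val_eqE /= nodeE => i0; lia. Qed.

(** In the sl(2)-string of alpha_i through position p, the vector at p is the
    upper end when alpha_i leads out of p, and the lower end when alpha_i leads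
    into p. *)
Definition enters (i : 'I_n.+1) (p : nat) : bool := (0 < p)%N && (node p.-1 == i).
Definition odd_root_wt (i : 'I_n.+1) (p : nat) : int := (node p == i)%:Z - (enters i p)%:Z.

Lemma node_enters i p : (p < n.*2)%N -> node p == i -> enters i p = false.
Proof. by rewrite /enters -!val_eqE /= !nodeE => *; lia. Qed.

Lemma odd_root_wt0 (i : 'I_n.+1) : i != ord0 -> odd_root_wt i 0 = - cartan i ord0.
Proof.
move=> i0; rewrite /odd_root_wt /enters cartanE // (negPf i0) -val_eqE /= nodeE.
by move: i0; rewrite -val_eqE /=; have := ltn_ord i; repeat (case: ifP => ?); lia.
Qed.

Lemma odd_root_wtS (i : 'I_n.+1) p : i != ord0 -> (p < n.*2.-1)%N ->
  odd_root_wt i p - cartan i (node p) = odd_root_wt i p.+1.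
Proof.
move=> i0 hp; rewrite /odd_root_wt /enters cartanE // (negPf i0) -!val_eqE /= !nodeE.
by move: i0; rewrite -val_eqE /=; have := ltn_ord i; repeat (case: ifP => ?); lia.
Qed.

Lemma wt_odd_root (i : 'I_n.+1) p : i != ord0 -> (p < n.*2)%N ->
  has_weight i (odd_root_wt i p) (odd_root p).
Proof.
move=> i0; elim: p => [|p IH] hp; first by rewrite odd_root_0 odd_root_wt0 //; exact: wt_f.
have hp' : (p < n.*2.-1)%N by lia.
rewrite odd_root_rec_step -odd_root_wtS //; apply: wtB; last first.
  by apply: wtM; [apply: IH; lia | exact: wt_f].
by rewrite addrC; apply: wtM; [exact: wt_f | apply: IH; lia].
Qed.

Lemma odd_root_ad p : (p < n.*2.-1)%N -> odd_root p.+1 = ad_f (node p) (odd_root p).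
Proof.
move=> hp; have h : has_weight (node p) 1 (odd_root p).
  have := @wt_odd_root (node p) p (node_neq0 hp); rewrite /odd_root_wt eqxx node_enters //; last by lia.
  by apply; lia.
by rewrite odd_root_rec_step (ad_fE h) expr1z.
Qed.

(** Induction along the string. The value of [ad_e i] is computed by moving it
    through the [ad_f] that defines the vector. Once it is known, the vector is
    either killed by [ad_e i] and of weight 0, or the image under [ad_f i] of
    a vector that is killed by [ad_e i] and of weight 1; in both cases
    [ad_f_iter_eq0] shows that [ad_f i] kills it. *)
Lemma odd_root_adjoint p : (p < n.*2)%N -> forall i, i != ord0 ->
  [/\ exists N, iter N (ad_f i) (odd_root p) = 0,
      ad_e i (odd_root p) = (if enters i p then odd_root p.-1 else 0)
    & ad_f i (odd_root p) = (if node p == i then odd_root p.+1 else 0)].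
Proof.
elim/ltn_ind: p => [[|p]] IH hp i i0.
  have ef0 : e i * f ord0 = f ord0 * e i by exact: ef_comm.
  have E0 : ad_e i (odd_root 0) = 0 by rewrite odd_root_0 /ad_e ef0 subrr mul0r.
  have N0 : exists N, iter N (ad_f i) (odd_root 0) = 0.
    by rewrite odd_root_0; apply: serre_ad_f => //; rewrite eq_sym.
  split=> //; case: eqP => [<-|/eqP ni]; first by rewrite -odd_root_ad //; lia.
  apply: (@ad_f_iter_eq0 i 0) => //.
  by have := wt_odd_root i0 hp; rewrite /odd_root_wt (negPf ni).
have hp1 : (p < n.*2.-1)%N by lia.
have hp2 : (p < n.*2)%N by lia.
have cS := odd_root_ad hp1; have c0 := node_neq0 hp1.
have [Np Ep Fp] := IH p (ltnSn p) hp2 i i0.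
have N : exists N, iter N (ad_f i) (odd_root p.+1) = 0.
  case: (eqVneq (node p) i) => [ci | nci].
    have [N hN] := Np; exists N; rewrite cS ci.
    by rewrite -iterSr iterS hN ad_f0.
  have [N hN] := Np; have [M hM] := serre_ad_f i0 nci.
  exists (M + N)%N; rewrite odd_root_rec_step.
  have iterD : forall m u v, iter m (ad_f i) (u + v) = iter m (ad_f i) u + iter m (ad_f i) v.
    by elim=> //= m IHm u v; rewrite IHm ad_fD.
  have iterZ : forall m c u, iter m (ad_f i) (c *: u) = c *: iter m (ad_f i) u.
    by elim=> //= m IHm c u; rewrite IHm ad_fZ.
  rewrite -scaleNr iterD iterZ (iter_ad_fM_eq0 (wt_f _ _) hM hN) add0r addnC.
  by rewrite (iter_ad_fM_eq0 (wt_odd_root i0 hp2) hN hM) scaler0.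
have E : ad_e i (odd_root p.+1) = if enters i p.+1 then odd_root p else 0.
  rewrite cS /enters /=; case: eqP => [ci | /eqP nci].
    have hw := wt_odd_root i0 hp2; rewrite /odd_root_wt ci eqxx in hw.
    rewrite node_enters ?ci // in hw.
    rewrite ci (ad_e_ad_f_id i0 hw) Ep node_enters ?ci // ad_f0 add0r.
    have t1 : t i - (t i)^-1 != 0.
      by have := qi_neqV qh_neq0 q_generic i (ltn0Sn 0); rewrite expr1.
    by rewrite expr1z -exprnN expr1 mulVf // scale1r.
  rewrite (ad_e_ad_f_comm (h := odd_root_wt (node p) p)) // 1?eq_sym //; last exact: wt_odd_root.
  rewrite Ep; case: ifP => [bi|_]; last by rewrite ad_f0.
  have /andP[p0 /eqP pi] := bi.
  have [||_ _ ->//] := IH p.-1 _ _ (node p) c0; try lia.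
  by rewrite pi eq_sym (negPf nci).
split=> //; case: eqP => [ci|/eqP nci].
  rewrite (@odd_root_ad p.+1) ?ci //.
  by move: i0; rewrite -ci -val_eqE /= nodeE; lia.
have hw := wt_odd_root i0 hp; rewrite /odd_root_wt (negPf nci) /enters /= in hw.
case: (eqVneq (node p) i) hw => [ci | nci'] hw; last first.
  apply: (@ad_f_iter_eq0 i 0) => //.
  by rewrite E /enters /= (negPf nci').
rewrite cS ci; apply: (@ad_f_iter_eq0 i 1) => //.
  by have := wt_odd_root i0 hp2; rewrite /odd_root_wt ci eqxx node_enters ?ci.
by rewrite Ep node_enters ?ci.
Qed.

Lemma ad_f_odd_root (i : 'I_n.+1) p : i != ord0 -> (p < n.*2)%N ->
  ad_f i (odd_root p) = if node p == i then odd_root p.+1 else 0.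
Proof. by move=> i0 hp; have [] := odd_root_adjoint hp i0. Qed.

Lemma ad_e_odd_root (i : 'I_n.+1) p : i != ord0 -> (p < n.*2)%N ->
  ad_e i (odd_root p) = if enters i p then odd_root p.-1 else 0.
Proof. by move=> i0 hp; have [] := odd_root_adjoint hp i0. Qed.

Lemma ad_f_odd_rootM (i : 'I_n.+1) p x : i != ord0 -> (p < n.*2)%N ->
  ad_f i (odd_root p * x) = (if node p == i then odd_root p.+1 else 0) * x
    + t i ^ odd_root_wt i p *: (odd_root p * ad_f i x).
Proof. by move=> i0 hp; rewrite (ad_fM _ (wt_odd_root i0 hp)) ad_f_odd_root. Qed.

Lemma odd_root_wt_node p : (p < n.*2)%N -> odd_root_wt (node p) p = 1.
Proof. by move=> hp; rewrite /odd_root_wt eqxx node_enters. Qed.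

Lemma odd_root_wt_nodeS p : (p.+1 < n.*2)%N -> odd_root_wt (node p) p.+1 = -1.
Proof.
move=> hp; rewrite /odd_root_wt /enters /= eqxx.
by case: eqP => // /(congr1 val); rewrite /= !nodeE; lia.
Qed.

Lemma node_nodeS p : (p.+1 < n.*2)%N -> (node p.+1 == node p) = false.
Proof. by move=> hp; apply/eqP => /(congr1 val); rewrite /= !nodeE; lia. Qed.

Lemma qi_sum_neq0 i : t i + (t i)^-1 != 0.
Proof.
have := qi_neqV qh_neq0 q_generic i (ltn0Sn 1); apply: contraNneq => h.
have -> : t i ^+ 2 - t i ^- 2 = (t i + (t i)^-1) * (t i - (t i)^-1).
  by field; exact: qi_neq0.
by rewrite h mul0r.
Qed.

(** ad(f)^2 applied to x_p^2 = 0 gives (q_i + q_i^-1) x_(p+1)^2 = 0. *)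
Lemma odd_root_sqr p : (p < n.*2)%N -> odd_root p * odd_root p = 0.
Proof.
elim: p => [|p IH] hp; first by have := rel_f0 H; rewrite odd_root_0 expr2.
have hp' : (p < n.*2)%N by lia.
have hp1 : (p < n.*2.-1)%N by lia.
have c0 := node_neq0 hp1.
have := congr1 (ad_f (node p)) (congr1 (ad_f (node p)) (IH hp')); rewrite !ad_f0.
rewrite ad_f_odd_rootM // ad_f_odd_root // eqxx ad_fD ad_fZ !ad_f_odd_rootM // !ad_f_odd_root // eqxx.
rewrite node_nodeS // odd_root_wt_node // odd_root_wt_nodeS // !(mul0r, mulr0, scaler0, addr0, add0r).
rewrite expr1z -scalerDl addrC => /eqP; rewrite scaler_eq0 -[t _ ^ (-1)]/((t (node p))^-1).
by rewrite (negPf (qi_sum_neq0 _)) => /eqP.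
Qed.

Local Notation tau := ((qh ^+ 2)^-1).

Lemma qi_node p : (p < n.*2.-1)%N -> (p.+1 != n)%N -> t (node p) = tau.
Proof.
move=> hp hn; rewrite /qi qhiE (negPf (node_neq0 hp)) nodeE ifT; last by lia.
by rewrite -[qh ^ (-1)]/(qh^-1) exprVn.
Qed.

(** From x_b x_a to x_(b+1) x_a one applies the ad(f_i) that raises b, provided
    that it does not move a. It fails to fix a only next to the excluded
    opposite pair; to step over that pair one applies ad(f_i)^2 to the relation
    for the positions a - 1 and b, which raises both. *)
Lemma odd_root_comm a b : (a < b < n.*2)%N -> (a + b != n.*2.-1)%N ->
  odd_root b * odd_root a + tau *: (odd_root a * odd_root b) = 0.
Proof.
elim/ltn_ind: a b => a IHa; elim=> [//|b IHb] hab hs.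
have hb : (b < n.*2.-1)%N by lia.
have hb2 : (b < n.*2)%N by lia.
have ha2 : (a < n.*2)%N by lia.
have c0 := node_neq0 hb.
case: (eqVneq a b) => [ab|nab].
  have := congr1 (ad_f (node b)) (odd_root_sqr hb2); rewrite ad_f0 ad_f_odd_rootM //.
  rewrite ad_f_odd_root // eqxx odd_root_wt_node // expr1z qi_node ?ab //; lia.
(* The simple root that raises b moves a only if a and b, or a and b + 1, are
   opposite. *)
case: (eqVneq (a + b)%N n.*2.-1) => [sab|nsab]; last first.
  have ni : (node a == node b) = false.
    by apply/eqP => /(congr1 val); rewrite /= !nodeE; lia.
  have nb : enters (node b) a = false.
    by rewrite /enters; apply/andP => [[a0 /eqP /(congr1 val)]]; rewrite /= !nodeE; lia.
  have /(congr1 (ad_f (node b))) := IHb ltac:(lia) ltac:(lia); rewrite ad_f0.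
  rewrite ad_fD ad_fZ !ad_f_odd_rootM // !ad_f_odd_root // eqxx ni /odd_root_wt ni nb.
  by rewrite subrr expr0z scale1r mulr0 scaler0 addr0 mul0r add0r.
have a0 : (0 < a)%N by lia.
(* Here a and b are opposite: both a - 1 and b are raised by the same root. *)
have E : node a.-1 = node b by apply: val_inj; rewrite /= !nodeE; lia.
have hbS : (b.+1 < n.*2)%N by lia.
have ha1 : (a.-1 < n.*2)%N by lia.
have naS : (node a == node b) = false.
  by apply/eqP => /(congr1 val); rewrite /= !nodeE; lia.
have w1 : odd_root_wt (node b) a.-1 = 1 by rewrite -E odd_root_wt_node.
have wa : odd_root_wt (node b) a = -1.
  by rewrite /odd_root_wt naS /enters a0 E eqxx.
have aS : a.-1.+1 = a by rewrite prednK.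
have tE : t (node b) != 0 by exact: qi_neq0.
have /(congr1 (ad_f (node b))) := IHa a.-1 ltac:(lia) b ltac:(lia) ltac:(lia).
rewrite ad_f0 ad_fD ad_fZ !ad_f_odd_rootM // !ad_f_odd_root // E eqxx aS w1 odd_root_wt_node //.
move/(congr1 (ad_f (node b))); rewrite ad_f0 ad_fD ad_fZ 2!ad_fD 2!ad_fZ.
rewrite !ad_f_odd_rootM // !ad_f_odd_root // E eqxx aS naS node_nodeS // w1 wa.
rewrite odd_root_wt_node // odd_root_wt_nodeS //.
rewrite !(mul0r, mulr0, scaler0, addr0, add0r) !expr1z -[t _ ^ (-1)]/((t (node b))^-1).
rewrite -!scalerDl scalerA [tau * _]mulrC -scalerA -scalerDr => /eqP.
by rewrite scaler_eq0 addrC (negPf (qi_sum_neq0 _)) => /eqP.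
Qed.

(** Obtained by raising the relation for the positions j and 2n - 2 - j: the
    same simple root leads out of both. *)
Lemma odd_root_pair j : (j.+1 < n)%N ->
  odd_root (n.*2.-1 - j) * odd_root j + tau *: (odd_root (n.*2.-1 - j.+1) * odd_root j.+1)
  + tau *: (odd_root j.+1 * odd_root (n.*2.-1 - j.+1))
  + tau ^+ 2 *: (odd_root j * odd_root (n.*2.-1 - j)) = 0.
Proof.
move=> hj; set b := (n.*2.-1 - j.+1)%N.
have -> : (n.*2.-1 - j)%N = b.+1 by rewrite /b; lia.
have hb : (b < n.*2)%N by rewrite /b; lia.
have hj2 : (j < n.*2)%N by lia.
have hb' : (b < n.*2.-1)%N by rewrite /b; lia.
have E : node j = node b by apply: val_inj; rewrite /= !nodeE /b; lia.
have c0 := node_neq0 hb'.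
have T : t (node b) = tau by apply: qi_node => //; rewrite /b; lia.
have w1 : odd_root_wt (node b) j = 1 by rewrite -E odd_root_wt_node.
have /(congr1 (ad_f (node b))) : odd_root b * odd_root j + tau *: (odd_root j * odd_root b) = 0.
  by apply: odd_root_comm; rewrite /b; lia.
rewrite ad_f0 ad_fD ad_fZ !ad_f_odd_rootM // !ad_f_odd_root // E eqxx w1 odd_root_wt_node // expr1z T.
by rewrite scalerDr scalerA -expr2 !addrA.
Qed.

Lemma odd_root_pair_mid : exists c, odd_root n.-1 * odd_root n = c *: (odd_root n * odd_root n.-1).
Proof.
have h1 : (n.-1 < n.*2)%N by lia.
have h2 : (n.-1 < n.*2.-1)%N by lia.
exists (- (t (node n.-1))^-1).
have := congr1 (ad_f (node n.-1)) (odd_root_sqr h1).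
rewrite ad_f0 ad_f_odd_rootM ?node_neq0 // ad_f_odd_root ?node_neq0 // eqxx odd_root_wt_node //.
rewrite prednK // expr1z => /eqP; rewrite addr_eq0 => /eqP ->.
by rewrite scalerN scaleNr opprK scalerA mulVf ?scale1r // qi_neq0.
Qed.

(** By the recursion, x_j x_(-j) is a combination of the products
    x_(-m) x_m with m >= j, where -m denotes the position opposite to m. *)
Lemma odd_root_pair_kill j x : (j < n)%N ->
  (forall m, (j <= m < n)%N -> odd_root (n.*2.-1 - m) * odd_root m * x = 0) ->
  odd_root j * odd_root (n.*2.-1 - j) * x = 0.
Proof.
move: {2}(n - j)%N (erefl (n - j)%N) => d; elim: d j => [|d IH] j hd hj hx; first by lia.
case: (ltnP j.+1 n) => hjn.
  have h1 := hx j ltac:(lia); have h2 := hx j.+1 ltac:(lia).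
  have h3 := IH j.+1 ltac:(lia) hjn (fun m hm => hx m ltac:(lia)).
  have := congr1 (fun y => y * x) (odd_root_pair hjn).
  rewrite mul0r !mulrDl -!scalerAl h1 h2 h3 !scaler0 !add0r => /eqP.
  by rewrite scaler_eq0 expf_eq0 invr_eq0 expf_eq0 (negPf qh_neq0) !andbF => /eqP.
have jn : j = n.-1 by lia.
have nE : (n.*2.-1 - n.-1)%N = n by lia.
have [c hc] := odd_root_pair_mid; have := hx j ltac:(lia).
by rewrite jn nE hc -scalerAl => ->; rewrite scaler0.
Qed.

(** * The products of all odd root vectors *)

Fixpoint desc_prod m : B := if m is m'.+1 then odd_root m' * desc_prod m' else 1.
Fixpoint asc_prod m l : B := if l is l'.+1 then odd_root m * asc_prod m.+1 l' else 1.

Lemma odd_root_comm_scale a b : (a < b < n.*2)%N -> (a + b != n.*2.-1)%N ->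
  odd_root a * odd_root b = - (tau^-1) *: (odd_root b * odd_root a).
Proof.
move=> hab hs; have := odd_root_comm hab hs => /eqP; rewrite addr_eq0 => /eqP ->.
by rewrite scaleNr scalerN opprK scalerA mulVf ?scale1r // invr_eq0 expf_neq0.
Qed.

Lemma odd_root0_desc m : (0 < m < n.*2)%N -> odd_root 0 * desc_prod m = 0.
Proof.
elim: m => [//|m IH] hm; case: (posnP m) => [-> /=|m0].
  by rewrite mulr1 odd_root_sqr //; lia.
rewrite /= mulrA odd_root_comm_scale; try lia.
by rewrite -scalerAl -mulrA IH ?mulr0 ?scaler0 //; lia.
Qed.

(** For m > j the pair q-commutes with the first factor, so that j can be
    increased. For m = j the first factor occurs twice once the inner pair has
    been reversed, and the correction terms have m > j. *)
Lemma pair_desc m j : (j <= m < n)%N ->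
  odd_root (n.*2.-1 - m) * odd_root m * desc_prod (n.*2 - j) = 0.
Proof.
move: {2}(n - j)%N (erefl (n - j)%N) => d; elim: d j m => [|d IH] j m hd hm; first by lia.
have -> : (n.*2 - j)%N = (n.*2.-1 - j).+1 by lia.
rewrite [desc_prod _.+1]/=.
have IHj m' : (j < m' < n)%N -> odd_root (n.*2.-1 - m') * odd_root m' * desc_prod (n.*2.-1 - j) = 0.
  move=> hm'; have -> : (n.*2.-1 - j = n.*2 - j.+1)%N by lia.
  by apply: IH; lia.
case: (eqVneq j m) => [<-|jm].
  rewrite -mulrA (mulrA (odd_root j)).
  (* The first factor is now followed by the pair at j in the wrong order. *)
  have [jn|jn] := ltnP j.+1 n; last first.
    have [c] := odd_root_pair_mid; have -> : j = n.-1 by lia.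
    have -> : (n.*2.-1 - n.-1)%N = n by lia.
    move=> ->; rewrite -scalerAl -scalerAr !mulrA odd_root_sqr ?mul0r ?scaler0 //; lia.
  have h1 : odd_root j.+1 * odd_root (n.*2.-1 - j.+1) * desc_prod (n.*2.-1 - j) = 0.
    by apply: odd_root_pair_kill => // m' hm'; apply: IHj; lia.
  have h2 := IHj j.+1 ltac:(lia).
  have := congr1 (fun y => odd_root (n.*2.-1 - j) * (y * desc_prod (n.*2.-1 - j))) (odd_root_pair jn).
  rewrite mul0r mulr0 !mulrDl !mulrDr -!scalerAl -!scalerAr h1 h2.
  rewrite -(mulrA _ (odd_root j)) (mulrA _ _ (odd_root j * _)) odd_root_sqr; last lia.
  rewrite mul0r !mulr0 !scaler0 !add0r => /eqP.
  by rewrite scaler_eq0 expf_eq0 invr_eq0 expf_eq0 (negPf qh_neq0) !andbF => /eqP.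
have c1 := @odd_root_comm_scale m (n.*2.-1 - j) ltac:(lia) ltac:(lia).
have c2 := @odd_root_comm_scale (n.*2.-1 - m) (n.*2.-1 - j) ltac:(lia) ltac:(lia).
have := IHj m ltac:(lia); rewrite -mulrA => hm0.
rewrite -(mulrA _ (odd_root m)) (mulrA (odd_root m)) c1 -scalerAl -scalerAr !mulrA c2.
by rewrite -!scalerAl -!mulrA hm0 mulr0 !scaler0.
Qed.

Lemma f0_desc : f ord0 * desc_prod n.*2 = 0.
Proof.
have h m : (0 < m < n)%N -> odd_root (n.*2.-1 - m) * odd_root m * desc_prod n.*2.-1 = 0.
  by move=> hm; have := @pair_desc m 1 hm; rewrite subn1.
have -> : desc_prod n.*2 = odd_root n.*2.-1 * desc_prod n.*2.-1.
  by have -> : n.*2 = n.*2.-1.+1 by lia.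
rewrite -odd_root_0 mulrA -{1}(subn0 n.*2.-1); apply: odd_root_pair_kill => // m hm.
case: (posnP m) => [->|m0]; last by apply: h; lia.
by rewrite -mulrA odd_root0_desc ?mulr0 //; lia.
Qed.

Lemma ad_f1 i : ad_f i 1 = 0.
Proof. by rewrite /ad_f /ad_K (mulr1 (k i ^+ 2)) KK' mulr1 mul1r subrr. Qed.

Lemma ad_e1 i : ad_e i 1 = 0.
Proof. by rewrite /ad_e mulr1 mul1r subrr mul0r. Qed.

Lemma ad_eM i h x y : has_weight i h y ->
  ad_e i (x * y) = t i ^ (- h) *: (ad_e i x * y) + x * ad_e i y.
Proof.
move=> hy; have yK := wt_K hy; rewrite /ad_e -(mulrA _ (k i ^+ 2) y) yK.
rewrite -scalerAr scalerA -expfzDr ?qi_neq0 // addNr expr0z scale1r.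
by nc K; ring.
Qed.

(** The weight of the vector at position p for all k_i, including k_0; for
    i > 0 it agrees with [odd_root_wt]. *)
Definition full_wt (i : 'I_n.+1) (p : nat) : int :=
  - cartan i ord0 - \sum_(r < p) cartan i (node r).

Lemma wt_odd_root_full i p : has_weight i (full_wt i p) (odd_root p).
Proof.
rewrite /full_wt; elim: p => [|p IH]; first by rewrite big_ord0 subr0 odd_root_0; exact: wt_f.
rewrite odd_root_rec_step big_ord_recr /= opprD addrA; apply: wtB.
  by rewrite addrC; apply: wtM => //; exact: wt_f.
by apply: wtM => //; exact: wt_f.
Qed.

Lemma wt_desc i m : has_weight i (\sum_(p < m) full_wt i p) (desc_prod m).
Proof.
elim: m => [|m IH]; first by rewrite big_ord0 /has_weight /= expr0z scale1r mulr1 mul1r.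
by rewrite big_ord_recr /= addrC; apply: wtM => //; exact: wt_odd_root_full.
Qed.

Lemma wt_asc i m l : has_weight i (\sum_(p < l) full_wt i (m + p)) (asc_prod m l).
Proof.
elim: l m => [|l IH] m; first by rewrite big_ord0 /has_weight /= expr0z scale1r mulr1 mul1r.
rewrite big_ord_recl addn0 /=; apply: wtM; first exact: wt_odd_root_full.
rewrite (eq_bigr (fun p : 'I_l => full_wt i (m.+1 + p))) //.
by move=> p _; rewrite /= /bump add1n addnS.
Qed.

(** Raising a factor other than the first one duplicates its left neighbour. *)
Lemma ad_f_desc (i : 'I_n.+1) m : i != ord0 -> (m <= n.*2)%N ->
  ad_f i (desc_prod m) = if enters i m then odd_root m * desc_prod m.-1 else 0.
Proof.
move=> i0; elim: m => [|m IH] hm; first by rewrite ad_f1.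
rewrite [desc_prod _]/= ad_f_odd_rootM // IH ?(ltnW hm) // /enters /=.
case: eqP => [mi|_]; first by rewrite [_ && _]node_enters ?mi // mulr0 scaler0 addr0.
case: ifP => [/andP[m0 _]|_]; last by rewrite mul0r mulr0 scaler0 addr0.
by rewrite mulrA odd_root_sqr // !mul0r scaler0 addr0.
Qed.

Lemma ad_e_desc (i : 'I_n.+1) m : i != ord0 -> (m <= n.*2)%N -> ad_e i (desc_prod m) = 0.
Proof.
move=> i0; elim: m => [|m IH] hm; first by rewrite ad_e1.
rewrite [desc_prod _]/= (ad_eM _ (wt_desc i m)) IH ?(ltnW hm) // mulr0 addr0 ad_e_odd_root //.
case: ifP => [/andP[m0 _]|_]; last by rewrite mul0r scaler0.
by case: m m0 hm {IH} => // m _ hm; rewrite /= mulrA odd_root_sqr ?mul0r ?scaler0 // ltnW.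
Qed.

(** Raising any factor duplicates its right neighbour; the last factor, at the
    end of the string, is killed. *)
Lemma ad_f_asc (i : 'I_n.+1) m l : i != ord0 -> (m + l = n.*2)%N -> ad_f i (asc_prod m l) = 0.
Proof.
move=> i0; elim: l m => [|l IH] m hm; first by rewrite ad_f1.
rewrite [asc_prod _ _]/= ad_f_odd_rootM //; last by lia.
rewrite IH ?mulr0 ?scaler0 ?addr0; last by lia.
case: eqP => [mi|_]; last by rewrite mul0r.
have hm' : (m < n.*2.-1)%N by move: i0; rewrite -mi -val_eqE /= nodeE; lia.
case: l hm {IH} => [|l] hm; first by lia.
by rewrite /= mulrA odd_root_sqr ?mul0r //; lia.
Qed.

(** Lowering a factor other than the first one duplicates its left
    neighbour. *)
Lemma ad_e_asc (i : 'I_n.+1) m l : i != ord0 -> (m + l <= n.*2)%N ->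
  exists c, ad_e i (asc_prod m l) =
    c *: (if enters i m then odd_root m.-1 * asc_prod m.+1 l.-1 else 0).
Proof.
move=> i0; elim: l m => [|l IH] m hm; first by exists 0; rewrite ad_e1 scale0r.
rewrite [asc_prod _ _]/= (ad_eM _ (wt_asc i m.+1 l)) ad_e_odd_root //; last by lia.
have [c ->] := IH m.+1 ltac:(lia).
exists (t i ^ (- (\sum_(p < l) full_wt i (m.+1 + p)))).
rewrite [X in _ + X](_ : _ = 0) ?addr0.
  by case: ifP => _ //; rewrite mul0r.
case: ifP => _; last by rewrite scaler0 mulr0.
by rewrite /= -scalerAr mulrA odd_root_sqr ?mul0r ?scaler0 //; lia.
Qed.

Lemma ad_f_eq0 i h x : has_weight i h x -> ad_f i x = 0 -> f i * x = t i ^ h *: (x * f i).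
Proof. by move=> hx; rewrite (ad_fE hx) => /eqP; rewrite subr_eq0 => /eqP. Qed.

Lemma ad_e_eq0 i x : ad_e i x = 0 -> e i * x = x * e i.
Proof.
move=> /(congr1 (fun y => y * k' i ^+ 2)).
by rewrite /ad_e -mulrA KK' mulr1 mul0r => /eqP; rewrite subr_eq0 => /eqP.
Qed.

Lemma e_desc i : i != ord0 -> e i * desc_prod n.*2 = desc_prod n.*2 * e i.
Proof. by move=> i0; apply: ad_e_eq0; apply: ad_e_desc. Qed.

Lemma f_desc i : i != ord0 -> exists c, f i * desc_prod n.*2 = c *: (desc_prod n.*2 * f i).
Proof.
move=> i0; exists (t i ^ (\sum_(p < n.*2) full_wt i p)).
apply: ad_f_eq0 (wt_desc i _) _; rewrite ad_f_desc // /enters.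
by rewrite node_last // andbF.
Qed.

Lemma e_asc i : i != ord0 -> e i * asc_prod 0 n.*2 = asc_prod 0 n.*2 * e i.
Proof.
by move=> i0; apply: ad_e_eq0; have [c ->] := @ad_e_asc i 0 n.*2 i0 (leqnn _); rewrite scaler0.
Qed.

Lemma f_asc i m l : i != ord0 -> (m + l = n.*2)%N ->
  exists c, f i * asc_prod m l = c *: (asc_prod m l * f i).
Proof.
move=> i0 hm; exists (t i ^ (\sum_(p < l) full_wt i (m + p))).
exact: ad_f_eq0 (wt_asc i _ _) (ad_f_asc i0 hm).
Qed.

End Adjoint.

Arguments odd_root {K n} qh {B} f p.
Arguments desc_prod {K n} qh {B} f m.
Arguments asc_prod {K n} qh {B} f m l.
Arguments has_weight {K n} qh {B} k i h x.

(** * Invariance of the product in a left ideal *)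

Section Invariance.
Variables (K : fieldType) (n : nat) (qh : K) (B : algType K).
Hypothesis n_gt0 : (0 < n)%N.
Hypothesis qh_neq0 : qh != 0.
Hypothesis q_generic : forall m : nat, (0 < m)%N -> (qh ^+ 2) ^+ m != 1.
Variables (k k' e f : 'I_n.+1 -> B).
Hypothesis H : osp_rel qh k k' e f.
Local Notation t := (@qi K n qh).

Definition negate0 (x : 'I_n.+1 -> B) i := if i == ord0 then - x i else x i.
Local Notation e' := (negate0 e).

Lemma serre_negate0 (x : 'I_n.+1 -> B) i j : i != ord0 ->
  serre qh (negate0 x) i j = if j == ord0 then - serre qh x i j else serre qh x i j.
Proof.
move=> i0; rewrite /serre /negate0 (negPf i0); case: ifP => // _.
by rewrite -sumrN; apply: eq_bigr => mu _; rewrite mulrN mulNr scalerN.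
Qed.

(** The Chevalley involution: it turns each statement about the phi's into one
    about the psi's. The sign on e_0 is needed since the bracket [e_0, f_0] is
    symmetric while k_0^2 - k_0^-2 changes sign. *)
Lemma osp_rel_swap : osp_rel qh k' k f e'.
Proof.
have wk i h x : has_weight qh k i h x -> k' i * x * k i = qhi qh i ^ (- h) *: x.
  move=> /(wt_k' qh_neq0 H) ->.
  by rewrite -scalerAl -mulrA (rel_k'k H) mulr1.
split.
- move=> i j; have := wt_k' qh_neq0 H (wt_k'0 qh_neq0 H i j).
  by rewrite oppr0 expr0z scale1r.
- exact: (rel_k'k H).
- exact: (rel_kk' H).
- by move=> i j; rewrite (wk i _ _ (wt_f H i j)) opprK.
- move=> i j; have hE : has_weight qh k i (cartan i j) (e' j).
    rewrite /negate0; case: ifP => _; last exact: (wt_e H).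
    by rewrite -scaleN1r; apply: wtZ; exact: (wt_e H).
  exact: wk.
- move=> i j; rewrite /negate0; have E := rel_ef H j i.
  rewrite [j == i]eq_sym andbC in E; case: (eqVneq i j) E => [<- | nij].
    case: ifP => j0 /=; rewrite ?expr0 ?expr1 ?scale1r ?scaleN1r ?opprK => E.
      by rewrite mulrN mulNr -[k' i ^+ 2 - _]opprB scalerN -E opprD addrC.
    by rewrite -[k' i ^+ 2 - _]opprB scalerN -E opprB.
  have -> : (i == ord0) && (j == ord0) = false.
    by apply: contra_neqF nij => /andP[/eqP -> /eqP ->].
  rewrite expr0 !scale1r => /eqP; rewrite subr_eq0 => /eqP E.
  by case: ifP => _; rewrite ?mulrN ?mulNr E ?opprK ?addNr ?subrr.
- exact: (rel_f0 H).
- by rewrite /negate0 eqxx sqrrN; exact: (rel_e0 H).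
- exact: (rel_sf H).
- move=> i j i0 ij; rewrite serre_negate0 // (rel_se H) // oppr0.
  by case: ifP.
Qed.

Local Notation H' := osp_rel_swap.

Variable L : B -> Prop.
Hypothesis L_lin : forall c x y, L x -> L y -> L (c *: x + y).
Hypothesis L_mul : forall x y, L y -> L (x * y).
Hypothesis L_e : forall i, i != ord0 -> L (e i).
Hypothesis L_f : forall i, i != ord0 -> L (f i).
Hypothesis L_k : forall i, L (k i - 1).
Hypothesis L_k' : forall i, L (k' i - 1).

Lemma ideal0 : L 0.
Proof. by have := L_mul 0 (L_k ord0); rewrite mul0r. Qed.
Lemma idealZ c x : L x -> L (c *: x).
Proof. by move=> hx; rewrite -[_ *: x]addr0; apply: L_lin => //; exact: ideal0. Qed.
Lemma idealD x y : L x -> L y -> L (x + y).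
Proof. by move=> hx hy; rewrite -[x]scale1r; exact: L_lin. Qed.
Lemma idealB x y : L x -> L y -> L (x - y).
Proof. by move=> hx hy; rewrite addrC -scaleN1r; exact: L_lin. Qed.

Lemma ideal_K i x : L (x * k i ^+ 2 - x).
Proof.
rewrite (_ : _ - _ = x * (k i + 1) * (k i - 1)); first exact: L_mul.
by nc K; ring.
Qed.
Lemma ideal_K' i x : L (x * k' i ^+ 2 - x).
Proof.
rewrite (_ : _ - _ = x * (k' i + 1) * (k' i - 1)); first exact: L_mul.
by nc K; ring.
Qed.

Local Notation psi := (odd_root qh e').
Local Notation W := (asc_prod qh e').
Local Notation F := (desc_prod qh f n.*2).

Lemma wt_tail i m l : (m + l = n.*2)%N -> exists h, has_weight qh k i h (W m l * F).
Proof.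
move=> _; have := wt_k' qh_neq0 H' (wt_asc qh_neq0 H' i m l) => hW.
eexists; apply: (wtM qh_neq0); [exact: hW | exact: (wt_desc qh_neq0 H)].
Qed.

(** e_i commutes with the tail of EE and with FF up to scalars, and ends up on
    the right. *)
Lemma e_tail_ideal i m l : i != ord0 -> (m + l = n.*2)%N -> L (e i * (W m l * F)).
Proof.
move=> i0 hm; have [c] := f_asc n_gt0 qh_neq0 q_generic H' i0 hm.
have -> : e' i = e i by rewrite /negate0 (negPf i0).
move=> hW.
rewrite mulrA hW -scalerAl -mulrA (e_desc n_gt0 qh_neq0 q_generic H) // mulrA.
by apply/idealZ/L_mul/L_e.
Qed.

Lemma f_even_ideal i : i != ord0 -> L (f i * (W 0 n.*2 * F)).
Proof.
move=> i0; rewrite mulrA (e_asc n_gt0 qh_neq0 q_generic H') // -mulrA.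
have [c ->] := f_desc n_gt0 qh_neq0 q_generic H i0.
by rewrite -scalerAr mulrA; apply/idealZ/L_mul/L_f.
Qed.

Definition anticomm p := f ord0 * psi p + psi p * f ord0.

(** {f_0, psi_1} is a combination of k_0^2 and k_0^-2, hence acts on weight
    vectors by scalars; as f_0 commutes with e_i, the next anticommutators are
    q-commutators with e_i, and all terms of these have e_i acting on an
    element of the ideal or on a tail. *)
Lemma anticomm_tail p m l : (p < n.*2)%N -> (m + l = n.*2)%N ->
  exists2 c, (0 < p)%N -> c = 0 & L (anticomm p * (W m l * F) - c *: (W m l * F)).
Proof.
elim: p => [|p IH] hp hm.
  have [h hh] := wt_tail ord0 hm; set X := W m l * F in hh *.
  have := wt_K hh; have := wt_K' qh_neq0 H hh; move: (_ ^ _) (_ ^ _) => a b Ka Kb.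
  have -> : anticomm 0 = - ((t ord0 - (t ord0)^-1)^-1 *: (k ord0 ^+ 2 - k' ord0 ^+ 2)).
    rewrite /anticomm odd_root_0 /negate0 eqxx mulrN mulNr -opprD addrC.
    by have := rel_ef H ord0 ord0; rewrite eqxx expr1 scaleN1r opprK => ->.
  set c := (_ - _)^-1; exists (- c * (a - b)) => //.
  rewrite (_ : _ - _ = (- c * a) *: (X * k ord0 ^+ 2 - X)
                     + (c * b) *: (X * k' ord0 ^+ 2 - X)); last first.
    rewrite mulNr -scalerAl mulrBl Ka Kb.
    by move: (k ord0 ^+ 2) (k' ord0 ^+ 2) => x y; nc K; ring.
  by apply: L_lin; [exact: ideal_K | exact/idealZ/ideal_K'].
have [c _ hc] := IH (ltnW hp) hm; exists 0 => //; rewrite scale0r subr0.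
have j0 : node n p != ord0 by apply: node_neq0; lia.
set j := node n p in j0 *; set X := W m l * F in hc *.
have eX : L (e j * X) by exact: e_tail_ideal.
have fe : f ord0 * e j = e j * f ord0 by rewrite (ef_comm H).
rewrite (_ : anticomm p.+1 = e j * anticomm p - t j *: (anticomm p * e j)); last first.
  rewrite /anticomm odd_root_rec_step -/j (_ : e' j = e j); last by rewrite /negate0 (negPf j0).
  transitivity (e j * (f ord0 * psi p + psi p * f ord0)
     - t j *: ((f ord0 * psi p + psi p * f ord0) * e j)
     + (f ord0 * e j - e j * f ord0) * psi p - t j *: (psi p * (e j * f ord0 - f ord0 * e j))).
    by nc K; ring.
  by rewrite fe !subrr mul0r mulr0 scaler0 addr0 subr0.
rewrite (_ : _ * X = e j * (anticomm p * X - c *: X) + (c *: (e j * X) - t j *: (anticomm p * (e j * X)))).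
  by apply: idealD; [exact: L_mul | apply: idealB; apply: idealZ => //; exact: L_mul].
by nc K; ring.
Qed.

Lemma f0_tail m l : (0 < m)%N -> (m + l = n.*2)%N -> L (f ord0 * (W m l * F)).
Proof.
elim: l m => [|l IH] m m0 hm.
  by rewrite mul1r (f0_desc n_gt0 qh_neq0 q_generic H); exact: ideal0.
rewrite (_ : _ * _ = anticomm m * (W m.+1 l * F) - psi m * (f ord0 * (W m.+1 l * F))).
  apply: idealB; last by apply/L_mul/IH => //; lia.
  have [|| c c0] := @anticomm_tail m m.+1 l; try lia.
  by rewrite c0 // scale0r subr0.
by rewrite /= /anticomm; nc K; ring.
Qed.

Lemma wt_EF i : has_weight qh k i 0 (W 0 n.*2 * F).
Proof.
have := wt_k' qh_neq0 H' (wt_asc qh_neq0 H' i 0 n.*2) => hW.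
by rewrite -(addNr (\sum_(p < n.*2) full_wt i p)); apply: (wtM qh_neq0) => //;
  exact: (wt_desc qh_neq0 H).
Qed.

Lemma asc_first : W 0 n.*2 = psi 0 * W 1 n.*2.-1.
Proof. by have -> : n.*2 = n.*2.-1.+1 by lia. Qed.

Lemma full_wt00 : full_wt (ord0 : 'I_n.+1) 0 = 0.
Proof. by rewrite /full_wt big_ord0 cartanE // eqxx. Qed.

Lemma wt_tail1 : has_weight qh k ord0 0 (W 1 n.*2.-1 * F).
Proof.
have := wt_k' qh_neq0 H' (wt_asc qh_neq0 H' ord0 1 n.*2.-1) => hW.
have hF := wt_desc qh_neq0 H ord0 n.*2.
have <- : - (\sum_(p < n.*2.-1) full_wt (ord0 : 'I_n.+1) (1 + p))
          + \sum_(p < n.*2) full_wt (ord0 : 'I_n.+1) p = 0.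
  have sumS N : \sum_(p < N.+1) full_wt (ord0 : 'I_n.+1) p
      = \sum_(p < N) full_wt (ord0 : 'I_n.+1) (1 + p).
    by rewrite big_ord_recl full_wt00 add0r.
  by have := sumS n.*2.-1; rewrite prednK ?double_gt0 // => ->; rewrite addNr.
exact: (wtM qh_neq0).
Qed.

(** For the first factor the scalar of [anticomm_tail] vanishes: the tail has
    weight zero for k_0, because alpha_0 is isotropic. *)
Lemma f0_ideal : L (f ord0 * (W 0 n.*2 * F)).
Proof.
rewrite asc_first -(mulrA (psi 0)).
set X := W 1 _ * F.
rewrite (_ : _ * _ = anticomm 0 * X - psi 0 * (f ord0 * X)); last first.
  by rewrite /anticomm; nc K; ring.
apply: idealB; last by apply/L_mul/f0_tail => //; lia.
have := wt_K wt_tail1; have := wt_K' qh_neq0 H wt_tail1.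
rewrite -/X oppr0 !expr0z !scale1r => Kb Ka.
have -> : anticomm 0 = - ((t ord0 - (t ord0)^-1)^-1 *: (k ord0 ^+ 2 - k' ord0 ^+ 2)).
  rewrite /anticomm odd_root_0 /negate0 eqxx mulrN mulNr -opprD addrC.
  by have := rel_ef H ord0 ord0; rewrite eqxx expr1 scaleN1r opprK => ->.
rewrite mulNr -scalerAl mulrBl Ka Kb -scaleNr; apply: idealZ.
rewrite (_ : _ - _ = (X * k ord0 ^+ 2 - X) - (X * k' ord0 ^+ 2 - X)).
  by apply: idealB; [exact: ideal_K | exact: ideal_K'].
by rewrite opprB addrA addrNK.
Qed.

Lemma e0_ideal : L (e ord0 * (W 0 n.*2 * F)).
Proof.
rewrite asc_first odd_root_0 /negate0 eqxx !mulrA mulrN -expr2 (rel_e0 H) oppr0 !mul0r.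
exact: ideal0.
Qed.

Lemma k_ideal i : L (k i * (W 0 n.*2 * F) - W 0 n.*2 * F).
Proof.
rewrite (wt_EF i) expr0z scale1r.
by rewrite -{2}[W 0 _ * F]mulr1 -mulrBr; exact: L_mul.
Qed.

Lemma k'_ideal i : L (k' i * (W 0 n.*2 * F) - W 0 n.*2 * F).
Proof.
rewrite (wt_k' qh_neq0 H (wt_EF i)) oppr0 expr0z scale1r.
by rewrite -{2}[W 0 _ * F]mulr1 -mulrBr; exact: L_mul.
Qed.

Lemma e_ideal i : L (e i * (W 0 n.*2 * F)).
Proof. by case: (eqVneq i ord0) => [->|i0]; [exact: e0_ideal | apply: e_tail_ideal]. Qed.

Lemma f_ideal i : L (f i * (W 0 n.*2 * F)).
Proof. by case: (eqVneq i ord0) => [->|i0]; [exact: f0_ideal | exact: f_even_ideal]. Qed.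

End Invariance.

(** * The coproduct respects the relations *)

Section UniversalModel.
Variables (K : fieldType) (n : nat) (qh : K).
Local Notation U := (Uq n qh).

Section Lift.
Variables (B : superAlgType K) (x : gen n -> B) (hx : model qh x).
Lemma Ulift_add (u v : U) : Ulift x (u + v) = Ulift x u + Ulift x v.
Proof. exact: UliftD. Qed.
Lemma Ulift_mul (u v : U) : Ulift x (u * v) = Ulift x u * Ulift x v.
Proof. exact: UliftM. Qed.
Lemma Ulift_scale c (u : U) : Ulift x (c *: u) = c *: Ulift x u.
Proof. exact: UliftZ. Qed.
Lemma Ulift_zero : Ulift x (0 : U) = 0.
Proof. exact: Ulift0. Qed.
Lemma Ulift_one : Ulift x (1 : U) = 1.
Proof. exact: Ulift1. Qed.
Lemma Ulift_opp (u : U) : Ulift x (- u) = - Ulift x u.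
Proof. exact: UliftN. Qed.
Lemma Ulift_exp (u : U) m : Ulift x (u ^+ m) = Ulift x u ^+ m.
Proof. by elim: m => [|m IH]; rewrite ?expr0 ?Ulift_one // !exprS Ulift_mul IH. Qed.
Lemma Ulift_sum I (r : seq I) (F : I -> U) :
  Ulift x (\sum_(i <- r) F i) = \sum_(i <- r) Ulift x (F i).
Proof.
elim: r => [|i r IH]; first by rewrite !big_nil Ulift_zero.
by rewrite !big_cons Ulift_add IH.
Qed.
Lemma Ulift_gen g : Ulift x (ugen qh g) = x g.
Proof. exact: Ulift_pi. Qed.
Lemma Ulift_hpart p (u : U) : Ulift x (hpart p u) = hpart p (Ulift x u).
Proof. exact: Ulift_part. Qed.
Lemma Ulift_serre (y : 'I_n.+1 -> U) i j :
  Ulift x (serre qh y i j) = serre qh (Ulift x \o y) i j.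
Proof.
rewrite /serre Ulift_sum; apply: eq_bigr => mu _.
by rewrite Ulift_scale !Ulift_mul !Ulift_exp.
Qed.
Definition Ulift_morph := (Ulift_add, Ulift_mul, Ulift_scale, Ulift_zero, Ulift_one,
  Ulift_opp, Ulift_exp, Ulift_gen, Ulift_hpart, Ulift_serre).
End Lift.

Lemma model_ugen : model qh (@ugen K n qh).
Proof.
split=> [g|].
  by apply: UqP => B x hx; rewrite !(Ulift_morph hx) (proj1 hx).
split=> [i j|i|i|i j|i j|i j|||i j i0 ij|i j i0 ij] /=; apply: UqP => B x hx;
  rewrite ?(fun_if (Ulift x)) !(Ulift_morph hx); have [_ R] := hx.
- exact: (rel_kk R).
- exact: (rel_kk' R).
- exact: (rel_k'k R).
- exact: (rel_ke R).
- exact: (rel_kf R).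
- by rewrite !scaleN1r -!expr2; exact: (rel_ef R).
- exact: (rel_e0 R).
- exact: (rel_f0 R).
- rewrite -(rel_se R i0 ij); rewrite /serre; apply: eq_bigr => mu _ /=.
  by rewrite !(Ulift_gen hx).
- rewrite -(rel_sf R i0 ij); rewrite /serre; apply: eq_bigr => mu _ /=.
  by rewrite !(Ulift_gen hx).
Qed.
End UniversalModel.

Section DeltaModel.
Variables (K : fieldType) (n : nat) (qh : K).
Hypothesis n_gt0 : (0 < n)%N.
Hypothesis qh_neq0 : qh != 0.
Hypothesis q_generic : forall m : nat, (0 < m)%N -> (qh ^+ 2) ^+ m != 1.
Local Notation U := (Uq n qh).
Local Notation UU := (tens U U).
Local Notation t := (@qi K n qh).

Lemma pureM_sign p r (a b a' b' : U) : hpart p b = b -> hpart r a' = a' ->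
  (pure a b : UU) * pure a' b' = (-1) ^+ (p && r) *: pure (a * a') (b * b').
Proof. exact: tmul_hom. Qed.

Lemma uk_even i : hpart false (uk qh i : U) = uk qh i.
Proof. exact: ((model_ugen n qh).1 (Gk i)). Qed.
Lemma uk'_even i : hpart false (uk' qh i : U) = uk' qh i.
Proof. exact: ((model_ugen n qh).1 (Gk' i)). Qed.
Lemma ue_hom i : hpart (i == ord0) (ue qh i : U) = ue qh i.
Proof. exact: ((model_ugen n qh).1 (Ge i)). Qed.
Lemma uf_hom i : hpart (i == ord0) (uf qh i : U) = uf qh i.
Proof. exact: ((model_ugen n qh).1 (Gf i)). Qed.

Lemma osp_rel_U : osp_rel qh (@uk K n qh) (@uk' K n qh) (@ue K n qh) (@uf K n qh).
Proof. exact: (model_ugen n qh).2. Qed.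

Lemma pureMl (a b a' b' : U) : hpart false b = b ->
  (pure a b : UU) * pure a' b' = pure (a * a') (b * b').
Proof.
move=> hb; rewrite [LHS]tmul_pureE /tmul_pure !big_bool /= !(hpart_hom _ hb) /=.
by rewrite !mul0r !pure0r !scaler0 !add0r !scale1r -pureDl -mulrDr addrC hpart_sum.
Qed.

Lemma pureMr (a b a' b' : U) : hpart false a' = a' ->
  (pure a b : UU) * pure a' b' = pure (a * a') (b * b').
Proof.
move=> ha; rewrite [LHS]tmul_pureE /tmul_pure !big_bool /= !(hpart_hom _ ha) /=.
by rewrite !mulr0 !pure0l !scaler0 !add0r !scale1r -pureDr -mulrDl addrC hpart_sum.
Qed.

(** The families e and f are treated together: they have weights a_ij and
    -a_ij, which is the role of the sign [sg]. *)
Section PrimitiveLike.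
Variables (sg : int) (y : 'I_n.+1 -> U).
Local Notation k := (@uk K n qh).
Local Notation k' := (@uk' K n qh).
Hypothesis y_hom : forall i, hpart (i == ord0) (y i) = y i.
Hypothesis y_wt : forall i j, has_weight qh k i (sg * cartan i j) (y j).
Let H := osp_rel_U.

Definition skew_prim i : UU := pure (y i) (k i) + pure (k' i) (y i).

Lemma y_even i : i != ord0 -> hpart false (y i) = y i.
Proof. by move=> i0; have := y_hom i; rewrite (negPf i0). Qed.

Lemma yk i j : y j * k i = qhi qh i ^ (- (sg * cartan i j)) *: (k i * y j).
Proof.
by rewrite y_wt scalerA -expfzDr ?qhi_neq0 // addNr expr0z scale1r.
Qed.

Lemma yk' i j : y j * k' i = qhi qh i ^ (sg * cartan i j) *: (k' i * y j).
Proof.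
by rewrite (wt_k' qh_neq0 H (y_wt i j)) scalerA -expfzDr ?qhi_neq0 // subrr expr0z scale1r.
Qed.

Lemma qhi_cartan_sg (i j : 'I_n.+1) :
  qhi qh j ^ (sg * cartan j i) = qhi qh i ^ (sg * cartan i j).
Proof. by rewrite ![sg * _]mulrC -!exprz_exp qhi_cartanC. Qed.

Lemma kC i j : k i * k j = k j * k i. Proof. exact: (rel_kk H). Qed.

Lemma skew_prim_conj i j :
  pure (k i) (k i) * skew_prim j * pure (k' i) (k' i) = qhi qh i ^ (sg * cartan i j) *: skew_prim j.
Proof.
have kyk : k i * y j * k' i = qhi qh i ^ (sg * cartan i j) *: y j.
  by rewrite y_wt -scalerAl -mulrA (rel_kk' H) mulr1.
have kkk : k i * k j * k' i = k j by rewrite kC -mulrA (rel_kk' H) mulr1.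
have kk'k : k i * k' j * k' i = k' j.
  by have := wt_k'0 qh_neq0 H i j; rewrite /has_weight expr0z scale1r => ->;
     rewrite -mulrA (rel_kk' H) mulr1.
rewrite /skew_prim mulrDr !pureMl ?uk_even // mulrDl !pureMr ?uk'_even //.
by rewrite kyk kkk kk'k pureZl pureZr scalerDr.
Qed.

Lemma skew_prim_hom i : hpart (i == ord0) (skew_prim i) = skew_prim i.
Proof.
rewrite /skew_prim linearD /=; congr (_ + _).
  by rewrite -[i == ord0]addbF; apply: tpart_hom; rewrite ?y_hom ?uk_even.
by rewrite -[i == ord0]addFb; apply: tpart_hom; rewrite ?y_hom ?uk'_even.
Qed.

Lemma skew_prim_sqr : y ord0 ^+ 2 = 0 -> skew_prim ord0 ^+ 2 = 0.
Proof.
move=> y0; rewrite expr2 /skew_prim mulrDl !mulrDr.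
have yo := y_hom ord0; rewrite eqxx in yo.
rewrite pureMl ?uk_even // pureMl ?uk_even // (pureM_sign _ _ yo yo) expr1 scaleN1r.
rewrite pureMr ?uk'_even // -!expr2 y0.
have c0 : cartan (ord0 : 'I_n.+1) ord0 = 0 by rewrite cartanE // eqxx.
have := yk ord0 ord0; have := yk' ord0 ord0; rewrite c0 mulr0 oppr0 !expr0z !scale1r => -> ->.
by rewrite pure0l pure0r add0r addr0 subrr.
Qed.

Lemma left_step i h v w : i != ord0 -> has_weight qh k i h v ->
  y i * w = qhi qh i ^ (- h) *: (w * y i) -> k i * w = w * k i ->
  hpart false w = w ->
  qcomm (t i ^ (- h)) (skew_prim i) (pure v w) = pure (qcomm (t i ^ (- h)) (y i) v) (k i * w).
Proof.
move=> i0 hv hw kw we; have yi := y_even i0.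
rewrite /qcomm {1 2}/skew_prim mulrDl mulrDr.
rewrite pureMl ?uk_even // pureMl // pureMl // pureMl // -kw.
rewrite (wt_k' qh_neq0 H hv) hw pureZl pureZr scalerA qhi_sqr scalerDr.
by rewrite opprD addrACA subrr addr0 -pureZl -scaleN1r -pureZl -pureDl scaleN1r.
Qed.

Lemma right_step i h v w : i != ord0 -> has_weight qh k i h v ->
  y i * w = qhi qh i ^ h *: (w * y i) -> k' i * w = w * k' i ->
  qcomm (t i ^ h) (skew_prim i) (pure w v) = pure (k' i * w) (qcomm (t i ^ h) (y i) v).
Proof.
move=> i0 hv hw kw; have yi := y_even i0.
rewrite /qcomm {1 2}/skew_prim mulrDl mulrDr.
rewrite pureMl ?uk_even // pureMl // pureMr // pureMr ?uk'_even // -kw.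
rewrite hv hw pureZl pureZr scalerA qhi_sqr scalerDr.
by rewrite opprD addrACA subrr add0r -pureZr -scaleN1r -pureZr -pureDr scaleN1r.
Qed.

(** Write the coproduct of y_i as P + Q with P = y_i (x) k_i and
    Q = k_i^-1 (x) y_i. On an element v (x) w with v of weight h, the
    q-commutator with parameter q_i^-h annihilates the contribution of Q, so
    when the factors of the Serre polynomial are applied in this order only P
    contributes. *)
Lemma left_iter i j m : i != ord0 ->
  let c r := t i ^ (- (sg * (cartan i j + 2 * r%:Z))) in
  qad c (skew_prim i) m (pure (y j) (k j)) = pure (qad c (y i) m (y j)) (k i ^+ m * k j).
Proof.
move=> i0 c.
suff [] : [/\ qad c (skew_prim i) m (pure (y j) (k j)) = pure (qad c (y i) m (y j)) (k i ^+ m * k j),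
    has_weight qh k i (sg * (cartan i j + 2 * m%:Z)) (qad c (y i) m (y j)),
    y i * (k i ^+ m * k j) = qhi qh i ^ (- (sg * (cartan i j + 2 * m%:Z))) *: (k i ^+ m * k j * y i)
    & hpart false (k i ^+ m * k j) = k i ^+ m * k j] by [].
elim: m => [|m [E V W P]].
  rewrite (_ : sg * _ = sg * cartan i j); last by rewrite mulr0 addr0.
  rewrite !expr0 !mul1r; split; rewrite ?uk_even //.
  by rewrite yk -!invr_expz qhi_cartan_sg.
have kC' : k i * (k i ^+ m * k j) = k i ^+ m * k j * k i.
  by rewrite -mulrA kC !mulrA -exprS exprSr.
have hS : sg * (cartan i j + 2 * m.+1%:Z) = sg * (cartan i j + 2 * m%:Z) + sg * 2.
  by rewrite -mulrDr; congr (sg * _); lia.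
split.
- rewrite [LHS]/= E (left_step i0 V W kC' P) exprS -mulrA.
  by [].
- rewrite hS [qad _ _ _ _]/= /qcomm; apply: wtB.
    by rewrite addrC; apply: (wtM qh_neq0) => //; rewrite -(cartan_diag n_gt0 i0); exact: y_wt.
  by apply: (wtM qh_neq0) => //; rewrite -(cartan_diag n_gt0 i0); exact: y_wt.
- rewrite exprS -(mulrA (k i)) (mulrA (y i)) yk cartan_diag // -scalerAl -(mulrA (k i) (y i)) W.
  rewrite -scalerAr scalerA -expfzDr ?qhi_neq0 // -opprD addrC -hS -mulrA.
  by rewrite !mulrA.
- by rewrite exprS -mulrA -[false]/(false (+) false) hpartM_hom ?uk_even.
Qed.

(** The same with the roles of P and Q exchanged, which requires the opposite
    order of the factors. *)
Lemma right_iter i j m : i != ord0 ->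
  let c r := t i ^ (sg * (cartan i j + 2 * r%:Z)) in
  qad c (skew_prim i) m (pure (k' j) (y j)) = pure (k' i ^+ m * k' j) (qad c (y i) m (y j)).
Proof.
move=> i0 c.
suff [] : [/\ qad c (skew_prim i) m (pure (k' j) (y j)) = pure (k' i ^+ m * k' j) (qad c (y i) m (y j)),
    has_weight qh k i (sg * (cartan i j + 2 * m%:Z)) (qad c (y i) m (y j))
    & y i * (k' i ^+ m * k' j) = qhi qh i ^ (sg * (cartan i j + 2 * m%:Z)) *: (k' i ^+ m * k' j * y i)] by [].
have k'C a b : k' a * k' b = k' b * k' a.
  by have := wt_k' qh_neq0 H (wt_k'0 qh_neq0 H a b); rewrite oppr0 expr0z scale1r.
elim: m => [|m [E V W]].
  rewrite (_ : sg * _ = sg * cartan i j); last by rewrite mulr0 addr0.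
  rewrite !expr0 !mul1r; split; rewrite ?uk_even //.
  by rewrite yk' qhi_cartan_sg.
have kC' : k' i * (k' i ^+ m * k' j) = k' i ^+ m * k' j * k' i.
  by rewrite -mulrA k'C !mulrA -exprS exprSr.
have hS : sg * (cartan i j + 2 * m.+1%:Z) = sg * (cartan i j + 2 * m%:Z) + sg * 2.
  by rewrite -mulrDr; congr (sg * _); lia.
split.
- by rewrite [LHS]/= E (right_step i0 V W kC') exprS -mulrA.
- rewrite hS [qad _ _ _ _]/= /qcomm; apply: wtB.
    by rewrite addrC; apply: (wtM qh_neq0) => //; rewrite -(cartan_diag n_gt0 i0); exact: y_wt.
  by apply: (wtM qh_neq0) => //; rewrite -(cartan_diag n_gt0 i0); exact: y_wt.
- rewrite exprS -(mulrA (k' i)) (mulrA (y i)) yk' cartan_diag // -scalerAl -(mulrA (k' i) (y i)) W.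
  rewrite -scalerAr scalerA -expfzDr ?qhi_neq0 // addrC -hS -mulrA.
  by rewrite !mulrA.
Qed.

Lemma eq_qad (A : algType K) c c' (x z : A) N : c =1 c' -> qad c x N z = qad c' x N z.
Proof. by move=> ec; elim: N => //= N ->; rewrite ec. Qed.

(** The Serre polynomial is evaluated on each of the two terms of the coproduct
    of y_j with its factors in the order suited to that term. *)
Lemma skew_prim_serre i j : sg = 1 \/ sg = -1 -> i != ord0 -> j != i -> serre qh y i j = 0 ->
  serre qh skew_prim i j = 0.
Proof.
move=> hsg i0 ij; rewrite !serre_qad // {2}/skew_prim qadD.
set m := absz _; set c1 := (fun r : nat => _) => h1.
set c2 := fun r : nat => t i ^ (cartan i j + 2 * r%:Z).
have h2 : qad c2 (y i) m (y j) = 0 by rewrite -h1 /c1 qad_rev.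
have rev z : qad c1 (skew_prim i) m z = qad c2 (skew_prim i) m z by exact: qad_rev.
have left0 c : c =1 (fun r => t i ^ (- (sg * (cartan i j + 2 * r%:Z)))) ->
    qad c (y i) m (y j) = 0 -> qad c (skew_prim i) m (pure (y j) (k j)) = 0.
  by move=> ec; rewrite !(eq_qad _ _ _ ec) left_iter // => ->; rewrite pure0l.
have right0 c : c =1 (fun r => t i ^ (sg * (cartan i j + 2 * r%:Z))) ->
    qad c (y i) m (y j) = 0 -> qad c (skew_prim i) m (pure (k' j) (y j)) = 0.
  by move=> ec; rewrite !(eq_qad _ _ _ ec) right_iter // => ->; rewrite pure0r.
case: hsg => hs.
  rewrite left0 // => [|r]; last by rewrite /c1 hs mul1r opprD.
  by rewrite add0r rev right0 // => r; rewrite hs mul1r.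
rewrite rev left0 // => [|r]; last by rewrite hs mulN1r opprK.
by rewrite add0r right0 // => r; rewrite hs mulN1r opprD.
Qed.
End PrimitiveLike.

Let H := osp_rel_U.
Local Notation k := (@uk K n qh).
Local Notation k' := (@uk' K n qh).
Local Notation e := (@ue K n qh).
Local Notation f := (@uf K n qh).

Lemma e_wt i j : has_weight qh k i (1 * cartan i j) (e j).
Proof. by rewrite mul1r; exact: wt_e H i j. Qed.
Lemma f_wt i j : has_weight qh k i (-1 * cartan i j) (f j).
Proof. by rewrite mulN1r; exact: wt_f H i j. Qed.

Lemma skew_primM (y z : 'I_n.+1 -> U) i j : hpart (i == ord0) (y i) = y i ->
  hpart (j == ord0) (z j) = z j -> skew_prim y i * skew_prim z j =
  pure (y i * z j) (k i * k j) + pure (k' i * k' j) (y i * z j)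
  + (pure (y i * k' j) (k i * z j)
     + (-1) ^+ ((i == ord0) && (j == ord0)) *: pure (k' i * z j) (y i * k j)).
Proof.
move=> hy hz; rewrite /skew_prim mulrDl !mulrDr (pureM_sign _ _ hy hz).
rewrite pureMl ?uk_even // pureMl ?uk_even // pureMr ?uk'_even //.
by rewrite [X in _ + X = _]addrC addrACA.
Qed.

Lemma skew_prim_bracket i j : skew_prim e i * skew_prim f j
    - (-1) ^+ ((i == ord0) && (j == ord0)) *: (skew_prim f j * skew_prim e i)
  = if i == j then (t i - (t i)^-1)^-1 *:
      ((pure (k i) (k i) : UU) ^+ 2 - (pure (k' i) (k' i) : UU) ^+ 2) else 0.
Proof.
rewrite !skew_primM ?ue_hom ?uf_hom // [(j == _) && _]andbC.
set s := (-1) ^+ _.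
have k'C : k' j * k' i = k' i * k' j.
  by have := wt_k' qh_neq0 H (wt_k'0 qh_neq0 H j i); rewrite oppr0 expr0z scale1r.
rewrite k'C [k j * k i](rel_kk H) scalerDr opprD addrACA.
have ss : s * s = 1 by rewrite /s -expr2 sqrr_sign.
have qq : qhi qh j ^ cartan j i * qhi qh i ^ (- cartan i j) = 1.
  by rewrite qhi_cartanC // -expfzDr ?qhi_neq0 // subrr expr0z.
have qq' : qhi qh i ^ cartan i j * qhi qh j ^ (- cartan j i) = 1.
  by rewrite qhi_cartanC // -expfzDr ?qhi_neq0 // subrr expr0z.
have cross1 : pure (e i * k' j) (k i * f j) = pure (k' j * e i) (f j * k i) :> UU.
  rewrite (yk' e_wt) (f_wt i j) mul1r mulN1r pureZl pureZr scalerA qq.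
  by rewrite scale1r.
have cross2 : pure (k' i * f j) (e i * k j) = pure (f j * k' i) (k j * e i) :> UU.
  rewrite (yk e_wt) (wt_k' qh_neq0 H (f_wt i j)) mul1r mulN1r opprK pureZl pureZr scalerA qq'.
  by rewrite scale1r.
rewrite cross1 cross2 [X in _ + (_ - X)]scalerDr scalerA ss scale1r.
rewrite [X in _ + (_ - X)]addrC subrr addr0.
rewrite scalerDr opprD addrACA -[s *: pure (f j * e i) _]pureZl -[s *: pure _ (f j * e i)]pureZr.
rewrite -![- pure _ _]scaleN1r -[-1 *: pure (s *: _) _]pureZl -[-1 *: pure _ (s *: _)]pureZr.
rewrite -pureDl -pureDr !scaleN1r (rel_ef H).
case: eqP => [<-|_]; last by rewrite pure0l pure0r addr0.
rewrite !expr2 !pureMl ?uk_even ?uk'_even // pureZl pureZr -scalerDr; congr (_ *: _).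
rewrite -!scaleN1r pureDl pureDr pureZl pureZr !scaleN1r.
by rewrite addrA subrK.
Qed.

Lemma model_Delta : model qh (@Delta_gen K n qh).
Proof.
have kk0 i j : k' i * k' j = k' j * k' i.
  by have := wt_k' qh_neq0 H (wt_k'0 qh_neq0 H i j); rewrite oppr0 expr0z scale1r.
split=> [[i|i|i|i]|].
- by apply: (tpart_hom (p := false) (r := false)); exact: uk_even.
- by apply: (tpart_hom (p := false) (r := false)); exact: uk'_even.
- exact: (skew_prim_hom (@ue_hom) i).
- exact: (skew_prim_hom (@uf_hom) i).
split=> [i j|i|i|i j|i j|i j|||i j i0 ij|i j i0 ij] /=.
- by rewrite !pureMl ?uk_even // (rel_kk H).
- by rewrite pureMl ?uk_even // (rel_kk' H).
- by rewrite pureMl ?uk'_even // (rel_k'k H).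
- by rewrite (skew_prim_conj e_wt) mul1r.
- by rewrite (skew_prim_conj f_wt) mulN1r.
- exact: skew_prim_bracket.
- by apply: (skew_prim_sqr (@ue_hom) e_wt); exact: (rel_e0 H).
- by apply: (skew_prim_sqr (@uf_hom) f_wt); exact: (rel_f0 H).
- by apply: (skew_prim_serre (@ue_hom) e_wt (or_introl erefl)) => //; exact: (rel_se H).
- by apply: (skew_prim_serre (@uf_hom) f_wt (or_intror erefl)) => //; exact: (rel_sf H).
Qed.
End DeltaModel.

(** * The vector representation respects the relations *)

Section VectorModel.
Variables (K : fieldType) (n : nat) (qh : K).
Hypothesis n_gt0 : (0 < n)%N.
Hypothesis qh_neq0 : qh != 0.
Hypothesis q_generic : forall m : nat, (0 < m)%N -> (qh ^+ 2) ^+ m != 1.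
Local Notation M := (smatrix K (@vpar n)).
Local Notation P := (@vidx n).
Local Notation N := (@vbar n).
Local Notation D := (@unit_mx K n).

Lemma P_eq a b : (a <= n)%N -> (b <= n)%N -> (P a == P b) = (a == b).
Proof.
by move=> ha hb; rewrite -val_eqE /= !inordK.
Qed.
Lemma N_eq a b : (a <= n)%N -> (b <= n)%N -> (N a == N b) = (a == b).
Proof.
by move=> ha hb; rewrite -val_eqE /= !inordK // eqn_add2l.
Qed.
Lemma PN_eq a b : (P a == N b) = false.
Proof. exact: eq_lrshift. Qed.
Lemma NP_eq a b : (N a == P b) = false.
Proof. by rewrite eq_sym PN_eq. Qed.

Lemma DM a b c d : D a b * D c d = if b == c then D a d else 0.
Proof.
rewrite -[LHS]/(delta_mx a b *m delta_mx c d) mul_delta_mx_cond.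
by case: eqP => _; rewrite ?mulr1n ?mulr0n.
Qed.

Lemma vindex_ind (Q : 'I_(nn n).+1 -> Prop) :
  (forall a, (a <= n)%N -> Q (P a)) -> (forall a, (a <= n)%N -> Q (N a)) -> forall c, Q c.
Proof.
move=> hP hN c; case: (split_ordP (c : 'I_(n.+1 + n.+1))) => a ->.
  by have := hP a; rewrite /vidx inord_val; apply; rewrite -ltnS.
by have := hN a; rewrite /vbar inord_val; apply; rewrite -ltnS.
Qed.

Definition vwt (i : nat) (c : 'I_(nn n).+1) : int :=
  match fintype.split (c : 'I_(n.+1 + n.+1)) with
  | inl a => Hval n i a | inr a => - Hval n i a end.

Lemma vwtP i a : (a <= n)%N -> vwt i (P a) = Hval n i a.
Proof.
by move=> ha; rewrite /vwt /vidx (unsplitK (inl _)) inordK.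
Qed.
Lemma vwtN i a : (a <= n)%N -> vwt i (N a) = - Hval n i a.
Proof.
by move=> ha; rewrite /vwt /vbar (unsplitK (inr _)) inordK.
Qed.
Lemma vparP a : (a <= n)%N -> vpar (P a) = (a != 0%N).
Proof.
by move=> ha; rewrite /vpar /vidx (unsplitK (inl _)) -val_eqE /= inordK.
Qed.
Lemma vparN a : (a <= n)%N -> vpar (N a) = (a != 0%N).
Proof.
by move=> ha; rewrite /vpar /vbar (unsplitK (inr _)) -val_eqE /= inordK.
Qed.

Lemma vec_kE (sg : int) (i : 'I_n.+1) :
  vec_k qh sg i = diag_mx (\row_c qhi qh i ^ (sg * vwt i c)) :> 'M[K]_((nn n).+1).
Proof.
rewrite diag_mx_sum_delta /vec_k.
rewrite [RHS](@big_split_ord _ _ _ n.+1 n.+1 xpredT) /= -big_split.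
apply: eq_bigr => a _ /=; rewrite !mxE.
have ha : (a <= n)%N by rewrite -ltnS.
have -> : lshift n.+1 a = P a by rewrite /vidx inord_val.
have -> : rshift n.+1 a = N a by rewrite /vbar inord_val.
by rewrite vwtP // vwtN // mulrN mulNr.
Qed.

(** The coefficient s is 1 for e_0 and -1 for the even e_j; with s = -1 the
    transpose is the matrix of f_j. *)
Definition raise_mx (s : K) (j : nat) : M :=
  if (j < n)%N then D (P j) (P j.+1) + s *: D (N j.+1) (N j) else D (P n) (N n).
Definition lower_mx (j : nat) : M :=
  if (j < n)%N then D (P j.+1) (P j) - D (N j) (N j.+1) else D (N n) (P n).

Lemma raiseE (i : 'I_n.+1) :
  vec_gen qh (Ge i) = raise_mx (if i == ord0 then 1 else -1) i.
Proof.
rewrite /= /raise_mx; case: eqP => [->|_] /=; first by rewrite n_gt0 scale1r.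
by rewrite scaleN1r.
Qed.

Lemma lowerE (i : 'I_n.+1) : vec_gen qh (Gf i) = lower_mx i.
Proof. by rewrite /= /lower_mx; case: eqP => [->|_] //=; rewrite n_gt0. Qed.

Ltac deqs := rewrite ?PN_eq ?NP_eq;
  repeat (rewrite P_eq; [|lia|lia]); repeat (rewrite N_eq; [|lia|lia]).
Ltac unit_products :=
  rewrite ?(mulrDl, mulrDr, mulNr, mulrN, mul0r, mulr0);
  rewrite -?scalerAl -?scalerAr ?DM ?PN_eq ?NP_eq;
  repeat (rewrite P_eq; [|lia|lia]); repeat (rewrite N_eq; [|lia|lia]).
Ltac unit_zero :=
  repeat (case: ifP => ?); rewrite ?(scaler0, addr0, add0r, oppr0, mul0r, mulr0) //; lia.

Lemma raise_sqr s i : (0 < i <= n)%N -> raise_mx s i * raise_mx s i = 0.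
Proof.
by move=> hi; rewrite /raise_mx; case: ifP => hin; unit_products; unit_zero.
Qed.

Lemma raise0_sqr s : raise_mx s 0 * raise_mx s 0 = 0.
Proof. by rewrite /raise_mx n_gt0; unit_products; unit_zero. Qed.

Lemma raise_orth s r i j : (i <= n)%N -> (j <= n)%N ->
  [&& i != j, i.+1 != j & j.+1 != i] -> raise_mx s i * raise_mx r j = 0.
Proof.
move=> hi hj hij; rewrite /raise_mx.
by case: ifP => hin; case: ifP => hjn; unit_products; unit_zero.
Qed.

(** The excluded pair is the one with a_ij = -2, where the product does not
    vanish but does not occur in the Serre relation without a square either. *)
Lemma raise_sandwich s r i j : (0 < i <= n)%N -> (j <= n)%N -> i != j ->
  ~~ ((i.+1 == n) && (j == n)) -> raise_mx s i * raise_mx r j * raise_mx s i = 0.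
Proof.
move=> hi hj hij hn; rewrite /raise_mx.
case: ifP => hin; case: ifP => hjn; unit_products;
 repeat (case: ifP => ?); rewrite ?(scaler0, addr0, add0r, oppr0, mul0r, mulr0) //; try lia;
 unit_products; unit_zero.
Qed.

Lemma trmx_raise j : (raise_mx (-1) j : 'M[K]_((nn n).+1))^T = lower_mx j.
Proof.
rewrite /raise_mx /lower_mx; case: ifP => _; last by rewrite trmx_delta.
by rewrite linearD linearZ /= !trmx_delta scaleN1r.
Qed.

Lemma lowerM i j : lower_mx i * lower_mx j =
  (raise_mx (-1) j * raise_mx (-1) i : 'M[K]_((nn n).+1))^T.
Proof. by rewrite trmx_mul !trmx_raise. Qed.

(** Once x_i^2 = 0, the Serre polynomial of degree 3 vanishes, and the one of
    degree 2 reduces to the word x_i x_j x_i. *)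
Lemma serre_nil (B : algType K) (x : 'I_n.+1 -> B) i j : i != ord0 -> j != i ->
  x i * x i = 0 -> (cartan i j = 0 -> x i * x j = 0 /\ x j * x i = 0) ->
  (cartan i j = -1 -> x i * x j * x i = 0) -> serre qh x i j = 0.
Proof.
move=> i0 ij sq0 c0 c1; rewrite serre_qad //.
have [c | c | c] := cartan_serre n_gt0 i0 ij; rewrite c;
  move: (fun r : nat => _) => d /=; rewrite /qcomm.
- by have [-> ->] := c0 c; rewrite scaler0 subrr.
- have h1 := c1 c; transitivity ((x i * x i) * x j - (d 0 + d 1) *: (x i * x j * x i)
     + (d 0 * d 1) *: (x j * (x i * x i))); first by nc K; ring.
  by rewrite sq0 h1 mul0r mulr0 !scaler0 subrr addr0.
- transitivity (x i * (x i * x i) * x j - (d 0 + d 1 + d 2) *: ((x i * x i) * x j * x i)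
     + (d 0 * d 1 + d 0 * d 2 + d 1 * d 2) *: (x i * x j * (x i * x i))
     - (d 0 * d 1 * d 2) *: (x j * (x i * x i) * x i)); first by nc K; ring.
  by rewrite sq0 !(mul0r, mulr0, scaler0, subr0, addr0).
Qed.

Lemma cartan0_far (i j : 'I_n.+1) : i != ord0 -> j != i -> cartan i j = 0 ->
  [&& (i != j :> nat), (i.+1 != j) & (j.+1 != i)]%N.
Proof.
move=> i0 ij; rewrite cartanE // (negPf i0) [i == j]eq_sym (negPf ij).
move: ij; rewrite -val_eqE /=; repeat (case: ifP => ?) => //; lia.
Qed.

Lemma cartanN1_mid (i j : 'I_n.+1) : i != ord0 -> j != i -> cartan i j = -1 ->
  ~~ ((i.+1 == n) && (j == n :> nat))%N.
Proof.
move=> i0 ij; rewrite cartanE // (negPf i0) [i == j]eq_sym (negPf ij).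
move: ij; rewrite -val_eqE /=; repeat (case: ifP => ?) => //; lia.
Qed.

Lemma raise_serre (s : 'I_n.+1 -> K) (i j : 'I_n.+1) : i != ord0 -> j != i ->
  serre qh (fun i => raise_mx (s i) i) i j = 0.
Proof.
move=> i0 ij; have hi : (0 < i <= n)%N by rewrite lt0n -ltnS ltn_ord andbT.
have hj : (j <= n)%N by rewrite -ltnS.
apply: serre_nil => //; first exact: raise_sqr.
  move=> c; have := cartan0_far i0 ij c => /and3P[h1 h2 h3].
  by split; apply: raise_orth; rewrite ?h1 ?h2 ?h3 // 1?eq_sym ?h1 //; case/andP: hi.
by move=> c; apply: raise_sandwich => //; [rewrite eq_sym | exact: cartanN1_mid].
Qed.

Lemma lower_serre (i j : 'I_n.+1) : i != ord0 -> j != i ->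
  serre qh (fun i => lower_mx i) i j = 0.
Proof.
move=> i0 ij; have hi : (0 < i <= n)%N by rewrite lt0n -ltnS ltn_ord andbT.
have hj : (j <= n)%N by rewrite -ltnS.
have tr0 : (0 : 'M[K]_((nn n).+1))^T = 0 by rewrite trmx0.
apply: serre_nil => //.
- by rewrite lowerM raise_sqr.
- move=> c; have := cartan0_far i0 ij c => /and3P[h1 h2 h3].
  by split; rewrite lowerM raise_orth // ?h1 ?h2 ?h3 // 1?eq_sym ?h1 //; case/andP: hi.
- move=> c; rewrite lowerM -trmx_raise -[_ * _]/(_ *m _) -trmx_mul.
  rewrite [X in X^T](_ : _ = raise_mx (-1) i * raise_mx (-1) j * raise_mx (-1) i); last by rewrite -mulrA.
  by rewrite raise_sandwich ?trmx0 //; [rewrite eq_sym | exact: cartanN1_mid].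
Qed.

Lemma Hval_step (i j : 'I_n.+1) : (j < n)%N ->
  Hval n i j - Hval n i j.+1 = cartan i j.
Proof.
move=> hj; rewrite cartanE // /Hval -!val_eqE /= !natz.
have := ltn_ord i; repeat (case: ifP => ?); lia.
Qed.

Lemma Hval_last (i j : 'I_n.+1) : (j < n)%N = false -> Hval n i n + Hval n i n = cartan i j.
Proof.
move=> hj; rewrite cartanE // /Hval -!val_eqE /= !natz.
have := ltn_ord i; have := ltn_ord j; repeat (case: ifP => ?); lia.
Qed.

Lemma Hval_bound (i : 'I_n.+1) a : [\/ Hval n i a = 0, Hval n i a = 1 | Hval n i a = -1].
Proof.
have : ((-1 <= Hval n i a) && (Hval n i a <= 1))%R.
  by rewrite /Hval !natz; repeat (case: ifP => ?); lia.
by case: (Hval n i a) => [[|[|m]]|[|m]] //= _; [constructor 1 | constructor 2 | constructor 3].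
Qed.

Lemma vec_conj i a b :
  vec_k qh 1 i * D a b * vec_k qh (-1) i = qhi qh i ^ (vwt i a - vwt i b) *: D a b.
Proof.
rewrite -[_ * _ * _]/(_ *m _ *m _) !vec_kE mul_diag_mx mul_mx_diag.
apply/matrixP => c d; rewrite !mxE; case: eqP => [->|_]; last by rewrite mulr0 mul0r mulr0.
case: eqP => [->|_]; last by rewrite mulr0 mul0r mulr0.
by rewrite mulr1 mulr1 mul1r mulN1r expfzDr ?qhi_neq0.
Qed.

Lemma vec_conj_raise s (i j : 'I_n.+1) :
  vec_k qh 1 i * raise_mx s j * vec_k qh (-1) i = qhi qh i ^ cartan i j *: raise_mx s j.
Proof.
have hj : (j <= n)%N by rewrite -ltnS.
rewrite /raise_mx; case: ifP => hjn.
  rewrite mulrDr mulrDl -scalerAr -scalerAl !vec_conj !vwtP // !vwtN //.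
  by rewrite opprK [- _ + _]addrC Hval_step // scalerDr !scalerA mulrC.
by rewrite vec_conj vwtP // vwtN // opprK (Hval_last i hjn).
Qed.

Lemma vec_conj_lower (i j : 'I_n.+1) :
  vec_k qh 1 i * lower_mx j * vec_k qh (-1) i = qhi qh i ^ (- cartan i j) *: lower_mx j.
Proof.
have hj : (j <= n)%N by rewrite -ltnS.
rewrite /lower_mx; case: ifP => hjn.
  rewrite mulrBr mulrBl !vec_conj !vwtP // !vwtN // opprK [- _ + _]addrC.
  by rewrite -(Hval_step i hjn) opprB scalerBr.
by rewrite vec_conj vwtP // vwtN // -(Hval_last i hjn) opprD.
Qed.

Lemma vec_kk (i j : 'I_n.+1) : vec_k qh 1 i * vec_k qh 1 j = vec_k qh 1 j * vec_k qh 1 i.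
Proof. by rewrite -[_ * _]/(_ *m _) !vec_kE diag_mxC. Qed.

Lemma vec_kk' (sg : int) (i : 'I_n.+1) : vec_k qh sg i * vec_k qh (- sg) i = 1.
Proof.
rewrite -[_ * _]/(_ *m _) !vec_kE mulmx_diag -[1]/(1%:M) -diag_const_mx.
congr diag_mx; apply/rowP => c; rewrite !mxE -expfzDr ?qhi_neq0 //.
by rewrite mulNr subrr expr0z.
Qed.

Lemma hpart_unit p a b : hpart p (D a b) = if vpar a (+) vpar b == p then D a b else 0.
Proof.
apply/matrixP => c d; rewrite mxE [in RHS](fun_if (fun A : 'M_((nn n).+1) => A c d)) !mxE.
by case: (eqVneq c a) => [->|_]; case: (eqVneq d b) => [->|_]; rewrite ?if_same.
Qed.

Lemma hpart_raise s (j : 'I_n.+1) : hpart (j == ord0) (raise_mx s j) = raise_mx s j.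
Proof.
have hj : (j <= n)%N by rewrite -ltnS.
rewrite /raise_mx; case: ifP => hjn.
  rewrite linearD linearZ /= !hpart_unit !vparP // !vparN // -val_eqE /=.
  by case: (nat_of_ord j) => [|m].
by rewrite hpart_unit vparP // vparN // addbb -val_eqE /=; case: ifP => //; lia.
Qed.

Lemma hpart_lower (j : 'I_n.+1) : hpart (j == ord0) (lower_mx j) = lower_mx j.
Proof.
have hj : (j <= n)%N by rewrite -ltnS.
rewrite /lower_mx; case: ifP => hjn.
  rewrite linearB /= !hpart_unit !vparP // !vparN // -val_eqE /=.
  by case: (nat_of_ord j) => [|m].
by rewrite hpart_unit vparP // vparN // addbb -val_eqE /=; case: ifP => //; lia.
Qed.

Lemma hpart_vec_k sg (i : 'I_n.+1) : hpart false (vec_k qh sg i) = vec_k qh sg i.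
Proof.
rewrite /vec_k linear_sum /=; apply: eq_bigr => a _.
by rewrite linearD !linearZ /= !hpart_unit !addbb.
Qed.

Lemma vwt_bound (i : 'I_n.+1) c : [\/ vwt i c = 0, vwt i c = 1 | vwt i c = -1].
Proof.
elim/vindex_ind: c => a ha; rewrite ?vwtP // ?vwtN //; first exact: Hval_bound.
by have [-> | -> | ->] := Hval_bound i a; [constructor 1 | constructor 3 | constructor 2].
Qed.

Lemma vec_cartan (i : 'I_n.+1) :
  (qi qh i - (qi qh i)^-1)^-1 *: (vec_k qh 1 i ^+ 2 - vec_k qh (-1) i ^+ 2)
  = diag_mx (\row_c (vwt i c)%:~R) :> 'M[K]_((nn n).+1).
Proof.
have t1 : qi qh i - (qi qh i)^-1 != 0.
  by have := qi_neqV qh_neq0 q_generic i (ltn0Sn 0); rewrite expr1.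
rewrite !expr2 -[_ * _]/(_ *m _) -[vec_k _ (-1) _ * _]/(_ *m _) !vec_kE !mulmx_diag.
rewrite -linearB -linearZ; congr diag_mx; apply/rowP => c; rewrite !mxE.
have sq (h : int) : qhi qh i ^ h * qhi qh i ^ h = qi qh i ^ h by rewrite /qi -expfzMl.
rewrite !sq !mul1r !mulN1r.
have [-> | -> | ->] := vwt_bound i c.
- by rewrite oppr0 expr0z subrr mulr0.
- by rewrite expr1z mulVf.
- by rewrite opprK expr1z -[_ ^ (-1)]/((qi qh i)^-1) -[(qi qh i)^-1 - _]opprB mulrN mulVf // rmorphN.
Qed.

Lemma D_diag a c d : D a a c d = ((c == a) && (c == d))%:R.
Proof. by rewrite mxE; case: (eqVneq c a) => [->|]; rewrite // eq_sym. Qed.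

Lemma vec_bracket (i j : 'I_n.+1) : let s := if i == ord0 then 1 else -1 in
  raise_mx s i * lower_mx j
    - (-1) ^+ ((i == ord0) && (j == ord0)) *: (lower_mx j * raise_mx s i)
  = if i == j then (qi qh i - (qi qh i)^-1)^-1 *: (vec_k qh 1 i ^+ 2 - vec_k qh (-1) i ^+ 2)
    else 0.
Proof.
move=> s; have hi : (i <= n)%N by rewrite -ltnS.
have hj : (j <= n)%N by rewrite -ltnS.
case: (eqVneq i j) => [<-{j hj}|ij]; last first.
  move: ij; rewrite -val_eqE /= => ij.
  rewrite /raise_mx /lower_mx.
  by case: ifP => hin; case: ifP => hjn; unit_products; unit_zero.
rewrite vec_cartan andbb; set g := (-1) ^+ _.
transitivity (if (i < n)%N then
    D (P i) (P i) - s *: D (N i.+1) (N i.+1) - g *: (D (P i.+1) (P i.+1) - s *: D (N i) (N i))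
  else D (P n) (P n) - D (N n) (N n) : M).
  rewrite /raise_mx /lower_mx; case: ifP => hin.
    by unit_products; rewrite !eqxx ?(scaler0, addr0, add0r, oppr0).
  have i0 : (i == ord0) = false by rewrite -val_eqE /=; lia.
  have g1 : g = 1 by rewrite /g i0.
  by rewrite !DM !eqxx g1 scale1r.
apply/matrixP => c d; rewrite [RHS]mxE !mxE.
case: (eqVneq c d) => [<-|cd]; last first.
  rewrite mulr0n; case: ifP => _; rewrite !(D_diag, mxE) (negPf cd) !andbF.
    by rewrite !(mulr0, oppr0, addr0).
  by rewrite subr0.
(* The two possible signs: even roots, and the odd simple root. *)
have gs : (g = 1 /\ s = -1 /\ (0 < i)%N) \/ (g = -1 /\ s = 1 /\ i = 0%N :> nat).
  rewrite /g /s -val_eqE /=; case: (nat_of_ord i) => [|m]; [right | left];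
    by rewrite ?expr0 ?expr1.
elim/vindex_ind: c => a ha; rewrite ?vwtP ?vwtN // mulr1n.
  case: ifP => hin; rewrite !(D_diag, mxE) eqxx !andbT; deqs; rewrite /= ?mulr0n /Hval hin.
    case: gs => [[-> [-> i0]]|[-> [-> ->]]] /=.
      by rewrite (_ : (i == 0 :> nat) = false); last lia; rewrite /= mulrzBr !natz -!pmulrn; ring.
    by rewrite mulrzDr !natz -!pmulrn; ring.
  by rewrite (_ : (i == 0 :> nat) = false) /= ?natz -?pmulrn ?subr0 //; lia.
case: ifP => hin; rewrite !(D_diag, mxE) eqxx !andbT; deqs; rewrite /= ?mulr0n /Hval hin.
  case: gs => [[-> [-> i0]]|[-> [-> ->]]] /=.
    by rewrite (_ : (i == 0 :> nat) = false); last lia; rewrite /= opprB mulrzBr !natz -!pmulrn; ring.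
  by rewrite opprD mulrzDr !mulrNz !natz -!pmulrn; ring.
by rewrite (_ : (i == 0 :> nat) = false) /= ?mulrNz ?natz -?pmulrn ?sub0r //; lia.
Qed.

Lemma model_vec : model qh (@vec_gen K n qh).
Proof.
have fun_raise : @vec_gen K n qh \o @Ge n =
    fun i => raise_mx (if i == ord0 then 1 else -1) i.
  by apply/funext => i; exact: raiseE.
have fun_lower : @vec_gen K n qh \o @Gf n = fun i => lower_mx i.
  by apply/funext => i; exact: lowerE.
split.
  case=> i; rewrite ?raiseE ?lowerE; [exact: hpart_vec_k | exact: hpart_vec_k
    | exact: hpart_raise | exact: hpart_lower].
rewrite fun_raise fun_lower; split=> [i j|i|i|i j|i j|i j|||i j i0 ij|i j i0 ij] /=.
- exact: vec_kk.
- exact: vec_kk'.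
- by have := vec_kk' (-1) i; rewrite opprK.
- exact: vec_conj_raise.
- exact: vec_conj_lower.
- exact: vec_bracket.
- by rewrite expr2 raise0_sqr.
- by rewrite expr2 lowerM raise0_sqr trmx0.
- exact: (raise_serre (fun i => if i == ord0 then 1 else -1)).
- exact: lower_serre.
Qed.

End VectorModel.

(** * Coproducts and translations in the dual *)

Section Translation.
Variables (K : fieldType) (X : superAlgType K) (B : gsub (dual X)).

Lemma dualP (a b : dual X) : (forall x, a x = b x) -> a = b.
Proof. by move=> h; apply/val_inj/funext. Qed.

Lemma subdualP (a b : B) : (forall x, dval (val a) x = dval (val b) x) -> a = b.
Proof. by move=> h; apply/val_inj/dualP. Qed.

Lemma dual_lin (a : dual X) c x y : a (c *: x + y) = c * a x + a y.
Proof. exact: dual_linear. Qed.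
Lemma dual_add (a : dual X) x y : a (x + y) = a x + a y.
Proof. by have := dual_lin a 1 x y; rewrite scale1r mul1r. Qed.
Lemma dual_zero (a : dual X) : a 0 = 0.
Proof. exact: (lin0 (dual_linear a)). Qed.
Lemma val_part p (b : B) x : dval (val (hpart p b)) x = dval (val b) (hpart p x).
Proof. exact: dpartE. Qed.

Lemma dual_part p (b : dual X) x : dval (hpart p b) x = b (hpart p x).
Proof. exact: dpartE. Qed.

Lemma dval_lin c (a b : dual X) x : dval (c *: a + b) x = c * a x + b x.
Proof. by []. Qed.

Lemma val_lin c (a b : B) x :
  dval (val (c *: a + b)) x = c * dval (val a) x + dval (val b) x.
Proof. by rewrite linearP. Qed.
Lemma val_scale c (a : B) x : dval (val (c *: a)) x = c * dval (val a) x.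
Proof. by rewrite linearZ. Qed.

Lemma tform_inner (f g : dual X) : bilin (fun v w : X => \sum_(p : bool) \sum_(r : bool)
    (-1) ^+ (p && r) * (f (hpart r v) * g (hpart p w)) : K^o).
Proof.
split=> [w c v1 v2 | v c w1 w2]; rewrite /= scaler_sumr -big_split;
  apply: eq_bigr => p _ /=; rewrite scaler_sumr -big_split;
  apply: eq_bigr => r _ /=; rewrite linearP dual_lin /GRing.scale /=; ring.
Qed.

Lemma tform_linear (f g : dual X) : linear (tform f g : tens X X -> K^o).
Proof. exact: tlift_linear (tform_inner f g). Qed.

Lemma tform_pure (f g : dual X) x y : tform f g (pure x y) =
  \sum_(p : bool) \sum_(r : bool) (-1) ^+ (p && r) * (f (hpart r x) * g (hpart p y)).
Proof. exact: (tlift_pure _ _ (tform_inner f g)). Qed.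

Lemma dpair_inner z : bilin (fun a b : B => tform (dval (val a)) (dval (val b)) z : K^o).
Proof.
split=> [b c a1 a2 | a c b1 b2]; rewrite /= /tform /tlift /tev scaler_sumr -big_split;
  apply: eq_bigr => u _ /=; rewrite scaler_sumr -big_split;
  apply: eq_bigr => p _ /=; rewrite scaler_sumr -big_split;
  apply: eq_bigr => r _ /=; rewrite /GRing.scale /=.
  rewrite -[dval _ (hpart r _)]/(c * dval (val a1) (hpart r u.1) + dval (val a2) (hpart r u.1)).
  by ring.
rewrite -[X in _ * (_ * X) = _]/(c * dval (val b1) (hpart p u.2) + dval (val b2) (hpart p u.2)).
by ring.
Qed.

Lemma dpair_linear z : linear ((@dpair _ _ B)^~ z : tens B B -> K^o).
Proof. exact: tlift_linear (dpair_inner z). Qed.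

Lemma dpair_pure (a b : B) z : dpair (pure a b) z = tform (dval (val a)) (dval (val b)) z.
Proof. exact: (tlift_pure _ _ (dpair_inner z)). Qed.

(** The functions on X x X that come from B (x) B; the signs of the pairing are
    absorbed into the components, since B is graded. *)
Definition decomposable (g : X -> X -> K) :=
  exists s : seq (B * B),
    forall x y, g x y = \sum_(u <- s) dval (val u.1) x * dval (val u.2) y.

Lemma decomposable_pure c (a b : B) (g : X -> X -> K) :
  (forall x y, g x y = c * (dval (val a) x * dval (val b) y)) -> decomposable g.
Proof.
move=> h; exists [:: (c *: a, b)] => x y; rewrite big_seq1 h mulrA /=.
by rewrite val_scale.
Qed.

Lemma decomposable_sum I (r : seq I) (F : I -> X -> X -> K) (g : X -> X -> K) :
  (forall i, decomposable (F i)) -> (forall x y, g x y = \sum_(i <- r) F i x y) ->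
  decomposable g.
Proof.
move=> hF; elim: r g => [|i r IH] g hg.
  by exists [::] => x y; rewrite hg !big_nil.
have [s hs] := IH (fun x y => \sum_(i <- r) F i x y) (fun _ _ => erefl).
have [s' hs'] := hF i; exists (s' ++ s) => x y.
by rewrite hg big_cons big_cat hs' hs.
Qed.

(** The tensor is the sum of the homogeneous components of the given terms, each
    with the sign that the pairing introduces. *)
Lemma coprodE (a : B) : decomposable (fun x y => dval (val a) (x * y)) ->
  forall x y, dpair (coprod a) (pure x y) = dval (val a) (x * y).
Proof.
case=> s hs; apply: (@xgetPex _ _ (fun T : tens B B =>
  forall x y, dpair T (pure x y) = dval (val a) (x * y))).
exists (\sum_(u <- s) \sum_(p : bool) \sum_(r : bool)
  (-1) ^+ (p && r) *: pure (hpart r u.1) (hpart p u.2)) => x y.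
have sumE I (l : seq I) (F : I -> tens B B) :
    dpair (\sum_(i <- l) F i) (pure x y) = \sum_(i <- l) dpair (F i) (pure x y).
  elim: l => [|i l IH]; first by rewrite !big_nil; exact: (lin0 (dpair_linear _)).
  rewrite !big_cons -IH -[F i]scale1r; have := dpair_linear (pure x y) 1 (F i).
  by move=> ->; rewrite !scale1r.
have scaleE c (T : tens B B) : dpair (c *: T) (pure x y) = c * dpair T (pure x y).
  have := dpair_linear (pure x y) c T 0; rewrite addr0 => ->.
  by rewrite (lin0 (dpair_linear _)) addr0.
rewrite hs sumE; apply: eq_bigr => u _; rewrite sumE.
rewrite -{2}[x]hpart_sum -{2}[y]hpart_sum !dual_add.
have addE (T S : tens B B) :
    dpair (T + S) (pure x y) = dpair T (pure x y) + dpair S (pure x y).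
  by have := dpair_linear (pure x y) 1 T S; rewrite !scale1r.
rewrite !big_bool /= !addE !scaleE !dpair_pure !tform_pure !big_bool /=.
by rewrite !val_part !hpartI /= !dual_zero; ring.
Qed.

Definition contract (T : tens B B) (x : X) : B :=
  tlift (fun a b : B => \sum_(p : bool) \sum_(r : bool)
    ((-1) ^+ (p && r) * dval (val a) (hpart r x)) *: hpart p b) T.

Lemma dval_sum I (l : seq I) (F : I -> B) z :
  dval (val (\sum_(i <- l) F i)) z = \sum_(i <- l) dval (val (F i)) z.
Proof.
elim: l => [|i l IH]; first by rewrite !big_nil linear0.
by rewrite !big_cons -IH -[F i]scale1r val_lin mul1r scale1r.
Qed.

Lemma contractE T x z : dval (val (contract T x)) z = dpair T (pure x z).
Proof.
rewrite /contract /dpair /tlift /tev dval_sum; apply: eq_bigr => u _.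
rewrite [RHS]tform_pure dval_sum; apply: eq_bigr => p _.
rewrite dval_sum; apply: eq_bigr => r _.
by rewrite val_scale val_part mulrA.
Qed.

Lemma scalar_sum (g : B -> K) I (l : seq I) (F : I -> B) : scalar g ->
  g (\sum_(i <- l) F i) = \sum_(i <- l) g (F i).
Proof.
move=> hg; elim: l => [|i l IH].
  by rewrite !big_nil; exact: (lin0 (hg : linear (g : B -> K^o))).
by rewrite !big_cons -IH -[F i]scale1r hg mul1r scale1r.
Qed.

Lemma scalar_scale (g : B -> K) c a : scalar g -> g (c *: a) = c * g a.
Proof.
move=> hg; have := hg c a 0; rewrite addr0 => ->.
by rewrite (lin0 (hg : linear (g : B -> K^o))) addr0.
Qed.

(** Evaluating the first leg at x produces the same sign as slicing: only the
    component of degree [x] of that leg contributes. *)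
Lemma tslice_contract (g : B -> K) (T : tens B B) x : scalar g ->
  dval (val (tslice g T : B)) x = g (contract T x).
Proof.
move=> hg; rewrite /contract /tslice /tlift /tev dval_sum scalar_sum //.
apply: eq_bigr => u _; rewrite dval_sum scalar_sum //.
apply: eq_bigr => p _; rewrite dval_sum scalar_sum //.
apply: eq_bigr => r _; rewrite val_scale scalar_scale // val_part; ring.
Qed.

Lemma nu_even x (a : B) : hpart false x = x -> nu x a = dval (val a) x.
Proof.
move=> hx; rewrite /nu !big_bool /= !val_part !(hpart_hom _ hx) /= !linear0 !dual_zero.
by ring.
Qed.

Lemma tform_nu_contract x (g : B -> K) (T : tens B B) : scalar g -> hpart false x = x ->
  tform (nu x) g T = g (contract T x).
Proof.
move=> hg hx; rewrite /contract /tform /tlift /tev scalar_sum //.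
apply: eq_bigr => u _; rewrite scalar_sum //.
apply: eq_bigr => p _; rewrite scalar_sum //.
apply: eq_bigr => r _; rewrite scalar_scale // nu_even // val_part; ring.
Qed.

(** The translate a(x _), obtained from the coproduct so that it lies in B. *)
Definition ltrans (x : X) (a : B) : B := contract (coprod a) x.

Lemma ltransE x a z : decomposable (fun x y => dval (val a) (x * y)) ->
  dval (val (ltrans x a)) z = dval (val a) (x * z).
Proof. by move=> ha; rewrite contractE coprodE. Qed.

End Translation.

(** * The algebra of functions has a coproduct *)

Section Functions.
Variables (K : fieldType) (n : nat) (qh : K).
Hypothesis n_gt0 : (0 < n)%N.
Hypothesis qh_neq0 : qh != 0.
Hypothesis q_generic : forall m : nat, (0 < m)%N -> (qh ^+ 2) ^+ m != 1.
Local Notation U := (Uq n qh).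
Local Notation A := (Asub n qh).
Local Notation Ae := (Aesub n qh).

Let mD := model_Delta n_gt0 qh_neq0 q_generic.
Let mV := model_vec n_gt0 qh_neq0 q_generic.
Let mE := model_eps n qh.

Lemma dmulE (a b : dual U) (x : U) : dmul a b x = tform a b (Delta x).
Proof.
rewrite /dmul mkdualE // => c u v; rewrite /conv /Delta !(Ulift_morph mD).
exact: tform_linear.
Qed.

Lemma tcoefE i j (u : U) : tcoef qh i j u = vec_rep u i j.
Proof.
rewrite /tcoef mkdualE // => c x y; rewrite /vec_rep !(Ulift_morph mV).
by rewrite !mxE.
Qed.

Lemma counitM (x y : U) : counit (x * y) = counit x * counit y.
Proof. by rewrite /counit (Ulift_morph mE). Qed.

(** Compatibility of the product and the coproduct of the dual, for two forms
    with given decompositions. The sign comes from moving the first component of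
    a past the second component of b. *)
Lemma tformM (a b : dual U) (s s' : seq (dual U * dual U)) (z w : tens U U) :
  (forall x y, a (x * y) = \sum_(u <- s) u.1 x * u.2 y) ->
  (forall x y, b (x * y) = \sum_(u <- s') u.1 x * u.2 y) ->
  tform a b (z * w) = \sum_(u <- s) \sum_(u' <- s') \sum_(p : bool) \sum_(r : bool)
    (-1) ^+ (p && r) * (tform (hpart p u.1 : dual U) u'.1 z * tform u.2 (hpart r u'.2 : dual U) w).
Proof.
move=> ha hb.
have t0 (f g : dual U) : tform f g 0 = 0 by exact: (lin0 (tform_linear f g)).
have tD (f g : dual U) x y : tform f g (x + y) = tform f g x + tform f g y.
  by have := tform_linear f g 1 x y; rewrite !scale1r.
have tZ (f g : dual U) c x : tform f g (c *: x) = c * tform f g x.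
  by have := tform_linear f g c x 0; rewrite addr0 t0 addr0.
have thom (f g : dual U) p r x y : hpart p x = x -> hpart r y = y ->
    tform f g (pure x y) = (-1) ^+ (p && r) * (f x * g y).
  move=> hx hy; rewrite tform_pure !big_bool /= !(hpart_hom _ hx) !(hpart_hom _ hy).
  by case: (p); case: (r); rewrite /= !dual_zero; ring.
elim/tens_hom_ind: z => [|z z' IH IH'|p1 p2 x1 x2 h1 h2].
- rewrite mul0r t0; symmetry; do 2 (apply: big1 => ? _); rewrite !big_bool /= !t0; ring.
- rewrite mulrDl tD IH IH' -big_split; apply: eq_bigr => u _; rewrite -big_split.
  by apply: eq_bigr => u' _; rewrite !big_bool /= !tD; ring.
elim/tens_hom_ind: w => [|w w' IH IH'|q1 q2 y1 y2 k1 k2].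
- rewrite mulr0 t0; symmetry; do 2 (apply: big1 => ? _); rewrite !big_bool /= !t0; ring.
- rewrite mulrDr tD IH IH' -big_split; apply: eq_bigr => u _; rewrite -big_split.
  by apply: eq_bigr => u' _; rewrite !big_bool /= !tD; ring.
rewrite (pureM_sign _ _ h2 k1) tZ (thom _ _ _ _ _ _ (hpartM_hom h1 k1) (hpartM_hom h2 k2)).
rewrite ha hb mulr_suml !mulr_sumr; apply: eq_bigr => u _.
rewrite !mulr_sumr; apply: eq_bigr => u' _.
rewrite !big_bool /= !(thom _ _ _ _ _ _ h1 h2) !(thom _ _ _ _ _ _ k1 k2) !dual_part.
rewrite !(hpart_hom _ h1) !(hpart_hom _ k2).
by case: (p1); case: (p2); case: (q1); case: (q2); rewrite /= ?dual_zero; ring.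
Qed.

Lemma Asub_decomposable (a : A) : decomposable A (fun x y => dval (val a) (x * y)).
Proof.
suff h b : A b -> decomposable A (fun x y : U => dval b (x * y)).
  exact: h (gmemP a).
elim=> {a b} [b [i [j ->]]|||c a b _ IHa _ IHb|a b ha IHa hb IHb|p a ha [s hs]].
- apply: (@decomposable_sum _ _ _ _ (index_enum _)
     (fun k x y => tcoef qh i k x * tcoef qh k j y)).
    move=> k.
    have hik : A (tcoef qh i k) by apply: gen_incl; exists i, k.
    have hkj : A (tcoef qh k j) by apply: gen_incl; exists k, j.
    by apply: (@decomposable_pure _ _ _ 1 (gin hik) (gin hkj)) => x y; rewrite mul1r.
  move=> x y; rewrite tcoefE /vec_rep (Ulift_morph mV) mxE.
  by apply: eq_bigr => k _; rewrite !tcoefE.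
- apply: (@decomposable_pure _ _ _ 1 (A_one n qh) (A_one n qh)) => x y.
  by rewrite mul1r; exact: counitM.
- by exists [::] => x y; rewrite big_nil.
- have [s hs] := IHa; have [s' hs'] := IHb.
  apply: (@decomposable_sum _ _ _ _ [:: true; false] (fun i x y =>
    if i then c * dval a (x * y) else dval b (x * y))) => [[]|x y].
  + apply: (@decomposable_sum _ _ _ _ s
      (fun u x y => c * (dval (val u.1) x * dval (val u.2) y))) => [u|x y].
      exact: decomposable_pure.
    by rewrite hs mulr_sumr.
  + by exists s'.
  + by rewrite !big_cons big_nil addr0 dval_lin.
- have [s hs] := IHa; have [s' hs'] := IHb.
  have hM x y := @tformM a b [seq (val u.1, val u.2) | u <- s]
    [seq (val u.1, val u.2) | u <- s'] (Delta x) (Delta y).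
  apply: (@decomposable_sum _ _ _ _ s (fun u x y => \sum_(u' <- s') \sum_(p : bool) \sum_(r : bool)
    (-1) ^+ (p && r) * (tform (hpart p (val u.1) : dual U) (dval (val u'.1)) (Delta x)
      * tform (dval (val u.2)) (hpart r (val u'.2) : dual U) (Delta y)))) => [u|x y].
    apply: (@decomposable_sum _ _ _ _ s') => [u'|x y]; last by [].
    apply: (@decomposable_sum _ _ _ _ (index_enum bool)) => [p|x y]; last by [].
    apply: (@decomposable_sum _ _ _ _ (index_enum bool)) => [r|x y]; last by [].
    pose v1 : A := @gin K (dual U) A _ (gen_mul (gen_part p (gmemP u.1)) (gmemP u'.1)).
    pose v2 : A := @gin K (dual U) A _ (gen_mul (gmemP u.2) (gen_part r (gmemP u'.2))).
    refine (@decomposable_pure _ _ A ((-1) ^+ (p && r)) v1 v2 _ _) => x y.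
    by rewrite -!dmulE.
  rewrite dmulE {1}/Delta (Ulift_morph mD) hM ?big_map.
  + by apply: eq_bigr => u _; rewrite big_map.
  + by move=> x' y'; rewrite big_map hs.
  + by move=> x' y'; rewrite big_map hs'.
- apply: (@decomposable_sum _ _ _ _ (index_enum bool)
    (fun r x y => \sum_(u <- s) dval (val u.1) (hpart r x) * dval (val u.2) (hpart (p (+) r) y))) => [r|x y].
    apply: (@decomposable_sum _ _ _ _ s) => [u|x y]; last by [].
    apply: (@decomposable_pure _ _ _ 1 (hpart r u.1 : A) (hpart (p (+) r) u.2 : A)) => x y.
    by rewrite mul1r !val_part.
  rewrite dual_part hpartM !big_bool /= dual_add.
  by rewrite !hs.
Qed.

Lemma Aesub_decomposable (c : Ae) : decomposable Ae (fun x y => dval (val c) (x * y)).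
Proof.
have [a ha ac] := gmemP c.
have [s hs] := Asub_decomposable (gin ha).
exists [seq (resA u.1, resA u.2) | u <- s] => x y; rewrite big_map ac.
rewrite [LHS]restrE [val (x * y)]/(val x * val y) hs.
by apply: eq_bigr => u _; congr (_ * _); exact/esym/restrE.
Qed.
End Functions.

(** * Left integrals from invariant elements *)

Section LeftIntegral.
Variables (K : fieldType) (n : nat) (qh : K).
Hypothesis n_gt0 : (0 < n)%N.
Hypothesis qh_neq0 : qh != 0.
Hypothesis q_generic : forall m : nat, (0 < m)%N -> (qh ^+ 2) ^+ m != 1.
Local Notation U := (Uq n qh).
Local Notation A := (Asub n qh).
Local Notation Ae := (Aesub n qh).

Let mE := model_eps n qh.
Let Adec := Asub_decomposable n_gt0 qh_neq0 q_generic.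
Let Aedec := Aesub_decomposable n_gt0 qh_neq0 q_generic.

Lemma ltrans_val u (a : A) z : dval (val (ltrans u a)) z = dval (val a) (u * z).
Proof. exact: ltransE z (Adec a). Qed.

Lemma ltrans_linl c u v (a : A) : ltrans (c *: u + v) a = c *: ltrans u a + ltrans v a.
Proof.
apply: subdualP => z; rewrite val_lin !ltrans_val.
by rewrite mulrDl -scalerAl dual_lin.
Qed.

Lemma ltrans_linr c u (a b : A) : ltrans u (c *: a + b) = c *: ltrans u a + ltrans u b.
Proof. by apply: subdualP => z; rewrite [LHS]ltrans_val !val_lin !ltrans_val. Qed.

Lemma ltransM u v (a : A) : ltrans (u * v) a = ltrans v (ltrans u a).
Proof. by apply: subdualP => z; rewrite !ltrans_val mulrA. Qed.

Lemma resA_lin c (a b : A) : resA (c *: a + b) = c *: resA a + resA b.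
Proof.
apply: subdualP => z; rewrite val_lin.
rewrite -[LHS]/(dval (restr (val (c *: a + b))) z).
by rewrite [LHS]restrE val_lin; congr (_ * _ + _); exact/esym/restrE.
Qed.

Lemma resA_ltrans (y : Uq0 n qh) (a : A) : resA (ltrans (val y) a) = ltrans y (resA a).
Proof.
apply: subdualP => z; rewrite ltransE; last exact: Aedec.
by rewrite [LHS]restrE ltrans_val; exact/esym/restrE.
Qed.

Variable int0 : Ae -> K.
Hypothesis int0_left :
  left_integral (@coprod _ _ Ae) (resA (A_one n qh)) int0.

Lemma int0_ltrans (y : Uq0 n qh) (c : Ae) : int0 (ltrans y c) = int0 c * counit (val y).
Proof.
have [lin inv] := int0_left.
rewrite /ltrans -tslice_contract // inv val_scale; congr (_ * _); exact: restrE.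
Qed.

(** The annihilator of the form int0 o P, which is the left ideal to which the
    invariance of Gamma is applied. *)
Definition annihilates (u : U) : Prop := forall a : A, int0 (resA (ltrans u a)) = 0.

Lemma annihilates_lin c u v : annihilates u -> annihilates v -> annihilates (c *: u + v).
Proof.
have [lin _] := int0_left.
by move=> hu hv a; rewrite ltrans_linl resA_lin lin hu hv mulr0 addr0.
Qed.

Lemma annihilates_mul x u : annihilates u -> annihilates (x * u).
Proof. by move=> hu a; rewrite ltransM hu. Qed.

Lemma annihilates_even (u : U) : gen0 u -> annihilates (u - counit u *: 1).
Proof.
move=> hu a; have [lin _] := int0_left.
pose y : Uq0 n qh := @gin K U (U0sub n qh) _ (gen_incl _ _ hu).
have tr1 : ltrans 1 a = a by apply: subdualP => z; rewrite ltrans_val mul1r.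
have -> : u - counit u *: 1 = - counit u *: 1 + u by rewrite addrC scaleNr.
rewrite ltrans_linl resA_lin lin tr1 -[u]/(val y) resA_ltrans int0_ltrans.
by rewrite mulNr mulrC addNr.
Qed.

Lemma U_ind (Q : U -> Prop) : (forall g, Q (ugen qh g)) -> Q 1 ->
  (forall u v, Q u -> Q v -> Q (u + v)) -> (forall u v, Q u -> Q v -> Q (u * v)) ->
  (forall c u, Q u -> Q (c *: u)) -> forall u, Q u.
Proof.
move=> hg h1 hD hM hZ u; rewrite -[u]reprK.
elim: (repr u) => [g||s IHs t IHt|s IHs t IHt|c s IHs].
- exact: hg.
- exact: h1.
- rewrite (_ : \pi_U _ = \pi_U s + \pi_U t); first exact: hD.
  by apply: UqP => B x hx; rewrite (Ulift_morph hx) !(Ulift_pi _ hx).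
- rewrite (_ : \pi_U _ = \pi_U s * \pi_U t); first exact: hM.
  by apply: UqP => B x hx; rewrite (Ulift_morph hx) !(Ulift_pi _ hx).
- rewrite (_ : \pi_U _ = c *: \pi_U s); first exact: hZ.
  by apply: UqP => B x hx; rewrite (Ulift_morph hx) !(Ulift_pi _ hx).
Qed.

Lemma annihilates0 : annihilates 0.
Proof.
by have := annihilates_mul 0 (annihilates_even (gen0_k qh ord0)); rewrite mul0r.
Qed.

Lemma invariant_all (G : U) :
  (forall g, annihilates (ugen qh g * G - counit (ugen qh g) *: G)) ->
  forall x, annihilates (x * G - counit x *: G).
Proof.
move=> hG; apply: U_ind => //= [|u v hu hv|u v hu hv|c u hu].
- rewrite /counit (Ulift_morph mE) mul1r scale1r subrr; exact: annihilates0.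
- rewrite /counit (Ulift_morph mE) mulrDl scalerDl opprD addrACA -[X in X + _]scale1r.
  exact: annihilates_lin.
- have -> : u * v * G - counit (u * v) *: G = counit v *: ((u * G - counit u *: G) : U)
      + u * (v * G - counit v *: G).
    rewrite mulrBr -scalerAr scalerBr scalerA mulrA [RHS]addrC addrA subrK.
    by rewrite /counit (Ulift_morph mE) mulrC.
  by apply: annihilates_lin => //; exact: annihilates_mul.
- rewrite /counit (Ulift_morph mE) -scalerAl -scalerA -scalerBr -[_ *: _]addr0.
  by apply: annihilates_lin => //; exact: annihilates0.
Qed.

Local Notation G0 := (asc_prod qh (negate0 (@ue K n qh)) 0 n.*2 * desc_prod qh (@uf K n qh) n.*2).

Lemma counit_gen (g : gen n) : counit (ugen qh g) = eps_gen K g.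
Proof. exact: Ulift_gen mE g. Qed.

Lemma annihilates_gen0 (i : 'I_n.+1) :
  [/\ i != ord0 -> annihilates (ue qh i), i != ord0 -> annihilates (uf qh i),
      annihilates (uk qh i - 1) & annihilates (uk' qh i - 1)].
Proof.
split=> [i0|i0||].
- have := annihilates_even (gen0_e qh i0); by rewrite counit_gen scale0r subr0.
- have := annihilates_even (gen0_f qh i0); by rewrite counit_gen scale0r subr0.
- have := annihilates_even (gen0_k qh i); by rewrite counit_gen scale1r.
- have := annihilates_even (gen0_k' qh i); by rewrite counit_gen scale1r.
Qed.

Lemma G0_invariant c g :
  annihilates (ugen qh g * (c *: G0) - counit (ugen qh g) *: (c *: G0)).
Proof.
suff h : annihilates (ugen qh g * G0 - counit (ugen qh g) *: G0).
  rewrite -scalerAr scalerA [_ * c]mulrC -scalerA -scalerBr -[_ *: _]addr0.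
  by apply: annihilates_lin => //; exact: annihilates0.
have Le i := let: And4 h _ _ _ := annihilates_gen0 i in h.
have Lf i := let: And4 _ h _ _ := annihilates_gen0 i in h.
have Lk i := let: And4 _ _ h _ := annihilates_gen0 i in h.
have Lk' i := let: And4 _ _ _ h := annihilates_gen0 i in h.
have R := osp_rel_U n qh.
have L1 := annihilates_lin; have L2 := annihilates_mul.
rewrite counit_gen; case: g => i; rewrite /= ?scale1r ?scale0r ?subr0.
- exact: (k_ideal qh_neq0 R L2 Lk).
- exact: (k'_ideal qh_neq0 R L2 Lk').
- by apply: (e_ideal n_gt0 qh_neq0 q_generic R L1 L2 Le Lk).
- by apply: (f_ideal n_gt0 qh_neq0 q_generic R L1 L2 Le Lf Lk Lk').
Qed.

Theorem left_integral_of_even_invariant (G : U) : hpart false G = G ->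
  (exists c, G = c *: G0) ->
  left_integral (@coprod _ _ A) (A_one n qh)
    (conv (@coprod _ _ A) (nu G) (fun a : A => int0 (resA a))).
Proof.
move=> Gev [c Gc]; have [lin _] := int0_left.
set I0 := fun a : A => int0 (resA a).
have I0lin : scalar I0 by move=> d a b; rewrite /I0 resA_lin lin.
have convE a : conv (@coprod _ _ A) (nu G) I0 a = I0 (ltrans G a).
  exact: tform_nu_contract.
have Ilin : scalar (conv (@coprod _ _ A) (nu G) I0).
  by move=> d a b; rewrite !convE ltrans_linr I0lin.
split=> // a; apply: subdualP => x; rewrite tslice_contract // convE.
rewrite -[contract _ x]/(ltrans x a) -ltransM val_scale convE.
have h : annihilates (x * G - counit x *: G).
  by apply: invariant_all => g; rewrite Gc; exact: G0_invariant.
have := h a; rewrite addrC -scaleNr ltrans_linl resA_lin lin mulNr addrC => /eqP.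
rewrite subr_eq0 => /eqP; rewrite -/(I0 _) mulrC => ->.
by [].
Qed.

End LeftIntegral.

(** * Gamma as a product along the string *)

Section Gamma.
Variables (K : fieldType) (n : nat) (qh : K).
Hypothesis n_gt0 : (0 < n)%N.
Hypothesis qh_neq0 : qh != 0.
Local Notation U := (Uq n qh).
Local Notation X := (odd_root qh (negate0 (@ue K n qh))).
Local Notation Y := (odd_root qh (@uf K n qh)).
Local Notation q := (qh ^+ 2).

Lemma qi_inner i : (0 < i < n)%N -> qi qh (inord i : 'I_n.+1) = q^-1.
Proof.
move=> hi; have iv : (inord i : 'I_n.+1) = i :> nat by rewrite inordK //; lia.
have i0 : (inord i : 'I_n.+1) != ord0 by rewrite -val_eqE /= iv; lia.
by rewrite /qi qhiE (negPf i0) iv ifT; [rewrite -[_ ^ _]/(qh^-1) exprVn | lia].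
Qed.

Lemma qi_outer : qi qh (inord n : 'I_n.+1) = q ^- 2.
Proof.
have iv : (inord n : 'I_n.+1) = n :> nat by rewrite inordK.
have i0 : (inord n : 'I_n.+1) != ord0 by rewrite -val_eqE /= iv; lia.
by rewrite /qi qhiE (negPf i0) iv ltnn -[_ ^ _]/(qh ^- 2) exprVn.
Qed.

Definition proportional (u v : U) := exists c, u = c *: v.

Lemma psi_step (i : 'I_n.+1) (u : U) p : i != ord0 -> node n p = i ->
  proportional u (X p) -> proportional (u * ue qh i - (qi qh i)^-1 *: (ue qh i * u)) (X p.+1).
Proof.
move=> i0 ip [c ->]; exists (- (qi qh i)^-1 * c).
rewrite odd_root_rec_step ip (_ : negate0 _ i = ue qh i); last by rewrite /negate0 (negPf i0).
have cE : - (qi qh i)^-1 * c * qi qh i = - c.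
  by rewrite mulrAC mulNr mulVf ?qi_neq0 // mulN1r.
rewrite -scalerAl -scalerAr scalerBr !scalerA cE.
by rewrite scaleNr opprK [RHS]addrC mulNr scaleNr.
Qed.

(** The psi's are defined with e_i on the other side of the q-commutator, hence
    the scalars. *)
Lemma psi_posE i : (i < n)%N -> proportional (psi_pos n qh i.+1) (X i).
Proof.
elim: i => [|i IH] hi.
  exists (-1); rewrite odd_root_0 /negate0 eqxx scalerN scaleN1r opprK /=.
  by congr (ue qh _); apply: val_inj; rewrite /= inordK.
have iv : (inord i.+1 : 'I_n.+1) = i.+1 :> nat by rewrite inordK //; lia.
rewrite [psi_pos _ _ _]/= -[if _ then _ else _]/(psi_pos n qh i.+1) -[q]invrK -(@qi_inner i.+1); last lia.
apply: psi_step; last by apply: IH; lia.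
  by rewrite -val_eqE /= iv.
by rewrite /node; congr inord; lia.
Qed.

Lemma psi_negE j : (j < n)%N -> proportional (psi_neg_rec n qh j) (X (n + j)).
Proof.
have key i p (u : U) : (0 < i <= n)%N -> minn p.+1 (n.*2.-1 - p) = i ->
    proportional u (X p) ->
    proportional (u * ue qh (inord i) - (qi qh (inord i : 'I_n.+1))^-1 *: (ue qh (inord i) * u)) (X p.+1).
  move=> hi hp; apply: psi_step; last by rewrite /node hp.
  by rewrite -val_eqE /= inordK; lia.
elim: j => [|j IH] hj.
  have -> : (n + 0 = n.-1.+1)%N by lia.
  rewrite /= -[q ^+ 2]invrK -qi_outer; apply: key; try lia.
  by have := @psi_posE n.-1; rewrite prednK //; apply; lia.
rewrite addnS [psi_neg_rec _ _ _]/= -[q]invrK -(@qi_inner (n - j.+1)); last lia.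
by apply: key; [lia | lia | apply: IH; lia].
Qed.

Lemma phi_posE i : (i < n)%N -> phi_pos n qh i.+1 = Y i.
Proof.
elim: i => [|i IH] hi.
  by rewrite odd_root_0 /=; congr (uf qh _); apply: val_inj; rewrite /= inordK.
rewrite [phi_pos _ _ _]/= -[if _ then _ else _]/(phi_pos n qh i.+1) IH; last lia.
rewrite odd_root_rec_step (_ : node n i = inord i.+1) ?qi_inner //; try lia.
by rewrite /node; congr inord; lia.
Qed.

Lemma phi_negE j : (j < n)%N -> phi_neg_rec n qh j = Y (n + j).
Proof.
elim: j => [|j IH] hj.
  have -> : (n + 0 = n.-1.+1)%N by lia.
  rewrite odd_root_rec_step (_ : node n n.-1 = inord n) ?qi_outer /=.
    by rewrite -phi_posE ?prednK //; lia.
  by rewrite /node; congr inord; lia.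
rewrite addnS odd_root_rec_step (_ : node n (n + j) = inord (n - j.+1)).
  by rewrite qi_inner /= ?IH //; lia.
by rewrite /node; congr inord; lia.
Qed.

Lemma proportional_prod (I : eqType) (s : seq I) (F G : I -> U) :
  {in s, forall i, proportional (F i) (G i)} ->
  proportional (\prod_(i <- s) F i) (\prod_(i <- s) G i).
Proof.
elim: s => [|i s IH] h; first by exists 1; rewrite !big_nil scale1r.
have [c hc] := h i (mem_head _ _).
have [|d hd] := IH; first by move=> j js; apply: h; rewrite inE js orbT.
by exists (c * d); rewrite !big_cons hc hd -scalerAl -scalerAr scalerA.
Qed.

Lemma asc_prodE (x : 'I_n.+1 -> U) m l : asc_prod qh x m l = \prod_(p <- iota m l) odd_root qh x p.
Proof. by elim: l m => [|l IH] m; rewrite ?big_nil //= big_cons IH. Qed.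

Lemma desc_prodE (x : 'I_n.+1 -> U) m : desc_prod qh x m = \prod_(p <- rev (iota 0 m)) odd_root qh x p.
Proof.
elim: m => [|m IH]; first by rewrite big_nil.
have -> : iota 0 m.+1 = iota 0 m ++ [:: m] by rewrite -addn1 iotaD.
by rewrite rev_cat /= big_cons IH.
Qed.

Lemma rev_iota1 : rev (iota 1 n) = [seq (n - j)%N | j <- iota 0 n].
Proof.
apply: (@eq_from_nth _ 0%N); first by rewrite size_rev size_map !size_iota.
move=> i; rewrite size_rev size_iota => hi.
rewrite nth_rev ?size_iota // (nth_map 0%N) ?size_iota // !nth_iota //; lia.
Qed.

Lemma rev_iota_shift : rev (iota n n) = [seq (n + (n - i))%N | i <- iota 1 n].
Proof.
apply: (@eq_from_nth _ 0%N); first by rewrite size_rev size_map !size_iota.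
move=> i; rewrite size_rev size_iota => hi.
rewrite nth_rev ?size_iota // (nth_map 0%N) ?size_iota // !nth_iota //; lia.
Qed.

Lemma iota_map a : iota a n = [seq (a + j)%N | j <- iota 0 n].
Proof. by rewrite -iotaDl addn0. Qed.

Lemma EE_asc : proportional (EE n qh) (asc_prod qh (negate0 (@ue K n qh)) 0 n.*2).
Proof.
rewrite asc_prodE -addnn iotaD big_cat /EE /=.
have [c hc] : proportional (\prod_(i <- iota 1 n) psi_pos n qh i) (\prod_(p <- iota 0 n) X p).
  rewrite (iota_map 1) big_map; apply: proportional_prod => i.
  by rewrite mem_iota add1n => hi; apply: psi_posE; lia.
have [d hd] : proportional (\prod_(i <- rev (iota 1 n)) psi_neg n qh i) (\prod_(p <- iota n n) X p).
  rewrite (iota_map n) rev_iota1 !big_map; apply: proportional_prod => j.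
  rewrite mem_iota /= => hj; rewrite /psi_neg subKn; last by lia.
  by apply: psi_negE; lia.
by exists (c * d); rewrite hc hd -scalerAl -scalerAr scalerA.
Qed.

Lemma FF_desc : FF n qh = desc_prod qh (@uf K n qh) n.*2.
Proof.
rewrite desc_prodE -addnn iotaD rev_cat big_cat /FF add0n; congr (_ * _).
  rewrite rev_iota_shift big_map big_seq [RHS]big_seq; apply: eq_bigr => i.
  by rewrite mem_iota => hi; rewrite /phi_neg phi_negE //; lia.
rewrite (iota_map 1) -map_rev big_map big_seq [RHS]big_seq.
apply: eq_bigr => i; rewrite mem_rev mem_iota add1n => hi.
by apply: phi_posE; lia.
Qed.

Lemma odd_root_odd (x : 'I_n.+1 -> U) : (forall i, hpart (i == ord0) (x i) = x i) ->
  forall p, (p < n.*2)%N -> hpart true (odd_root qh x p) = odd_root qh x p.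
Proof.
move=> hx; elim=> [|p IH] hp; first by rewrite odd_root_0; have := hx ord0; rewrite eqxx.
have ne : hpart false (x (node n p)) = x (node n p).
  by have := hx (node n p); rewrite (negPf (node_neq0 n_gt0 qh_neq0 _)) //; lia.
have hp' : (p < n.*2)%N by lia.
rewrite odd_root_rec_step linearB linearZ /=.
by rewrite -[true]/(false (+) true) hpartM_hom ?IH // -[false (+) true]/(true (+) false) hpartM_hom ?IH.
Qed.

Lemma asc_hpart (x : 'I_n.+1 -> U) : (forall i, hpart (i == ord0) (x i) = x i) ->
  forall l m, (m + l <= n.*2)%N -> hpart (odd l) (asc_prod qh x m l) = asc_prod qh x m l.
Proof.
move=> hx; elim=> [|l IH] m hm; first by rewrite /= hpart1.
rewrite /= -addTb; apply: hpartM_hom; first by apply: odd_root_odd => //; lia.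
by apply: IH; lia.
Qed.

Lemma desc_hpart (x : 'I_n.+1 -> U) : (forall i, hpart (i == ord0) (x i) = x i) ->
  forall m, (m <= n.*2)%N -> hpart (odd m) (desc_prod qh x m) = desc_prod qh x m.
Proof.
move=> hx; elim=> [|m IH] hm; first by rewrite /= hpart1.
rewrite /= -addTb; apply: hpartM_hom; first by apply: odd_root_odd => //; lia.
by apply: IH; lia.
Qed.

Lemma Gamma_proportional : exists c, Gamma n qh =
  c *: (asc_prod qh (negate0 (@ue K n qh)) 0 n.*2 * desc_prod qh (@uf K n qh) n.*2).
Proof. by have [c hc] := EE_asc; exists c; rewrite /Gamma hc FF_desc scalerAl. Qed.

Lemma Gamma_even : hpart false (Gamma n qh) = Gamma n qh.
Proof.
have [c ->] := Gamma_proportional; rewrite linearZ /=; congr (_ *: _).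
rewrite -[false]/(false (+) false); apply: hpartM_hom; rewrite -(odd_double n).
  apply: asc_hpart => // i; rewrite /negate0; case: eqP => [->|/eqP i0].
    rewrite linearN /=; by have := ue_hom qh (ord0 : 'I_n.+1); rewrite eqxx => ->.
  by have := ue_hom qh i; rewrite (negPf i0).
by apply: desc_hpart => // i; exact: uf_hom.
Qed.

End Gamma.

Theorem theorem7 (R : realType) (n : nat) (q qh : R[i])
  (n_ge1 : (1 <= n)%N)
  (q_neq0 : q != 0)
  (q_generic : forall m : nat, (0 < m)%N -> q ^+ m != 1)
  (qh_sqrt : qh ^+ 2 = q)
  (int0 : Aesub n qh -> R[i])
  (int0_left : left_integral (@coprod _ _ (Aesub n qh)) (resA (A_one n qh)) int0)
  (int0_one : int0 (resA (A_one n qh)) = 1) :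
  left_integral (@coprod _ _ (Asub n qh)) (A_one n qh)
    (conv (@coprod _ _ (Asub n qh)) (nu (Gamma n qh))
       (fun a : Asub n qh => int0 (resA a))).
Proof.
have qh_neq0 : qh != 0 by apply: contraNneq q_neq0 => qh0; rewrite -qh_sqrt qh0 expr0n.
apply: left_integral_of_even_invariant => //.
- by move=> m m0; rewrite qh_sqrt q_generic.
- exact: Gamma_even.
- exact: Gamma_proportional.
Qed.
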